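(* Let $\beta>1$, let $h\in M^{\beta,+}_G(0,T)$, and suppose that $A_t=\int_0^t h_s\,d\langle B\rangle_s$, $t\in[0,T]$, is a process with stationary and independent increments w.r.t. the filtration. Then there exists a constant $c\ge0$ such that $A_t=c\langle B\rangle_t$ for all $t\in[0,T]$.
   Context: **Sublinear expectations.** A sublinear expectation space $(\Omega,\mathcal H,\hat E)$ consists of a set $\Omega$, a vector lattice $\mathcal H$ of real functions on $\Omega$ containing the constants, and $\hat E:\mathcal H\to\mathbb R$ that is monotone, preserves constants, is sub-additive ($\hat E(X)-\hat E(Y)\le \hat E(X-Y)$) and positively homogeneous. $C_{l,Lip}(\mathbb R^n)$ is the set of continuous $\varphi$ with $|\varphi(x)-\varphi(y)|\le C(1+|x|^k+|y|^k)|x-y|$ for some $C,k$; $C_{b,Lip}$ is the set of bounded Lipschitz functions. Random vectors $X_1,X_2$ (possibly on different spaces) are identically distributed, $X_1\sim X_2$, if $\hat E_1[\varphi(X_1)]=\hat E_2[\varphi(X_2)]$ for all $\varphi\in C_{l,Lip}(\mathbb R^n)$. $Y$ is independent of $X$ if $\hat E[\varphi(X,Y)]=\hat E[\hat E[\varphi(x,Y)]_{x=X}]$ for all $\varphi\in C_{b,Lip}$. **$G$-expectation.** Fix $T>0$, $\overline\sigma>\underline\sigma>0$ and $G(a)=\frac12(\overline\sigma^2a^+-\underline\sigma^2a^-)$. A random variable $\xi$ is $G$-normal if $a\xi+b\hat\xi\sim\sqrt{a^2+b^2}\,\xi$ for all $a,b\ge0$, with $\hat\xi$ an independent copy of $\xi$,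 and $\frac12\hat E[a\xi^2]=G(a)$ for all $a\in\mathbb R$. Let $\Omega_T=C_0([0,T];\mathbb R)$ (continuous paths starting at $0$, sup norm), $B$ the coordinate process, and $\mathcal H^0_T=\{\varphi(B_{t_1},\dots,B_{t_n}): n\ge1,\ t_i\in[0,T],\ \varphi\in C_{l,Lip}(\mathbb R^n)\}$. For $0=t_0<\dots<t_m\le T$ put $\hat E[\varphi(B_{t_1}-B_{t_0},\dots,B_{t_m}-B_{t_{m-1}})]=\tilde E[\varphi(\sqrt{t_1-t_0}\,\xi_1,\dots,\sqrt{t_m-t_{m-1}}\,\xi_m)]$, where the $\xi_i$ are $G$-normal on some sublinear expectation space with $\xi_{i+1}$ independent of $(\xi_1,\dots,\xi_i)$. $L^p_G(\Omega_T)$ ($p\ge1$) is the completion of $\mathcal H^0_T$ under $\|\xi\|_{p,G}=\hat E[|\xi|^p]^{1/p}$; $L^p_G(\Omega_t)$ is defined in the same way with time points in $[0,t]$. $\hat E$ extends continuously to $L^1_G(\Omega_T)$. **The space $M^p_G(0,T)$.** $L_{ip}(\Omega_t)=\{\varphi(B_{t_1},\dots,B_{t_n}): t_i\in[0,t],\ \varphi\in C_{b,Lip}(\mathbb R^n)\}$. $H^0_G(0,T)$ is the set of processes $\eta_t=\sum_{j=0}^{N-1}\xi_j1_{]t_j,t_{j+1}]}(t)$ with $0=t_0<\dots<t_N=T$ and $\xi_j\in L_{ip}(\Omega_{t_j})$. $M^p_G(0,T)$ is its completion under $\|\eta\|_{M^p_G}=\{\hat E\int_0^T|\eta_s|^p\,ds\}^{1/p}$.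 $M^{p,+}_G(0,T)$ denotes the set of non-negative elements of $M^p_G(0,T)$. **Quadratic variation of $B$.** $\langle B\rangle_t$ is the $L^1_G$-limit of $\sum_k(B_{t_{k+1}}-B_{t_k})^2$ along partitions of $[0,t]$ with mesh tending to $0$; it satisfies $\underline\sigma^2(t-s)\le\langle B\rangle_t-\langle B\rangle_s\le\overline\sigma^2(t-s)$ for $s<t$. For $\eta\in H^0_G(0,T)$, $\int_0^t\eta_s\,d\langle B\rangle_s=\sum_j\xi_j(\langle B\rangle_{t_{j+1}\wedge t}-\langle B\rangle_{t_j\wedge t})$, extended continuously to $\eta\in M^1_G(0,T)$ with values in $L^1_G(\Omega_t)$. **Increments.** For elements of $L^1_G(\Omega_T)$, identity in distribution and independence are tested with bounded Lipschitz functions. $\{X_t\}$ has stationary increments if $X_{t+r}-X_{s+r}\sim X_t-X_s$ whenever $0\le s\le t$, $r\ge0$, $t+r\le T$. $\{X_t\}$ with $X_t\in L^1_G(\Omega_t)$ for every $t$ has independent increments w.r.t. the filtration if for all $0<s<T$ and $0\le s_0\le\dots\le s_m\le s\le t_0\le\dots\le t_n\le T$ the vector $(X_{t_1}-X_{t_0},\dots,X_{t_n}-X_{t_{n-1}})$ is independent of $(B_{s_1}-B_{s_0},\dots,B_{s_m}-B_{s_{m-1}})$. *)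

(* Defs.v *)
From HB Require Import structures.
From mathcomp Require Import all_boot all_order all_algebra.
From mathcomp Require Import all_classical all_reals all_analysis.
Set Implicit Arguments.
Unset Strict Implicit.
Unset Printing Implicit Defensive.
Import Order.TTheory GRing.Theory Num.Theory.
Import numFieldNormedType.Exports.
Local Open Scope classical_set_scope.
Local Open Scope ring_scope.

Record sublinear_expectation (R : realType) (Om : Type)
    (H : set (Om -> R)) (E : (Om -> R) -> R) : Prop := SublinearExpectation {
  rv_cst : forall c : R, H (fun=> c) ;
  rv_add : forall X Y, H X -> H Y -> H (fun w => X w + Y w) ;
  rv_scale : forall (c : R) X, H X -> H (fun w => c * X w) ;
  rv_max : forall X Y, H X -> H Y -> H (fun w => Num.max (X w) (Y w)) ;
  sexp_monotone : forall X Y, H X -> H Y -> (forall w, X w <= Y w) -> E X <= E Y ;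
  sexp_cst : forall c : R, E (fun=> c) = c ;
  sexp_subadditive : forall X Y, H X -> H Y ->
    E X - E Y <= E (fun w => X w - Y w) ;
  sexp_homogeneous : forall (c : R) X, 0 <= c -> H X ->
    E (fun w => c * X w) = c * E X }.

(** The test functions are defined on an arbitrary normed space [V]; only
    [V = R], ['rV[R]_n] and products of these (all with the max norm) are used.
    Since all norms on R^n are equivalent, the classes do not depend on the
    norm.  Continuity follows from the local Lipschitz bound. *)
Definition C_lLip (R : realType) (V : normedModType R) : set (V -> R) :=
  [set phi | exists (C : R) (k : nat), forall x y : V,
     `|phi x - phi y| <= C * (1 + `|x| ^+ k + `|y| ^+ k) * `|x - y|].

Definition C_bLip (R : realType) (V : normedModType R) : set (V -> R) :=
  [set phi | bounded_fun phi /\ lipschitz phi].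

(** [H] is only assumed to be a vector lattice, hence the requirement that all
    [phi (X)] belong to the domain of the expectation. *)
Definition random_vector (R : realType) (V : normedModType R) (Om : Type)
    (H : set (Om -> R)) (X : Om -> V) : Prop :=
  forall phi : V -> R, C_lLip phi -> H (phi \o X).

Definition same_law (R : realType) (V : normedModType R) (Om1 Om2 : Type)
    (E1 : (Om1 -> R) -> R) (X1 : Om1 -> V)
    (E2 : (Om2 -> R) -> R) (X2 : Om2 -> V) : Prop :=
  forall phi : V -> R, C_lLip phi -> E1 (phi \o X1) = E2 (phi \o X2).

(** [Y] is independent of [X] (the notion is not symmetric). *)
Definition independent_of (R : realType) (V W : normedModType R) (Om : Type)
    (H : set (Om -> R)) (E : (Om -> R) -> R) (Y : Om -> W) (X : Om -> V) : Prop :=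
  random_vector H (fun w => (X w, Y w)) /\
  forall phi : V * W -> R, C_bLip phi ->
    E (fun w => phi (X w, Y w)) = E (fun w => E (fun w' => phi (X w, Y w'))).

Definition Gfun (R : realType) (slo shi a : R) : R :=
  2^-1 * (shi ^+ 2 * Num.max a 0 - slo ^+ 2 * Num.max (- a) 0).

Definition G_normal (R : realType) (slo shi : R) (Om : Type)
    (H : set (Om -> R)) (E : (Om -> R) -> R) (xi : Om -> R) : Prop :=
  [/\ random_vector H xi,
      exists xi' : Om -> R,
        [/\ same_law E xi' E xi,
            independent_of H E xi' xi &
            forall a b : R, 0 <= a -> 0 <= b ->
              same_law E (fun w => a * xi w + b * xi' w)
                       E (fun w => Num.sqrt (a ^+ 2 + b ^+ 2) * xi w)] &
      forall a : R, 2^-1 * E (fun w => a * xi w ^+ 2) = Gfun slo shi a].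

(** C_0([0,T]; R).  A path is extended by 0 outside of [0,T], so that equality
    of paths is equality on [0,T]. *)
Record Omega (R : realType) (T : R) := MkOmega {
  path_fun :> R -> R ;
  path_continuous : {within `[0, T], continuous path_fun} ;
  path_start : path_fun 0 = 0 ;
  path_out : forall t, t \notin `[0, T] -> path_fun t = 0 }.

(** H^0_t, the functions phi (B_{t_1}, ..., B_{t_n}) with t_i in [0,t]; the
    value at time [t] of the coordinate process is [w t]. *)
Definition H0 (R : realType) (T t : R) : set (Omega T -> R) :=
  [set X | exists (n : nat) (ts : 'I_n.+1 -> R) (phi : 'rV[R]_n.+1 -> R),
     [/\ forall i, 0 <= ts i <= t, C_lLip phi &
         X = fun w : Omega T => phi (\row_i w (ts i))]].

Definition Lip (R : realType) (T t : R) : set (Omega T -> R) :=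
  [set X | exists (n : nat) (ts : 'I_n.+1 -> R) (phi : 'rV[R]_n.+1 -> R),
     [/\ forall i, 0 <= ts i <= t, C_bLip phi &
         X = fun w : Omega T => phi (\row_i w (ts i))]].

Definition G_expectation (R : realType) (T slo shi : R)
    (E : (Omega T -> R) -> R) : Prop :=
  sublinear_expectation (@H0 R T T) E /\
  exists (Om : Type) (H : set (Om -> R)) (E' : (Om -> R) -> R)
         (xi : nat -> Om -> R),
    [/\ sublinear_expectation H E',
        forall i, G_normal slo shi H E' (xi i),
        forall i, independent_of H E' (xi i.+1)
                    (fun w => \row_(j < i.+1) xi j w) &
        forall (m : nat) (t : nat -> R) (phi : 'rV[R]_m.+1 -> R),
          t 0%N = 0 -> (forall i, (i <= m)%N -> t i < t i.+1) -> t m.+1 <= T ->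
          C_lLip phi ->
          E (fun w => phi (\row_(i < m.+1) (w (t i.+1) - w (t i)))) =
          E' (fun w =>
            phi (\row_(i < m.+1) (Num.sqrt (t i.+1 - t i) * xi i w)))].

(** An element of the completion of a space of functions under a seminorm [N]
    is represented by an [N]-Cauchy sequence; equality in the completion is
    [N]-convergence to 0 of the difference of two representatives. *)

Definition cauchy_for (R : realType) (V : zmodType) (N : V -> R)
    (u : nat -> V) : Prop :=
  forall e : R, 0 < e -> exists n0 : nat, forall m n : nat,
    (n0 <= m)%N -> (n0 <= n)%N -> N (u m - u n) < e.

(** Random variables in the completion L^1_G are sequences of random variables. *)
Definition rvseq (R : realType) (T : R) := nat -> Omega T -> R.

Definition L1norm (R : realType) (T : R) (E : (Omega T -> R) -> R)
    (X : Omega T -> R) : R := E (fun w => `|X w|).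

Definition L1G (R : realType) (T : R) (E : (Omega T -> R) -> R) (t : R) :
    set (rvseq T) :=
  [set X | (forall n, H0 t (X n)) /\ cauchy_for (L1norm E) X].

Definition L1G_eq (R : realType) (T : R) (E : (Omega T -> R) -> R)
    (X Y : rvseq T) : Prop :=
  L1norm E (fun w => X n w - Y n w) @[n --> \oo] --> (0 : R).

(** Continuous extension of [E] to L^1_G. *)
Definition Eext (R : realType) (T : R) (E : (Omega T -> R) -> R)
    (X : rvseq T) : R := limn (fun n => E (X n)).

Definition L1G_dist (R : realType) (T : R) (E : (Omega T -> R) -> R)
    (X Y : rvseq T) : R := Eext E (fun n w => `|X n w - Y n w|).

(** The [j]-th point of the partition 0 = t_0 < t_1 < ... < t_N given by the
    list [s] of its points t_1, ..., t_N. *)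
Definition node (R : realType) (s : seq R) (j : nat) : R := nth 0 (0 :: s) j.

Record simple_process (R : realType) (T : R) := SimpleProcess {
  sp_times : seq R ;
  sp_coef : nat -> Omega T -> R ;
  sp_partition : itv_partition 0 T sp_times ;
  sp_adapted : forall j, (j < size sp_times)%N ->
    Lip (node sp_times j) (sp_coef j) }.

Definition sp_val (R : realType) (T : R) (eta : simple_process T) :
    R -> Omega T -> R :=
  fun t w => \sum_(0 <= j < size (sp_times eta))
    sp_coef eta j w *
    \1_(`]node (sp_times eta) j, node (sp_times eta) j.+1]%classic) t.

Definition Mnorm (R : realType) (T : R) (E : (Omega T -> R) -> R) (p : R)
    (eta : R -> Omega T -> R) : R :=
  E (fun w => \int[@lebesgue_measure R]_(s in `[0, T]) (`|eta s w| `^ p))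
    `^ p^-1.

Definition MG (R : realType) (T : R) (E : (Omega T -> R) -> R) (p : R) :
    set (nat -> simple_process T) :=
  [set h | cauchy_for (Mnorm E p) (fun n => sp_val (h n))].

(** The negative part of [h], extended by continuity to M^p_G, vanishes. *)
Definition MG_nonneg (R : realType) (T : R) (E : (Omega T -> R) -> R) (p : R)
    (h : nat -> simple_process T) : Prop :=
  Mnorm E p (fun s w => Num.max (- sp_val (h n) s w) 0) @[n --> \oo] --> (0 : R).

Definition quadratic_variation (R : realType) (T : R)
    (E : (Omega T -> R) -> R) (Q : R -> rvseq T) : Prop :=
  forall t, 0 <= t <= T ->
    L1G E t (Q t) /\
    forall e : R, 0 < e -> exists2 d : R, 0 < d &
      forall s : seq R, itv_partition 0 t s ->
        (forall k, (k < size s)%N -> node s k.+1 - node s k < d) ->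
        L1G_dist E
          (fun _ w => \sum_(0 <= k < size s) (w (node s k.+1) - w (node s k)) ^+ 2)
          (Q t) < e.

Definition sp_integral (R : realType) (T : R) (Q : R -> rvseq T)
    (eta : simple_process T) (t : R) : rvseq T :=
  fun n w => \sum_(0 <= j < size (sp_times eta))
    sp_coef eta j w *
    (Q (Num.min (node (sp_times eta) j.+1) t) n w -
     Q (Num.min (node (sp_times eta) j) t) n w).

(** [A] is the integral of [h] over [0,t] against d<B>, i.e. the L^1_G-limit of
    the integrals of the simple processes defining [h].  A Cauchy sequence for
    the norm of M^p_G, p >= 1, is also one for the norm of M^1_G. *)
Definition is_integral (R : realType) (T : R) (E : (Omega T -> R) -> R)
    (Q : R -> rvseq T) (h : nat -> simple_process T) (t : R) (A : rvseq T) : Prop :=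
  L1G E t A /\
  L1G_dist E A (sp_integral Q (h n) t) @[n --> \oo] --> (0 : R).

Definition L1G_same_law (R : realType) (T : R) (E : (Omega T -> R) -> R)
    (X Y : rvseq T) : Prop :=
  forall phi : R -> R, C_bLip phi ->
    Eext E (fun n w => phi (X n w)) = Eext E (fun n w => phi (Y n w)).

(** Random vectors in L^1_G are represented by sequences of random vectors. *)
Definition L1G_independent_of (R : realType) (V W : normedModType R) (T : R)
    (E : (Omega T -> R) -> R)
    (Y : nat -> Omega T -> W) (X : nat -> Omega T -> V) : Prop :=
  forall phi : V * W -> R, C_bLip phi ->
    Eext E (fun n w => phi (X n w, Y n w)) =
    Eext E (fun n w => Eext E (fun k w' => phi (X n w, Y k w'))).

Definition stationary_increments (R : realType) (T : R)
    (E : (Omega T -> R) -> R) (X : R -> rvseq T) : Prop :=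
  forall s t r : R, 0 <= s -> s <= t -> 0 <= r -> t + r <= T ->
    L1G_same_law E (fun n w => X (t + r) n w - X (s + r) n w)
                   (fun n w => X t n w - X s n w).

Definition independent_increments (R : realType) (T : R)
    (E : (Omega T -> R) -> R) (X : R -> rvseq T) : Prop :=
  (forall t, 0 <= t <= T -> L1G E t (X t)) /\
  forall (s : R) (m n : nat) (ss ts : nat -> R),
    0 < s < T ->
    0 <= ss 0%N -> (forall i, (i < m)%N -> ss i <= ss i.+1) -> ss m <= s ->
    s <= ts 0%N -> (forall j, (j < n)%N -> ts j <= ts j.+1) -> ts n <= T ->
    L1G_independent_of E
      (fun k w => \row_(j < n) (X (ts j.+1) k w - X (ts j) k w))
      (fun _ w => \row_(i < m) (w (ss i.+1) - w (ss i))).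

(* Main.v *)
Require Import Defs.
From HB Require Import structures.
From mathcomp Require Import all_boot all_order all_algebra.
From mathcomp Require Import all_classical all_reals all_analysis.
From mathcomp Require Import ring lra measurable_realfun.
Set Implicit Arguments.
Unset Strict Implicit.
Unset Printing Implicit Defensive.
Import Order.TTheory GRing.Theory Num.Theory.
Import numFieldNormedType.Exports.
Local Open Scope classical_set_scope.
Local Open Scope ring_scope.

(** Let [v = shi ^+ 2] be the upper variance. By independence and stationarity of
    its increments, the mean of [A] is additive in time and homogeneous, so that
    the increment of [A] over [s,t] has mean [lam * (t - s)] for some [lam >= 0]
    ([A_mean]). The claim is that [h = c] for [c := lam / v].

    A random variable [Y] is called neutral at time [s] if adding it to any
    random variable known at time [s] does not change the expectation; the idea
    is that its conditional expectation vanishes. Two families of neutral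
    variables are available: the compensated increments
    [A t - A s - lam * (t - s)] of [A], times a nonnegative weight known at time
    [s] ([neutral_dA], from the independence of increments), and those of the
    quadratic variation, [Q t - Q s - v * (t - s)], times a nonnegative constant
    ([neutral_dQ], since [v] is the largest possible volatility).

    Let [Phi] be a bounded Lipschitz functional of finitely many values of the
    path. Given a partition, split off from each of its intervals a last part, of
    relative length [th]. If [th] is small, [Phi] hardly depends on the
    increments of the path over the last parts; therefore variables carried by
    the last parts and neutral at their beginnings can be added to [Phi] without
    changing its expectation by much ([insertion]).

    For the upper bound ([integrand_le]), [Phi] is the integral of
    [max (h - c) 0], and the variables inserted are a large multiple of
    [Q t - Q s - v * (t - s)]. They penalize any volatility below the maximal
    one, so that on the last parts the increment of [A], the integral of [h]
    with respect to [Q], is [v] times the integral of [h] up to terms that the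
    penalty absorbs ([upper_step]). But the compensated increments of [A],
    weighted by an approximate indicator of [h > c], have mean zero. Hence [Phi]
    has expectation at most 0, and [h <= c].

    For the lower bound ([integrand_ge]), [Phi] is the integral of
    [max (c - h) 0], and the variables inserted are the compensated increments
    of [A], divided by [th * v]. As the volatility is at most [v] and [h] is
    nonnegative, an increment of [A] is at most [v] times the integral of [h]
    over the last part, so the inserted terms compensate [Phi] up to the
    integral of [max (h - c) 0], which is known to vanish ([lower_step]).

    All this is carried out for the simple processes [h n], on partitions that
    refine those of [h n] and of a second, better approximation [h n1]: the
    integrals over the last parts, of total length [th * T], have to be
    approximated up to an error that is small relative to [th]
    ([integral_approx]). Both bounds together say that [h n] tends to [c] in
    M^1, and [A] is [c] times [Q] by continuity of the integral
    ([integral_constant]). The law of the canonical process enters through its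
    first, second and fourth moments and the independence of its increments
    only ([G_brownian]). *)

(** * Sublinear expectations *)

Section SublinearExpectation.
Context {R : realType} {Om : Type} {H : set (Om -> R)} {E : (Om -> R) -> R}.
Context (sE : sublinear_expectation H E).

Lemma rv_opp X : H X -> H (fun w => - X w).
Proof.
by move=> HX; have := rv_scale sE (-1) HX; under eq_fun do rewrite mulN1r.
Qed.

Lemma rv_sub X Y : H X -> H Y -> H (fun w => X w - Y w).
Proof. by move=> HX HY; exact: (rv_add sE HX (rv_opp HY)). Qed.

Lemma rv_abs X : H X -> H (fun w => `|X w|).
Proof.
move=> HX; have := rv_max sE HX (rv_opp HX).
by under eq_fun do rewrite maxrN.
Qed.

Lemma rv_sum n (X : nat -> Om -> R) : (forall i, (i < n)%N -> H (X i)) ->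
  H (fun w => \sum_(0 <= i < n) X i w).
Proof.
elim: n => [|n IH] HX.
  by under eq_fun do rewrite big_geq//; exact: (rv_cst sE).
under eq_fun do rewrite big_nat_recr//=.
by apply: (rv_add sE); [apply: IH => i /ltnW; exact: HX | exact: HX].
Qed.

Lemma sexp_add X Y : H X -> H Y -> E (fun w => X w + Y w) <= E X + E Y.
Proof.
move=> HX HY; have := sexp_subadditive sE (rv_add sE HX HY) HY.
under [X in _ - _ <= E X]eq_fun do rewrite addrK.
lra.
Qed.

Lemma sexp_addc c X : H X -> E (fun w => X w + c) = E X + c.
Proof.
move=> HX; have Hc := rv_cst sE; apply/eqP; rewrite eq_le; apply/andP; split.
  by rewrite -[c in leRHS](sexp_cst sE); exact: sexp_add.
have := sexp_add (rv_add sE HX (Hc c)) (Hc (- c)).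
under [X in E X <= _]eq_fun do rewrite addrK.
by rewrite (sexp_cst sE); lra.
Qed.

Lemma sexp_dist X Y : H X -> H Y -> `|E X - E Y| <= E (fun w => `|X w - Y w|).
Proof.
have half U V : H U -> H V -> E U - E V <= E (fun w => `|U w - V w|).
  move=> HU HV; apply: (le_trans (sexp_subadditive sE HU HV)).
  apply: (sexp_monotone sE); [exact: rv_sub | exact/rv_abs/rv_sub |].
  by move=> w; exact: ler_norm.
move=> HX HY; rewrite ler_norml half// andbT lerNl opprB.
by under eq_fun do rewrite distrC; exact: half.
Qed.

Lemma sexp_ge0 X : H X -> (forall w, 0 <= X w) -> 0 <= E X.
Proof.
move=> HX X0; rewrite -(sexp_cst sE 0).
exact: (sexp_monotone sE (rv_cst sE 0)).
Qed.

Lemma sexp_le_cst X c : H X -> (forall w, X w <= c) -> E X <= c.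
Proof.
move=> HX Xc; rewrite -(sexp_cst sE c).
exact: (sexp_monotone sE HX (rv_cst sE c)).
Qed.

Lemma sexp_opp X : H X -> - E (fun w => - X w) <= E X.
Proof.
move=> HX; have := sexp_add HX (rv_opp HX).
by under [X in E X <= _]eq_fun do rewrite subrr; rewrite (sexp_cst sE); lra.
Qed.

Lemma sexp_sum n (X : nat -> Om -> R) : (forall i, (i < n)%N -> H (X i)) ->
  E (fun w => \sum_(0 <= i < n) X i w) <= \sum_(0 <= i < n) E (X i).
Proof.
elim: n => [|n IH] HX.
  under [X in E X]eq_fun do rewrite big_geq//.
  by rewrite big_geq// (sexp_cst sE).
under [X in E X]eq_fun do rewrite big_nat_recr//=.
rewrite big_nat_recr//=; have HX' i : (i < n)%N -> H (X i) by move=> /ltnW/HX.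
apply: le_trans (lerD (IH HX') (lexx _)).
by apply: sexp_add; [exact: rv_sum | exact: HX].
Qed.

(** Pointwise, [|x| <= x^2 / a + a]; for a small second moment and a suitable
    [a] this is as good as the Cauchy-Schwarz inequality. *)
Lemma sexp_abs_le_sqr X (a : R) : 0 < a -> H X -> H (fun w => X w ^+ 2) ->
  E (fun w => `|X w|) <= a^-1 * E (fun w => X w ^+ 2) + a.
Proof.
move=> a0 HX HX2; have a1 : 0 <= a^-1 by rewrite invr_ge0 ltW.
have HaX := rv_scale sE a^-1 HX2.
rewrite -(sexp_homogeneous sE a1 HX2) -(sexp_addc _ HaX).
apply: (sexp_monotone sE); [exact: rv_abs | exact: (rv_add sE HaX (rv_cst sE a)) |].
move=> w /=; rewrite -(real_normK (num_real (X w))).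
have := normr_ge0 (X w); set x := `|X w| => x0.
case: (leP x a) => [xa|ax].
  by rewrite (le_trans xa)// lerDr mulr_ge0// sqr_ge0.
apply: le_trans (_ : a^-1 * x ^+ 2 <= _); last by rewrite lerDl ltW.
by rewrite expr2 mulrA ler_peMl// ler_pdivlMl// mulr1 ltW.
Qed.
End SublinearExpectation.

(** * Locally Lipschitz functions of polynomial growth *)

Lemma max_lip {R : realType} (c x y : R) :
  `|Num.max x c - Num.max y c| <= `|x - y|.
Proof.
have := ler_norm (x - y); have := ler_norm (y - x); rewrite [`|y - x|]distrC.
move: `|x - y| => d h1 h2; rewrite ler_norml.
by case: (leP x c); case: (leP y c) => *; apply/andP; split; lra.
Qed.

Lemma min_lip {R : realType} (c x y : R) :
  `|Num.min x c - Num.min y c| <= `|x - y|.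
Proof.
have := ler_norm (x - y); have := ler_norm (y - x); rewrite [`|y - x|]distrC.
move: `|x - y| => d h1 h2; rewrite ler_norml.
by case: (leP x c); case: (leP y c) => *; apply/andP; split; lra.
Qed.

Section PolyLipschitz.
Context {R : realType}.

(** The class [C_lLip], over any set with a size [N] and a distance [D] so as
    to cover functions of a vector and functions of finitely many values of a
    path alike. *)
Definition plip (A : Type) (N : A -> R) (D : A -> A -> R) : set (A -> R) :=
  [set f | exists (C : R) (k : nat), 0 <= C /\ forall a b : A,
     `|f a - f b| <= C * (1 + N a + N b) ^+ k * D a b].

Definition blip (A : Type) (D : A -> A -> R) : set (A -> R) :=
  [set f | exists C : R, [/\ 0 <= C, forall a, `|f a| <= C &
     forall a b, `|f a - f b| <= C * D a b]].

Context {A : Type} {N : A -> R} {D : A -> A -> R}.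
Context (N0 : forall a, 0 <= N a) (D0 : forall a b, 0 <= D a b).

Lemma weight_ge1 a b : 1 <= 1 + N a + N b.
Proof. by rewrite -addrA lerDl addr_ge0. Qed.

Lemma weight_le k l a b : (k <= l)%N ->
  (1 + N a + N b) ^+ k <= (1 + N a + N b) ^+ l.
Proof. by move=> kl; apply: ler_weXn2l => //; exact: weight_ge1. Qed.

Lemma weight_ge0 k a b : 0 <= (1 + N a + N b) ^+ k.
Proof. by rewrite exprn_ge0// (le_trans ler01)// weight_ge1. Qed.

Lemma blip_plip : blip D `<=` plip N D.
Proof.
by move=> f [C [C0 _ fl]]; exists C, 0%N; split=> // a b; rewrite expr0 mulr1.
Qed.

Lemma plip_cst c : plip N D (fun=> c).
Proof. by exists 0, 0%N; split=> // a b; rewrite subrr normr0 !mul0r. Qed.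

Lemma plip_add f g : plip N D f -> plip N D g -> plip N D (fun a => f a + g a).
Proof.
move=> [C [k [C0 fl]]] [C' [k' [C'0 gl]]].
exists (C + C'), (maxn k k'); split=> [|a b]; first exact: addr_ge0.
rewrite opprD addrACA (le_trans (ler_normD _ _))// mulrDl mulrDl lerD//.
  rewrite (le_trans (fl a b))// ler_wpM2r// ler_wpM2l//.
  by apply: weight_le; exact: leq_maxl.
rewrite (le_trans (gl a b))// ler_wpM2r// ler_wpM2l//.
by apply: weight_le; exact: leq_maxr.
Qed.

Lemma plip_lip1 (h : R -> R) f : (forall x y, `|h x - h y| <= `|x - y|) ->
  plip N D f -> plip N D (fun a => h (f a)).
Proof.
move=> hl [C [k [C0 fl]]]; exists C, k; split=> // a b.
exact: le_trans (hl _ _) (fl a b).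
Qed.

Lemma plip_opp f : plip N D f -> plip N D (fun a => - f a).
Proof. by apply: (@plip_lip1 -%R) => x y; rewrite -opprD normrN. Qed.

Lemma plip_abs f : plip N D f -> plip N D (fun a => `|f a|).
Proof. by apply: (@plip_lip1 Num.norm) => x y; exact: ler_dist_dist. Qed.

Lemma plip_scale c f : plip N D f -> plip N D (fun a => c * f a).
Proof.
move=> [C [k [C0 fl]]]; exists (`|c| * C), k; split=> [|a b].
  by rewrite mulr_ge0.
by rewrite -mulrBr normrM -!mulrA ler_wpM2l// mulrA fl.
Qed.

Lemma plip_max f g : plip N D f -> plip N D g ->
  plip N D (fun a => Num.max (f a) (g a)).
Proof.
move=> fp gp.
have -> : (fun a => Num.max (f a) (g a)) =
    (fun a => 2^-1 * (f a + g a + `|f a + - g a|)).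
  by apply/funext => a; rewrite maxr_absE mulrC.
apply: plip_scale; apply: plip_add; first exact: plip_add.
by apply: plip_abs; apply: plip_add => //; exact: plip_opp.
Qed.

Lemma blip_cst c : blip D (fun=> c).
Proof.
by exists `|c|; split=> // a b; rewrite subrr normr0 mulr_ge0.
Qed.

Lemma blip_lip (h : R -> R) (L : R) f :
  (forall x y, `|h x - h y| <= L * `|x - y|) ->
  blip D f -> blip D (fun a => h (f a)).
Proof.
move=> hl [C [C0 fC fl]].
have L0 : 0 <= L by have := hl 1 0; rewrite subr0 normr1 mulr1; apply: le_trans.
exists (`|h 0| + L * C); split=> [|a|a b].
- by rewrite addr_ge0// mulr_ge0.
- rewrite -[h (f a)](subrK (h 0)) addrC (le_trans (ler_normD _ _))// lerD2l.
  by rewrite (le_trans (hl _ _))// ler_wpM2l// subr0.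
- apply: le_trans (hl _ _) _; rewrite mulrDl -[leLHS]add0r lerD//.
    exact: mulr_ge0.
  by rewrite -mulrA ler_wpM2l.
Qed.

Lemma blip_add f g : blip D f -> blip D g -> blip D (fun a => f a + g a).
Proof.
move=> [C [C0 fC fl]] [C' [C'0 gC gl]]; exists (C + C'); split=> [|a|a b].
- exact: addr_ge0.
- by rewrite (le_trans (ler_normD _ _))// lerD.
- by rewrite opprD addrACA (le_trans (ler_normD _ _))// mulrDl lerD.
Qed.

Lemma blip_mul f g : blip D f -> blip D g -> blip D (fun a => f a * g a).
Proof.
move=> [C [C0 fC fl]] [C' [C'0 gC gl]].
exists (C * C' + C * C'); split=> [|a|a b].
- by rewrite addr_ge0// mulr_ge0.
- by rewrite normrM -[leLHS]addr0 lerD ?mulr_ge0// ler_pM.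
- have -> : f a * g a - f b * g b = f a * (g a - g b) + (f a - f b) * g b by ring.
  rewrite (le_trans (ler_normD _ _))// [leRHS]mulrDl !normrM lerD//.
    by rewrite -mulrA ler_pM.
  by rewrite mulrAC ler_pM.
Qed.

Context (ND : forall a b, `|N a - N b| <= D a b).
Context (DN : forall a b, D a b <= N a + N b).

Lemma plip_growth f : plip N D f ->
  exists (C : R) (k : nat), 0 <= C /\ forall a, `|f a| <= C * (1 + N a) ^+ k.
Proof.
move=> [C [k [C0 fl]]].
have [[a0 _]|noA] := pselect (exists a : A, True); last first.
  by exists 0, 0%N; split=> // a; exfalso; apply: noA; exists a.
exists (`|f a0| + C * (1 + N a0) ^+ k.+1), k.+1.
have w0 a : 0 <= 1 + N a by rewrite addr_ge0.
split=> [|a]; first by rewrite addr_ge0// mulr_ge0// exprn_ge0.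
rewrite -[f a](subrK (f a0)) addrC (le_trans (ler_normD _ _))// mulrDl lerD//.
  by rewrite ler_peMr// exprn_ege1// lerDl.
apply: le_trans (fl _ _) _; rewrite -!mulrA ler_wpM2l// -exprMn.
apply: (@le_trans _ _ ((1 + N a + N a0) ^+ k.+1)).
  rewrite exprSr ler_wpM2l ?weight_ge0// (le_trans (DN _ _))//.
  by rewrite -addrA lerDr.
apply: lerXn2r; rewrite ?nnegrE ?mulr_ge0// ?addr_ge0//.
by have := mulr_ge0 (N0 a) (N0 a0); lra.
Qed.

Lemma plip_mul f g : plip N D f -> plip N D g -> plip N D (fun a => f a * g a).
Proof.
move=> fp gp.
have [F [p [F0 fF]]] := plip_growth fp; have [G [q [G0 gG]]] := plip_growth gp.
have [C [k [C0 fl]]] := fp; have [C' [l [C'0 gl]]] := gp.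
have w1 a b p' : (1 + N a) ^+ p' <= (1 + N a + N b) ^+ p'.
  by apply: lerXn2r; rewrite ?nnegrE ?addr_ge0// lerDl.
have w2 a b p' : (1 + N b) ^+ p' <= (1 + N a + N b) ^+ p'.
  by rewrite addrAC; exact: w1.
have W0 a b := @weight_ge0 _ a b.
exists (F * C' + G * C), (maxn (p + l) (q + k)).
split=> [|a b]; first by rewrite addr_ge0// mulr_ge0.
have -> : f a * g a - f b * g b = f a * (g a - g b) + g b * (f a - f b) by ring.
rewrite (le_trans (ler_normD _ _))// !mulrDl !normrM lerD//.
- apply: (@le_trans _ _ (F * (1 + N a + N b) ^+ p * (C' * (1 + N a + N b) ^+ l * D a b))).
    rewrite ler_pM//; last by rewrite (le_trans (fF _))// ler_wpM2l.
  rewrite mulrA ler_wpM2r// mulrACA -exprD ler_wpM2l ?mulr_ge0//.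
  by apply: weight_le; exact: leq_maxl.
- apply: (@le_trans _ _ (G * (1 + N a + N b) ^+ q * (C * (1 + N a + N b) ^+ k * D a b))).
    rewrite ler_pM//; last by rewrite (le_trans (gG _))// ler_wpM2l.
  rewrite mulrA ler_wpM2r// mulrACA -exprD ler_wpM2l ?mulr_ge0//.
  by apply: weight_le; exact: leq_maxr.
Qed.

(** Multiplying by a cut-off at size [n] makes a function bounded and
    Lipschitz, at the price of one more power of the size in the error. *)
Lemma plip_cutoff f : plip N D f -> exists (C : R) (k : nat), 0 <= C /\
  forall n, exists2 g, blip D g &
    forall a, `|f a - g a| <= (n.+1%:R)^-1 * (C * (1 + N a) ^+ k).
Proof.
move=> fp; have [C [k [C0 fC]]] := plip_growth fp.
have [C' [l [C'0 fl]]] := fp.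
exists C, k.+1; split=> // n.
have [M M0 ->] : exists2 M : R, 0 < M & n.+1%:R = M.
  by exists n.+1%:R => //; rewrite ltr0n.
pose chi (r : R) := Num.max 0 (Num.min 1 (M + 1 - r)).
have chi_ge0 r : 0 <= chi r by rewrite le_max lexx.
have chi_le1 r : chi r <= 1 by rewrite ge_max ler01 ge_min lexx.
have chi_out r : M + 1 <= r -> chi r = 0.
  by move=> h; apply/max_idPl; rewrite ge_min subr_le0 h orbT.
have chi_in r : r <= M -> chi r = 1.
  by move=> h; rewrite /chi; have -> : Num.min 1 (M + 1 - r) = 1;
    [apply/min_idPl; lra | apply/max_idPr; exact: ler01].
have chi_lip x y : `|chi x - chi y| <= `|x - y|.
  rewrite /chi ![Num.max 0 _]maxC (le_trans (max_lip _ _ _))//.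
  rewrite ![Num.min 1 _]minC (le_trans (min_lip _ _ _))//.
  have -> : M + 1 - x - (M + 1 - y) = y - x by ring.
  by rewrite distrC.
have w0 a : 0 <= 1 + N a by rewrite addr_ge0.
exists (fun a => f a * chi (N a)); last first.
  move=> a; have [Na|Na] := leP (N a) M.
    by rewrite chi_in// mulr1 subrr normr0 !mulr_ge0 ?invr_ge0 ?exprn_ge0// ltW.
  rewrite -[X in `|X - _|]mulr1 -mulrBr normrM mulrC.
  apply: (@le_trans _ _ (1 * `|f a|)).
    by rewrite ler_wpM2r// ger0_norm ?subr_ge0// lerBlDr lerDl.
  rewrite mul1r (le_trans (fC a))// mulrCA ler_wpM2l// exprSr mulrCA.
  rewrite ler_peMr ?exprn_ge0// ler_pdivlMl// mulr1.
  by rewrite (le_trans (ltW Na))// lerDr.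
set B1 := C * (2 + M) ^+ k; set B2 := C' * (3 + 2 * M) ^+ l.
have B10 : 0 <= B1 by rewrite mulr_ge0// exprn_ge0// addr_ge0// ltW.
have B20 : 0 <= B2.
  by rewrite mulr_ge0// exprn_ge0// addr_ge0// mulr_ge0// ltW.
have f_in a : N a <= M + 1 -> `|f a| <= B1.
  move=> Na; rewrite (le_trans (fC a))// ler_wpM2l// lerXn2r ?nnegrE//.
    by rewrite addr_ge0// ltW.
  lra.
have key a b : N b <= M + 1 ->
    `|f a * chi (N a) - f b * chi (N b)| <= (B1 + B2) * D a b.
  move=> Nb; have -> : f a * chi (N a) - f b * chi (N b) =
    f b * (chi (N a) - chi (N b)) + chi (N a) * (f a - f b) by ring.
  rewrite (le_trans (ler_normD _ _))// mulrDl !normrM lerD//.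
    by rewrite ler_pM// ?f_in// (le_trans (chi_lip _ _)).
  have [Na|Na] := leP (M + 1) (N a).
    by rewrite chi_out// normr0 mul0r mulr_ge0.
  apply: (@le_trans _ _ (1 * `|f a - f b|)).
    by rewrite ler_wpM2r// ger0_norm.
  rewrite mul1r (le_trans (fl a b))// ler_wpM2r// ler_wpM2l//.
  rewrite lerXn2r ?nnegrE//; [by rewrite !addr_ge0| |].
    by rewrite addr_ge0// mulr_ge0// ltW.
  lra.
have Dsym a b : N a <= M + 1 -> M + 1 < N b -> 
    `|f a * chi (N a) - f b * chi (N b)| <= (B1 + B2) * D a b.
  move=> Na Nb; rewrite (chi_out _ (ltW Nb)) mulr0 subr0 normrM.
  rewrite mulrDl -[leLHS]addr0 lerD ?(mulr_ge0 B20)// ler_pM ?f_in//.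
  rewrite -[chi (N a)]subr0 -(chi_out _ (ltW Nb)).
  exact: le_trans (chi_lip _ _) (ND _ _).
exists (B1 + B2); split=> [|a|a b]; first exact: addr_ge0.
  have [Na|Na] := leP (M + 1) (N a).
    by rewrite chi_out// mulr0 normr0 addr_ge0.
  rewrite normrM -[leRHS]mulr1 ler_pM//; last by rewrite ger0_norm.
  by rewrite (le_trans (f_in _ (ltW Na)))// lerDl.
have [Nb|Nb] := leP (N b) (M + 1); first exact: key.
have [Na|Na] := leP (N a) (M + 1); first exact: Dsym.
rewrite (chi_out _ (ltW Na)) (chi_out _ (ltW Nb)) !mulr0 subrr normr0.
by rewrite mulr_ge0// addr_ge0.
Qed.
End PolyLipschitz.

Lemma plip_comp {R : realType} (A B : Type) (NA : A -> R) (DA : A -> A -> R)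
    (NB : B -> R) (DB : B -> B -> R) (g : A -> B) (K : R) (f : B -> R) :
  (forall a, 0 <= NA a) -> (forall a b, 0 <= DA a b) ->
  (forall a, 0 <= NB a) -> 0 <= K ->
  (forall a, NB (g a) <= K * (1 + NA a)) ->
  (forall a b, DB (g a) (g b) <= K * DA a b) ->
  plip NB DB f -> plip NA DA (f \o g).
Proof.
move=> NA0 DA0 NB0 K0 gN gD [C [k [C0 fl]]].
exists (C * (1 + 2 * K) ^+ k * K), k.
have K1 : 0 <= 1 + 2 * K by rewrite addr_ge0// mulr_ge0.
split=> [|a b /=]; first by rewrite !mulr_ge0// exprn_ge0.
apply: le_trans (fl _ _) _.
have W0 : 0 <= 1 + NB (g a) + NB (g b) by rewrite !addr_ge0.
apply: (@le_trans _ _ (C * (1 + NB (g a) + NB (g b)) ^+ k * (K * DA a b))).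
  by rewrite ler_wpM2l// mulr_ge0// exprn_ge0.
rewrite mulrA ler_wpM2r// -[leRHS]mulrA [K * _]mulrC mulrA ler_wpM2r//.
rewrite -mulrA ler_wpM2l// -exprMn.
rewrite lerXn2r ?nnegrE ?(mulr_ge0 K1) ?addr_ge0 ?addr_ge0//.
have := gN a; have := gN b; have := mulr_ge0 K0 (NA0 a).
have := mulr_ge0 K0 (NA0 b); have := NA0 a; have := NA0 b; lra.
Qed.

Lemma blip_comp {R : realType} (A B : Type) (DA : A -> A -> R)
    (DB : B -> B -> R) (g : A -> B) (K : R) (f : B -> R) :
  (forall a b, 0 <= DA a b) -> 0 <= K ->
  (forall a b, DB (g a) (g b) <= K * DA a b) ->
  blip DB f -> blip DA (f \o g).
Proof.
move=> DA0 K0 gD [C [C0 fC fl]]; exists (C * (1 + K)); split=> [|a|a b] /=.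
- by rewrite mulr_ge0// addr_ge0.
- by rewrite (le_trans (fC _))// ler_peMr// lerDl.
- apply: le_trans (fl _ _) _; rewrite -mulrA ler_wpM2l//.
  by rewrite (le_trans (gD _ _))// ler_wpM2r// lerDr.
Qed.

Section NormedTestFunctions.
Context {R : realType}.

Definition ndist (V : normedModType R) (x y : V) : R := `|x - y|.

Lemma C_lLipP (V : normedModType R) (f : V -> R) :
  C_lLip f <-> plip Num.norm (@ndist V) f.
Proof.
split=> -[C [k]].
- move=> fl; exists (`|C| * 3), k; split=> [|x y]; first by rewrite mulr_ge0.
  apply: le_trans (fl x y) _; rewrite ler_wpM2r//.
  have w1 : 1 <= 1 + `|x| + `|y| by rewrite -addrA lerDl addr_ge0.
  apply: (@le_trans _ _ (`|C| * (1 + `|x| ^+ k + `|y| ^+ k))).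
    by rewrite ler_wpM2r ?ler_norm// !addr_ge0// exprn_ge0.
  rewrite -mulrA ler_wpM2l//.
  have -> : 3 * (1 + `|x| + `|y|) ^+ k = (1 + `|x| + `|y|) ^+ k +
    (1 + `|x| + `|y|) ^+ k + (1 + `|x| + `|y|) ^+ k by ring.
  rewrite !lerD ?exprn_ege1// lerXn2r ?nnegrE// ?(le_trans ler01 w1)//.
    by rewrite addrAC lerDr addr_ge0.
  by rewrite lerDr addr_ge0.
- move=> [C0 fl]; exists (C * 3 ^+ k), k => x y.
  apply: le_trans (fl x y) _; rewrite /ndist ler_wpM2r// -?mulrA ler_wpM2l//.
  have le3 (a : R) : 1 + `|x| + `|y| <= 3 * a -> 0 <= a ->
      a ^+ k <= 1 + `|x| ^+ k + `|y| ^+ k ->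
      (1 + `|x| + `|y|) ^+ k <= 3 ^+ k * (1 + `|x| ^+ k + `|y| ^+ k).
    move=> h a0 h2; apply: (@le_trans _ _ ((3 * a) ^+ k)).
      by rewrite lerXn2r// nnegrE ?mulr_ge0// !addr_ge0.
    by rewrite exprMn ler_wpM2l// exprn_ge0.
  have x0 := normr_ge0 x; have y0 := normr_ge0 y.
  have xk : 0 <= `|x| ^+ k by rewrite exprn_ge0.
  have yk : 0 <= `|y| ^+ k by rewrite exprn_ge0.
  case: (leP `|x| 1) => hx; case: (leP `|y| 1) => hy.
  + by apply: (le3 1); rewrite ?expr1n//; lra.
  + by apply: (le3 `|y|) => //; lra.
  + by apply: (le3 `|x|) => //; lra.
  + case: (leP `|x| `|y|) => hxy; first by apply: (le3 `|y|) => //; lra.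
    by apply: (le3 `|x|) => //; lra.
Qed.

Lemma C_bLip_blip (V : normedModType R) (f : V -> R) :
  C_bLip f -> blip (@ndist V) f.
Proof.
move=> [fb [L [_ fL]]].
have FF : ProperFilter (globally [set: V]).
  exact: (globally_properfilter (a := 0)).
have [M fM] := (ex_bound f).1 fb.
have M0 : 0 <= M by apply: le_trans (fM 0 I); exact: normr_ge0.
pose K := Num.max M (Num.max 0 (L + 1)).
have KM : M <= K by rewrite le_max lexx.
have KL : L < K by rewrite !lt_max; apply/orP; right; rewrite ltrDl ltr01 orbT.
exists K; split=> [|x|x y]; first exact: le_trans KM.
- by rewrite (le_trans (fM x I)).
- by have := fL K KL (x, y); apply.
Qed.

Lemma blip_C_bLip (V : normedModType R) (f : V -> R) :
  blip (@ndist V) f -> C_bLip f.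
Proof.
move=> [C [C0 fC fl]]; split.
  have FF : ProperFilter (globally [set: V]).
    exact: (globally_properfilter (a := 0)).
  by apply: (ex_bound f).2; exists C => x _; exact: fC.
exists C; split; first exact: num_real.
move=> K CK [x y] _ /=.
apply: (le_trans (fl x y)); rewrite /ndist ler_wpM2r//; exact: ltW.
Qed.

Lemma row_norm_ge n (x : 'rV[R]_n) (i : 'I_n) : `|x 0 i| <= `|x|.
Proof.
have -> : `|x| = mx_norm x by [].
by rewrite mx_normrE; exact: (le_bigmax _ (fun ij => `|x ij.1 ij.2|) (0, i)).
Qed.

Lemma row_norm_le n (x : 'rV[R]_n) (a : R) : 0 <= a ->
  (forall i, `|x 0 i| <= a) -> `|x| <= a.
Proof.
move=> a0 xa; have -> : `|x| = mx_norm x by [].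
rewrite mx_normrE; apply/bigmax_leP; split=> // -[i j] _ /=.
by rewrite (ord1 i).
Qed.
End NormedTestFunctions.

(** * Functionals of finitely many values of a path *)

Section Paths.
Context {R : realType} {T : R}.
Implicit Types (S : seq R) (w : Omega T) (X : Omega T -> R).

Definition pnorm S w : R := \sum_(r <- S) `|w r|.
Definition pdist S w w' : R := \sum_(r <- S) `|w r - w' r|.

Lemma pnorm_ge0 S w : 0 <= pnorm S w.
Proof. exact: sumr_ge0. Qed.

Lemma pdist_ge0 S w w' : 0 <= pdist S w w'.
Proof. exact: sumr_ge0. Qed.

Lemma pnorm_dist S w w' : `|pnorm S w - pnorm S w'| <= pdist S w w'.
Proof.
rewrite -sumrB (le_trans (ler_norm_sum _ _ _))//.
by apply: ler_sum => r _; exact: ler_dist_dist.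
Qed.

Lemma pdist_le S w w' : pdist S w w' <= pnorm S w + pnorm S w'.
Proof. by rewrite -big_split; apply: ler_sum => r _; exact: ler_normB. Qed.

Lemma ler_sum_mem S (f : R -> R) r : (forall x, 0 <= f x) -> r \in S ->
  f r <= \sum_(x <- S) f x.
Proof.
move=> f0; elim: S => // x S IH; rewrite in_cons big_cons => /orP[/eqP->|/IH h].
  by rewrite lerDl sumr_ge0.
by rewrite (le_trans h)// lerDr.
Qed.

Lemma ler_sum_size S (f : R -> R) (c : R) : (forall x, x \in S -> f x <= c) ->
  \sum_(x <- S) f x <= (size S)%:R * c.
Proof.
elim: S => [|x S IH] fc; first by rewrite big_nil mul0r.
rewrite big_cons /= -natr1 mulrDl mul1r addrC lerD//.
  by apply: IH => y yS; rewrite fc// in_cons yS orbT.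
by rewrite fc// mem_head.
Qed.

Lemma pnorm_sub S S' w : {subset S <= S'} ->
  pnorm S w <= (size S)%:R * pnorm S' w.
Proof.
by move=> SS; apply: ler_sum_size => r /SS; apply: ler_sum_mem => x.
Qed.

Lemma pdist_sub S S' w w' : {subset S <= S'} ->
  pdist S w w' <= (size S)%:R * pdist S' w w'.
Proof.
move=> SS; apply: ler_sum_size => r /SS.
by apply: (ler_sum_mem (f := fun x => `|w x - w' x|)).
Qed.

Lemma plip_sub S S' X : {subset S <= S'} ->
  plip (pnorm S) (pdist S) X -> plip (pnorm S') (pdist S') X.
Proof.
move=> SS; apply: (@plip_comp _ _ _ _ _ _ _ id (size S)%:R) => //.
- exact: pnorm_ge0.
- exact: pdist_ge0.
- exact: pnorm_ge0.
- move=> w; rewrite (le_trans (pnorm_sub w SS))// ler_wpM2l// lerDr//.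
- by move=> w w'; exact: pdist_sub.
Qed.

Lemma blip_sub S S' X : {subset S <= S'} ->
  blip (pdist S) X -> blip (pdist S') X.
Proof.
move=> SS; apply: (@blip_comp _ _ _ _ _ id (size S)%:R) => //.
- exact: pdist_ge0.
- by move=> w w'; exact: pdist_sub.
Qed.

Lemma plip_agree S X w w' : plip (pnorm S) (pdist S) X ->
  (forall r, r \in S -> w r = w' r) -> X w = X w'.
Proof.
move=> [C [k [_ Xl]]] ww; apply/eqP; rewrite -subr_eq0 -normr_le0.
rewrite (le_trans (Xl w w'))// /pdist big_seq big1 ?mulr0// => r /ww ->.
by rewrite subrr normr0.
Qed.

Lemma poly_path (p : {poly R}) : p.[0] = 0 ->
  exists w : Omega T, forall r : R, 0 <= r <= T -> w r = p.[r].
Proof.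
move=> p0; pose f (t : R) : R := if (0 <= t <= T) then p.[t] else 0.
have fc : {within `[0, T], continuous f}.
  have : {within `[0, T], continuous (horner p)}.
    by apply: continuous_subspaceT; exact: continuous_horner.
  apply: subspace_eq_continuous => x; rewrite inE /= in_itv/= => xT.
  by rewrite /from_subspace /f /= xT.
have f0 : f 0 = 0 by rewrite /f; case: ifP.
have fo t : t \notin `[0, T] -> f t = 0.
  by rewrite in_itv /f => /negbTE ->.
by exists (MkOmega fc f0 fo) => r rT /=; rewrite /f rT.
Qed.

Lemma path_interpolation S (v : R -> R) :
  exists w : Omega T, forall r, r \in S -> 0 < r <= T -> w r = v r.
Proof.
suff [p [p0 pv]] : exists p : {poly R}, p.[0] = 0 /\
    forall r, r \in S -> 0 < r -> p.[r] = v r.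
  have [w wp] := poly_path p0; exists w => r rS /andP[r0 rT].
  by rewrite wp ?pv// ltW.
elim: S => [|s S [p [p0 pv]]]; first by exists 0; rewrite horner0.
have [sS|sS] := boolP (s \in S).
  by exists p; split=> // r; rewrite in_cons => /orP[/eqP->|]; exact: pv.
have [s0|s0] := leP s 0.
  exists p; split=> // r; rewrite in_cons => /orP[/eqP->|]; last exact: pv.
  by rewrite ltNge s0.
pose q : {poly R} := 'X * \prod_(x <- S) ('X - x%:P).
have qs : q.[s] != 0.
  rewrite hornerM hornerX mulf_neq0//; first by rewrite gt_eqF.
  rewrite horner_prod big_seq prodf_seq_neq0; apply/allP => x xS; apply/implyP => _.
  by rewrite !hornerE subr_eq0; apply: contra sS => /eqP ->.
exists (p + ((v s - p.[s]) / q.[s])%:P * q); split=> [|r].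
  have q0 : q.[0] = 0 by rewrite hornerM hornerX mul0r.
  by rewrite hornerD p0 hornerM q0 mulr0 addr0.
rewrite in_cons hornerD hornerM hornerC; have [->|rs /= rS r0] := eqVneq r s.
  by rewrite mulfVK// addrC subrK.
suff -> : q.[r] = 0 by rewrite pv// mulr0 addr0.
rewrite hornerM horner_prod (perm_big _ (perm_to_rem rS)) /= big_cons.
by rewrite hornerXsubC subrr mul0r mulr0.
Qed.

(** A functional of the values of a path at the times in [S] factors through
    any map of paths whose values at these times can be read off a vector. *)
Lemma path_section S (V : normedModType R) (v : V -> R -> R) (K : R) :
  0 <= K -> (forall r, r \in S -> 0 <= r <= T) ->
  (forall r, v 0 r = 0) -> (forall x y r, `|v x r - v y r| <= K * `|x - y|) ->
  exists (P : V -> Omega T) (K' : R),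
    [/\ 0 <= K',
        forall x r, r \in S -> P x r = if r == 0 then 0 else v x r,
        forall x, pnorm S (P x) <= K' * (1 + `|x|) &
        forall x y, pdist S (P x) (P y) <= K' * ndist x y].
Proof.
move=> K0 ST v0 vl.
have /choice[P PP] : forall x : V, exists w : Omega T,
    forall r, r \in S -> 0 < r <= T -> w r = v x r.
  by move=> x; exact: path_interpolation.
have PE x r : r \in S -> P x r = if r == 0 then 0 else v x r.
  move=> rS; case: eqVneq => [->|r0]; first exact: path_start.
  by have /andP[r1 r2] := ST r rS; rewrite PP// lt_neqAle eq_sym r0 r1.
have PD x y : pdist S (P x) (P y) <= (size S)%:R * K * ndist x y.
  rewrite -mulrA; apply: ler_sum_size => r rS; rewrite !PE//.
  case: ifP => _; last exact: vl.
  by rewrite subrr normr0 mulr_ge0// /ndist.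
have PN x : pnorm S (P x) <= (size S)%:R * K * (1 + `|x|).
  apply: (@le_trans _ _ ((size S)%:R * K * ndist x 0)); last first.
    by rewrite ler_wpM2l ?mulr_ge0// /ndist subr0 lerDr.
  rewrite -mulrA; apply: ler_sum_size => r rS; rewrite !PE//.
  case: ifP => _; first by rewrite normr0 mulr_ge0// /ndist.
  by rewrite -[v x r]subr0 -(v0 r); exact: vl.
by exists P, ((size S)%:R * K); split=> //; rewrite mulr_ge0.
Qed.

(** [cyl s] is the coordinate-free description of [H0 s], and [bcyl s] that of
    [Lip s]. *)
Definition cyl (s : R) : set (Omega T -> R) :=
  [set X | exists2 S, (forall r, r \in S -> 0 <= r <= s) &
     plip (pnorm S) (pdist S) X].

Definition bcyl (s : R) : set (Omega T -> R) :=
  [set X | exists2 S, (forall r, r \in S -> 0 <= r <= s) & blip (pdist S) X].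

Lemma bcyl_cyl s : bcyl s `<=` cyl s.
Proof.
by move=> X [S Ss XS]; exists S => //; apply: blip_plip XS; exact: pdist_ge0.
Qed.

Lemma cyl_le s t : s <= t -> cyl s `<=` cyl t.
Proof.
move=> st X [S Ss XS]; exists S => // r /Ss /andP[-> rs].
exact: le_trans st.
Qed.

Lemma bcyl_le s t : s <= t -> bcyl s `<=` bcyl t.
Proof.
move=> st X [S Ss XS]; exists S => // r /Ss /andP[-> rs].
exact: le_trans st.
Qed.

Lemma cyl_common s X Y : cyl s X -> cyl s Y -> exists S,
  [/\ (forall r, r \in S -> 0 <= r <= s), plip (pnorm S) (pdist S) X &
      plip (pnorm S) (pdist S) Y].
Proof.
move=> [S1 h1 X1] [S2 h2 Y2]; exists (S1 ++ S2); split.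
- by move=> r; rewrite mem_cat => /orP[/h1|/h2].
- by apply: plip_sub X1 => r; rewrite mem_cat => ->.
- by apply: plip_sub Y2 => r; rewrite mem_cat => ->; rewrite orbT.
Qed.

Lemma bcyl_common s X Y : bcyl s X -> bcyl s Y -> exists S,
  [/\ (forall r, r \in S -> 0 <= r <= s), blip (pdist S) X & blip (pdist S) Y].
Proof.
move=> [S1 h1 X1] [S2 h2 Y2]; exists (S1 ++ S2); split.
- by move=> r; rewrite mem_cat => /orP[/h1|/h2].
- by apply: blip_sub X1 => r; rewrite mem_cat => ->.
- by apply: blip_sub Y2 => r; rewrite mem_cat => ->; rewrite orbT.
Qed.

Lemma cyl_cst s c : cyl s (fun=> c).
Proof. by exists [::] => //; apply: plip_cst. Qed.

Lemma cyl_add s X Y : cyl s X -> cyl s Y -> cyl s (fun w => X w + Y w).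
Proof.
move=> cX cY; have [S [? ? ?]] := cyl_common cX cY; exists S => //.
by apply: plip_add => //; [exact: pnorm_ge0 | exact: pdist_ge0].
Qed.

Lemma cyl_mul s X Y : cyl s X -> cyl s Y -> cyl s (fun w => X w * Y w).
Proof.
move=> cX cY; have [S [? ? ?]] := cyl_common cX cY; exists S => //.
apply: plip_mul => //;
  [exact: pnorm_ge0 | exact: pdist_ge0 | exact: pdist_le].
Qed.

Lemma cyl_max s X Y : cyl s X -> cyl s Y ->
  cyl s (fun w => Num.max (X w) (Y w)).
Proof.
move=> cX cY; have [S [? ? ?]] := cyl_common cX cY; exists S => //.
by apply: plip_max => //; [exact: pnorm_ge0 | exact: pdist_ge0].
Qed.

Lemma cyl_scale s c X : cyl s X -> cyl s (fun w => c * X w).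
Proof. by move=> cX; apply: cyl_mul => //; exact: cyl_cst. Qed.

Lemma cyl_opp s X : cyl s X -> cyl s (fun w => - X w).
Proof. by move=> [S hS XS]; exists S => //; exact: plip_opp. Qed.

Lemma cyl_sub s X Y : cyl s X -> cyl s Y -> cyl s (fun w => X w - Y w).
Proof. by move=> cX cY; apply: cyl_add => //; exact: cyl_opp. Qed.

Lemma cyl_abs s X : cyl s X -> cyl s (fun w => `|X w|).
Proof. by move=> [S hS XS]; exists S => //; exact: plip_abs. Qed.

Lemma cyl_sum s n (X : nat -> Omega T -> R) :
  (forall i, (i < n)%N -> cyl s (X i)) ->
  cyl s (fun w => \sum_(0 <= i < n) X i w).
Proof.
elim: n => [|n IH] HX.
  by under eq_fun do rewrite big_geq//; exact: cyl_cst.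
under eq_fun do rewrite big_nat_recr//=.
by apply: cyl_add; [apply: IH => i /ltnW; exact: HX | exact: HX].
Qed.

Lemma cyl_sqr s X : cyl s X -> cyl s (fun w => X w ^+ 2).
Proof. by move=> cX; under eq_fun do rewrite expr2; exact: cyl_mul. Qed.

Lemma cyl_eval s r : 0 <= r <= s -> cyl s (fun w => w r).
Proof.
move=> rs; exists [:: r]; first by move=> x; rewrite inE => /eqP ->.
exists 1, 0%N; split=> // w w'.
by rewrite /pdist big_seq1 expr0 !mul1r.
Qed.

Lemma bcyl_cst s c : bcyl s (fun=> c).
Proof. by exists [::] => //; apply: blip_cst => *; exact: pdist_ge0. Qed.

Lemma bcyl_lip s (f : R -> R) (L : R) X :
  (forall x y, `|f x - f y| <= L * `|x - y|) ->
  bcyl s X -> bcyl s (fun w => f (X w)).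
Proof.
move=> fL [S hS XS]; exists S => //; apply: blip_lip fL XS => *.
exact: pdist_ge0.
Qed.

Lemma bcyl_add s X Y : bcyl s X -> bcyl s Y -> bcyl s (fun w => X w + Y w).
Proof.
by move=> cX cY; have [S [? ? ?]] := bcyl_common cX cY; exists S => //;
  apply: blip_add.
Qed.

Lemma bcyl_mul s X Y : bcyl s X -> bcyl s Y -> bcyl s (fun w => X w * Y w).
Proof.
move=> cX cY; have [S [? ? ?]] := bcyl_common cX cY; exists S => //.
by apply: blip_mul => //; exact: pdist_ge0.
Qed.

Lemma bcyl_scale s c X : bcyl s X -> bcyl s (fun w => c * X w).
Proof. by move=> cX; apply: bcyl_mul => //; exact: bcyl_cst. Qed.

Lemma bcyl_opp s X : bcyl s X -> bcyl s (fun w => - X w).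
Proof.
by apply: (@bcyl_lip _ -%R 1) => x y; rewrite -opprD normrN mul1r.
Qed.

Lemma bcyl_sub s X Y : bcyl s X -> bcyl s Y -> bcyl s (fun w => X w - Y w).
Proof. by move=> cX cY; apply: bcyl_add => //; exact: bcyl_opp. Qed.

Lemma bcyl_abs s X : bcyl s X -> bcyl s (fun w => `|X w|).
Proof.
by apply: (@bcyl_lip _ Num.norm 1) => x y; rewrite mul1r ler_dist_dist.
Qed.

Lemma bcyl_maxc s c X : bcyl s X -> bcyl s (fun w => Num.max (X w) c).
Proof.
by apply: (@bcyl_lip _ (Num.max^~ c) 1) => x y; rewrite mul1r max_lip.
Qed.

Lemma bcyl_minc s c X : bcyl s X -> bcyl s (fun w => Num.min (X w) c).
Proof.
by apply: (@bcyl_lip _ (Num.min^~ c) 1) => x y; rewrite mul1r min_lip.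
Qed.

Lemma bcyl_sum s n (X : nat -> Omega T -> R) :
  (forall i, (i < n)%N -> bcyl s (X i)) ->
  bcyl s (fun w => \sum_(0 <= i < n) X i w).
Proof.
elim: n => [|n IH] HX.
  by under eq_fun do rewrite big_geq//; exact: bcyl_cst.
under eq_fun do rewrite big_nat_recr//=.
by apply: bcyl_add; [apply: IH => i /ltnW; exact: HX | exact: HX].
Qed.

Lemma row_pnorm (n : nat) (ts : 'I_n.+1 -> R) w :
  `|\row_i w (ts i)| <= pnorm [seq ts i | i <- enum 'I_n.+1] w.
Proof.
apply: row_norm_le => [|i]; first exact: pnorm_ge0.
rewrite mxE; apply: (ler_sum_mem (f := fun r => `|w r|)) => //.
by apply: map_f; rewrite mem_enum.
Qed.

Lemma row_pdist (n : nat) (ts : 'I_n.+1 -> R) w w' :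
  `|\row_i w (ts i) - \row_i w' (ts i)|
    <= pdist [seq ts i | i <- enum 'I_n.+1] w w'.
Proof.
apply: row_norm_le => [|i]; first exact: pdist_ge0.
rewrite !mxE; apply: (ler_sum_mem (f := fun r => `|w r - w' r|)) => //.
by apply: map_f; rewrite mem_enum.
Qed.

Lemma Lip_bcyl s : Lip (T := T) s `<=` bcyl s.
Proof.
move=> X [n [ts [phi [tss /C_bLip_blip philip ->]]]].
exists [seq ts i | i <- enum 'I_n.+1].
  by move=> r /mapP[i _ ->].
apply: (@blip_comp _ _ _ _ _ (fun w => \row_i w (ts i)) 1) philip => //.
  exact: pdist_ge0.
by move=> w w'; rewrite mul1r; exact: row_pdist.
Qed.

(** A functional of the values of a path at the times in [S] is a function of
    the vector of these values, by way of a path that takes them. *)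
Lemma H0_cyl s : 0 <= s <= T -> H0 (T := T) s = cyl s.
Proof.
move=> /andP[s0 sT]; apply/seteqP; split=> X.
- move=> [n [ts [phi [tss /C_lLipP philip ->]]]].
  exists [seq ts i | i <- enum 'I_n.+1].
    by move=> r /mapP[i _ ->].
  apply: (@plip_comp _ _ _ _ _ _ _ (fun w => \row_i w (ts i)) 1) philip => //.
  + exact: pnorm_ge0.
  + exact: pdist_ge0.
  + move=> w; rewrite mul1r (le_trans (row_pnorm _ _))//.
    by rewrite lerDr.
  + by move=> w w'; rewrite mul1r; exact: row_pdist.
- move=> [S Ss XS].
  pose n := size S; pose ts (i : 'I_n.+1) := nth 0 (0 :: S) i.
  pose v (x : 'rV[R]_n.+1) r := if r \in S then x 0 (inord (index r (0 :: S))) else 0.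
  have [||||P [K' [K'0 PE PN PD]]] := @path_section S _ v 1.
  + by [].
  + by move=> r /Ss /andP[-> /le_trans]; apply.
  + by move=> r; rewrite /v; case: ifP => _ //; rewrite mxE.
  + move=> x y r; rewrite mul1r /v; case: ifP => _; last first.
      by rewrite subrr normr0.
    have -> : x 0 (inord (index r (0 :: S))) - y 0 (inord (index r (0 :: S))) =
      (x - y) 0 (inord (index r (0 :: S))) by rewrite !mxE.
    exact: row_norm_ge.
  exists n, ts, (X \o P); split.
  + move=> i; rewrite /ts; case: i => -[|i] /= ni; first by rewrite lexx s0.
    by apply: Ss; apply: mem_nth.
  + apply/C_lLipP; apply: (plip_comp _ _ _ K'0 PN PD XS) => //.
    * by move=> x y; exact: normr_ge0.
    * exact: pnorm_ge0.
  + apply/funext => w /=; apply: plip_agree XS _ => r rS; rewrite PE//.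
    case: eqVneq => [->|r0]; first exact: path_start.
    rewrite /v rS mxE /ts inordK.
      by rewrite nth_index// in_cons rS orbT.
    by rewrite -[X in (_ < X)%N]/(size (0 :: S)) index_mem in_cons rS orbT.
Qed.
End Paths.

(** * Independence *)

Lemma eq_of_invn {R : realType} (a b M : R) :
  (forall n : nat, `|a - b| <= n.+1%:R^-1 * M) -> a = b.
Proof.
move=> ab; apply/eqP; rewrite -subr_eq0 -normr_eq0; apply/negPn/negP => d0.
have d1 : 0 < `|a - b| by rewrite lt_neqAle eq_sym d0 normr_ge0.
have M0 : 0 < M.
  by have := lt_le_trans d1 (ab 0%N); rewrite invr1 mul1r.
have := ab (Num.truncn (M / `|a - b|)).
rewrite leNgt => /negP; apply; rewrite ltr_pdivrMl// -ltr_pdivrMr//.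
exact: truncnS_gt.
Qed.

Section PowersOfSize.
Context {R : realType} {A : Type} {N : A -> R} {D : A -> A -> R}.
Context (N0 : forall a, 0 <= N a) (D0 : forall a b, 0 <= D a b).
Context (ND : forall a b, `|N a - N b| <= D a b).
Context (DN : forall a b, D a b <= N a + N b).

Lemma plip_exp f k : plip N D f -> plip N D (fun a => f a ^+ k).
Proof.
move=> fp; elim: k => [|k IH].
  by under eq_fun do rewrite expr0; exact: plip_cst.
by under eq_fun do rewrite exprS; exact: plip_mul.
Qed.

Lemma plip_weight c k : plip N D (fun a => (1 + c * N a) ^+ k).
Proof.
apply: plip_exp; apply: plip_add => //; first exact: plip_cst.
by apply: plip_scale => //; exists 1, 0%N; split=> // a b; rewrite expr0 !mul1r.
Qed.
End PowersOfSize.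

Section Norms.
Context {R : realType} (V W : normedModType R).
Lemma norm0 (x : V) : 0 <= `|x| :> R. Proof. exact: normr_ge0. Qed.
Lemma ndist0 (x y : V) : 0 <= ndist x y. Proof. exact: normr_ge0. Qed.
Lemma ndistxx (x : V) : ndist x x = 0.
Proof. by rewrite /ndist subrr normr0. Qed.
Lemma norm_ndist (x y : V) : `| `|x| - `|y| | <= ndist x y.
Proof. exact: ler_dist_dist. Qed.
Lemma ndist_norm (x y : V) : ndist x y <= `|x| + `|y|.
Proof. exact: ler_normB. Qed.

Lemma pair_norm_le (x : V) (y : W) : `|(x, y)| <= `|x| + `|y|.
Proof. by rewrite prod_normE/= ge_max lerDl lerDr !normr_ge0. Qed.

Lemma pair_norm_fst (z : V * W) : `|z.1| <= `|z|.
Proof. by rewrite [leRHS]prod_normE le_max lexx. Qed.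

Lemma pair_norm_snd (z : V * W) : `|z.2| <= `|z|.
Proof. by rewrite [leRHS]prod_normE le_max lexx orbT. Qed.

Lemma ndist_pair (x x' : V) (y y' : W) :
  ndist (x, y) (x', y') <= ndist x x' + ndist y y'.
Proof. exact: pair_norm_le. Qed.
End Norms.

Section Average.
Context {R : realType} {Om : Type} {H : set (Om -> R)} {E : (Om -> R) -> R}.
Context (sE : sublinear_expectation H E).
Context {W : normedModType R} {Z : Om -> W}.
Context (HZ : forall f : W -> R, plip Num.norm (@ndist R W) f ->
  H (fun w => f (Z w))).
Context {A : Type} {N : A -> R} {D : A -> A -> R}.
Context (N0 : forall a, 0 <= N a) (D0 : forall a b, 0 <= D a b).
Context (Dxx : forall a, D a a = 0).

Definition pairN (z : A * W) : R := N z.1 + `|z.2|.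
Definition pairD (z z' : A * W) : R := D z.1 z'.1 + ndist z.2 z'.2.

Lemma plip_freeze_pair (f : A * W -> R) (a : A) : plip pairN pairD f ->
  plip Num.norm (@ndist R W) (fun y => f (a, y)).
Proof.
move=> fp; have K0 : 0 <= 1 + N a by rewrite addr_ge0.
apply: (plip_comp (g := fun y => (a, y)) _ _ _ K0 _ _ fp) => [y|y y'|z|y|y y'].
- exact: norm0.
- exact: ndist0.
- by rewrite addr_ge0.
- rewrite /pairN /=; have := mulr_ge0 (N0 a) (normr_ge0 y); lra.
- by rewrite /pairD /= Dxx add0r mulrDl mul1r lerDl mulr_ge0// ndist0.
Qed.

Lemma plip_average_pair (f : A * W -> R) : plip pairN pairD f ->
  plip N D (fun a => E (fun w => f (a, Z w))).
Proof.
move=> fp; have [C [k [C0 fl]]] := fp.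
have HW : H (fun w => (1 + 2 * `|Z w|) ^+ k).
  by apply: (HZ (f := fun y => (1 + 2 * `|y|) ^+ k)); apply: plip_weight;
    [exact: norm0 | exact: ndist0 | exact: norm_ndist | exact: ndist_norm].
have EW0 : 0 <= E (fun w => (1 + 2 * `|Z w|) ^+ k).
  by apply: (sexp_ge0 sE HW) => w; rewrite exprn_ge0// addr_ge0// mulr_ge0.
exists (C * E (fun w => (1 + 2 * `|Z w|) ^+ k)), k; split=> [|x x'].
  exact: mulr_ge0.
have Hx z : H (fun w => f (z, Z w)) by exact: (HZ (plip_freeze_pair z fp)).
apply: (le_trans (sexp_dist sE (Hx x) (Hx x'))).
set c := C * (1 + N x + N x') ^+ k * D x x'.
have c0 : 0 <= c by rewrite !mulr_ge0 ?exprn_ge0 ?addr_ge0.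
have -> : C * E (fun w => (1 + 2 * `|Z w|) ^+ k) * (1 + N x + N x') ^+ k *
    D x x' = c * E (fun w => (1 + 2 * `|Z w|) ^+ k) by rewrite /c; ring.
rewrite -(sexp_homogeneous sE c0 HW); apply: (sexp_monotone sE).
- by apply: (rv_abs sE); exact: (rv_sub sE).
- exact: (rv_scale sE).
move=> w; apply: (le_trans (fl _ _)); set y := Z w.
apply: (@le_trans _ _ (C * ((1 + N x + N x') * (1 + 2 * `|y|)) ^+ k * D x x')).
  rewrite /pairD /= /ndist subrr normr0 addr0 ler_wpM2r// ler_wpM2l//.
  rewrite /pairN /=; apply: lerXn2r; rewrite ?nnegrE.
  - by do ?[apply: addr_ge0].
  - by do ?[apply: mulr_ge0|apply: addr_ge0].
  have := mulr_ge0 (N0 x) (normr_ge0 y).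
  by have := mulr_ge0 (N0 x') (normr_ge0 y); lra.
by rewrite exprMn /c le_eqVlt; apply/orP; left; apply/eqP; ring.
Qed.
End Average.
Arguments pairN {R W A} N z.
Arguments pairD {R W A} D z z'.

Section Independence.
Context {R : realType} {V W : normedModType R} {Om : Type}.
Context {H : set (Om -> R)} {E : (Om -> R) -> R}.
Context (sE : sublinear_expectation H E) {X : Om -> V} {Y : Om -> W}.
Context (XY : independent_of H E Y X).

Let plipW (f : V * W -> R) : plip Num.norm (@ndist R (V * W)%type) f ->
  H (fun w => f (X w, Y w)).
Proof. by move=> /C_lLipP; exact: XY.1. Qed.

Lemma plip_fst (f : V -> R) : plip Num.norm (@ndist R V) f ->
  H (fun w => f (X w)).
Proof.
move=> fp; apply: (plipW (f := f \o fst)).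
apply: (plip_comp _ _ _ ler01 _ _ fp) => [a|a b|a|a|a b].
- exact: norm0.
- exact: ndist0.
- exact: norm0.
- by rewrite mul1r (le_trans (pair_norm_fst a))// lerDr.
- by rewrite mul1r; exact: (pair_norm_fst (a - b)).
Qed.

Lemma plip_snd (f : W -> R) : plip Num.norm (@ndist R W) f ->
  H (fun w => f (Y w)).
Proof.
move=> fp; apply: (plipW (f := f \o snd)).
apply: (plip_comp _ _ _ ler01 _ _ fp) => [a|a b|a|a|a b].
- exact: norm0.
- exact: ndist0.
- exact: norm0.
- by rewrite mul1r (le_trans (pair_norm_snd a))// lerDr.
- by rewrite mul1r; exact: (pair_norm_snd (a - b)).
Qed.

Let plip_sum (f : V * W -> R) : plip Num.norm (@ndist R (V * W)%type) f ->
  plip (pairN Num.norm) (pairD (@ndist R V)) f.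
Proof.
apply: (plip_comp (g := id) _ _ _ ler01) => [a|a b|a|[x y]|[x y] [x' y']].
- by rewrite addr_ge0.
- by rewrite addr_ge0// ndist0.
- exact: norm0.
- by rewrite mul1r (le_trans (pair_norm_le x y))// lerDr.
- by rewrite mul1r; exact: ndist_pair.
Qed.

Lemma plip_freeze (f : V * W -> R) (x : V) :
  plip Num.norm (@ndist R (V * W)%type) f ->
  plip Num.norm (@ndist R W) (fun y => f (x, y)).
Proof.
move=> /plip_sum fp.
exact: (plip_freeze_pair (@norm0 R V) (@ndistxx R V) x fp).
Qed.

Let g (f : V * W -> R) (x : V) := E (fun w => f (x, Y w)).

Lemma plip_average (f : V * W -> R) :
  plip Num.norm (@ndist R (V * W)%type) f -> plip Num.norm (@ndist R V) (g f).
Proof.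
move=> /plip_sum fp.
exact: (plip_average_pair sE plip_snd (@norm0 R V) (@ndist0 R V) (@ndistxx R V)
  fp).
Qed.

(** Independence, which is tested with bounded Lipschitz functions, extends to
    locally Lipschitz functions of polynomial growth: cut off at size [n]; the
    error is [n^-1] times a moment. *)
Lemma independent_plip (f : V * W -> R) :
  plip Num.norm (@ndist R (V * W)%type) f ->
  E (fun w => f (X w, Y w)) = E (fun w => E (fun w' => f (X w, Y w'))).
Proof.
move=> fp; have [C [k [C0 fcut]]] := plip_cutoff (@norm0 _ _)
  (@ndist0 _ _) (@norm_ndist _ _) (@ndist_norm _ _) fp.
have weightV (U : normedModType R) :
    plip Num.norm (@ndist R U) (fun z => (1 + 1 * `|z|) ^+ k).
  by apply: plip_weight; [exact: norm0 | exact: ndist0 | exact: norm_ndist |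
                          exact: ndist_norm].
have HXY := plipW (weightV (V * W)%type).
have HX := plip_fst (weightV V); have HY := plip_snd (weightV W).
pose MXY := E (fun w => (1 + 1 * `|(X w, Y w)|) ^+ k).
pose MX := E (fun w => (1 + 1 * `|X w|) ^+ k).
pose MY := E (fun w => (1 + 1 * `|Y w|) ^+ k).
have MY0 : 0 <= MY.
  by apply: (sexp_ge0 sE HY) => w; rewrite exprn_ge0// addr_ge0// mul1r.
apply: (@eq_of_invn _ _ _ (C * MXY + C * MX * MY)) => n.
have n0 : 0 <= n.+1%:R^-1 :> R by rewrite invr_ge0.
have [h hb fh] := fcut n.
have hp : plip Num.norm (@ndist R (V * W)%type) h.
  by apply: blip_plip hb => *; exact: ndist0.
have hE : E (fun w => h (X w, Y w)) = E (fun w => g h (X w)).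
  by apply: XY.2; exact: blip_C_bLip.
have Hgf := plip_fst (plip_average fp); have Hgh := plip_fst (plip_average hp).
have Hf := plipW fp; have Hh := plipW hp.
have -> : E (fun w => f (X w, Y w)) - E (fun w => g f (X w)) =
  (E (fun w => f (X w, Y w)) - E (fun w => h (X w, Y w))) -
  (E (fun w => g f (X w)) - E (fun w => g h (X w))) by rewrite hE; ring.
rewrite (le_trans (ler_normB _ _))// mulrDr lerD//.
  apply: (le_trans (sexp_dist sE Hf Hh)).
  have c0 : 0 <= n.+1%:R^-1 * C by rewrite mulr_ge0.
  rewrite mulrA -(sexp_homogeneous sE c0 HXY).
  apply: (sexp_monotone sE); [exact/(rv_abs sE)/(rv_sub sE) | exact: (rv_scale sE) |].
  by move=> w; rewrite -mulrA mul1r; exact: fh.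
apply: (le_trans (sexp_dist sE Hgf Hgh)).
have c0 : 0 <= n.+1%:R^-1 * C * MY by rewrite !mulr_ge0.
have -> : n.+1%:R^-1 * (C * MX * MY) = n.+1%:R^-1 * C * MY * MX by ring.
rewrite -(sexp_homogeneous sE c0 HX).
apply: (sexp_monotone sE); [exact/(rv_abs sE)/(rv_sub sE) | exact: (rv_scale sE) |].
move=> w; set x := X w.
have Hx u : plip Num.norm (@ndist R (V * W)%type) u -> H (fun w => u (x, Y w)).
  by move=> up; exact: (plip_snd (plip_freeze x up)).
apply: (le_trans (sexp_dist sE (Hx _ fp) (Hx _ hp))).
have d0 : 0 <= n.+1%:R^-1 * C * (1 + 1 * `|x|) ^+ k.
  by rewrite !mulr_ge0// exprn_ge0// mul1r addr_ge0.
rewrite mulrAC -(sexp_homogeneous sE d0 HY).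
apply: (sexp_monotone sE); [|exact: (rv_scale sE)|].
  by apply: (rv_abs sE); apply: (rv_sub sE); exact: Hx.
move=> w'; apply: (le_trans (fh _)); rewrite !mul1r -!mulrA !ler_wpM2l//.
rewrite -exprMn lerXn2r ?nnegrE ?mulr_ge0 ?addr_ge0//.
have := pair_norm_le x (Y w').
by have := mulr_ge0 (normr_ge0 x) (normr_ge0 (Y w')); lra.
Qed.
End Independence.

(** * Partitions *)

Section Partitions.
Context {R : realType}.
Implicit Types (p : seq R) (b : R).

Lemma node_last p b : itv_partition 0 b p -> node p (size p) = b.
Proof. by move=> [_ /eqP <-]; rewrite /node -[0 :: p]cat1s nth_last. Qed.

Lemma node_lt p b i j : itv_partition 0 b p -> (i < j)%N -> (j <= size p)%N ->
  node p i < node p j.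
Proof.
move=> [pp _] ij jp; rewrite /node; apply: (sorted_ltn_nth lt_trans) => //.
  by rewrite inE /= ltnS (leq_trans (ltnW ij)).
Qed.

Lemma node_le p b i j : itv_partition 0 b p -> (i <= j)%N -> (j <= size p)%N ->
  node p i <= node p j.
Proof.
move=> pp; rewrite leq_eqVlt => /orP[/eqP -> //|ij jp].
exact/ltW/(node_lt pp).
Qed.

Lemma node_bounds p b i : itv_partition 0 b p -> (i <= size p)%N ->
  0 <= node p i <= b.
Proof.
move=> pp ip; apply/andP; split; first exact: (node_le (i := 0) pp).
by rewrite -[leRHS](node_last pp) (node_le pp).
Qed.

Lemma node_mem p i : (i <= size p)%N -> node p i \in 0 :: p.
Proof. by move=> ip; apply: mem_nth. Qed.

Lemma mem_node p r : r \in 0 :: p -> exists2 i, (i <= size p)%N & r = node p i.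
Proof.
move=> rp; exists (index r (0 :: p)); last by rewrite /node nth_index.
by rewrite -ltnS -[X in (_ < X)%N]/(size (0 :: p)) index_mem.
Qed.

Lemma partition_of (S : seq R) b : 0 < b -> (forall r, r \in S -> 0 <= r <= b) ->
  exists2 p, itv_partition 0 b p & {subset S <= 0 :: p}.
Proof.
move=> b0 Sb; pose p := sort <=%O (undup [seq r <- b :: S | 0 < r]).
have pE r : (r \in p) = (0 < r) && (r \in b :: S).
  by rewrite mem_sort mem_undup mem_filter.
have pp : path <%O 0 p.
  rewrite path_min_sorted; last by apply/allP => r; rewrite pE => /andP[].
  rewrite lt_sorted_uniq_le sort_uniq undup_uniq /=.
  by apply: sort_sorted; exact: Order.TotalTheory.le_total.
have pb' : itv_partition 0 (last 0 p) p by split.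
exists p; last first.
  move=> r rS; have /andP[r0 rb] := Sb r rS; rewrite in_cons.
  by case: eqVneq => //= rn0; rewrite pE lt_neqAle eq_sym rn0 r0 in_cons rS orbT.
split=> //; rewrite eq_le; apply/andP; split.
  have := mem_last 0 p; rewrite in_cons => /orP[/eqP ->|]; first exact: ltW.
  by rewrite pE in_cons => /andP[_ /orP[/eqP -> //|/Sb/andP[]]].
have : b \in 0 :: p by rewrite in_cons pE b0 mem_head orbT.
move=> /mem_node[i ip {1}->]; rewrite -(node_last pb').
exact: (node_le pb').
Qed.
End Partitions.

Lemma sum_below {R : realType} (m : nat) (t f : nat -> R) k :
  (forall i j, (i < j)%N -> (j <= m)%N -> t i < t j) -> (k <= m)%N ->
  \sum_(l < m) (if t l.+1 <= t k then f l else 0) = \sum_(0 <= l < k) f l.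
Proof.
move=> tlt km.
rewrite -(big_mkord xpredT (fun l => if t l.+1 <= t k then f l else 0)).
rewrite (big_cat_nat (leq0n k) km) /= [X in _ + X]big_nat [X in _ + X]big1 ?addr0.
  rewrite !big_nat; apply: eq_bigr => l /andP[_ lk]; move: (lk).
  rewrite leq_eqVlt; case/orP => [/eqP -> |lk1]; first by rewrite lexx.
  by rewrite ltW// tlt.
by move=> l /andP[kl lm]; rewrite ifN// -ltNge tlt.
Qed.

(** Any vector is the vector of increments of some path over the partition [p];
    functionals of the values of a path at nodes of [p] thus become functions
    of these increments. *)
Lemma path_of_increments {R : realType} {T b : R} (p S : seq R) :
  itv_partition 0 b p -> b <= T -> {subset S <= 0 :: p} ->
  exists (P : 'rV[R]_(size p) -> Omega T) (K : R), [/\ 0 <= K,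
    forall (x : nat -> R) r, r \in S ->
      P (\row_l x l) r = \sum_(0 <= l < index r (0 :: p)) x l,
    forall (w : Omega T) r, r \in S ->
      P (\row_l (w (node p l.+1) - w (node p l))) r = w r,
    forall x, pnorm S (P x) <= K * (1 + `|x|) &
    forall x y, pdist S (P x) (P y) <= K * ndist x y].
Proof.
move=> pp bT Sp; set m := size p.
pose v (x : 'rV[R]_m) r := \sum_(l < m) (if node p l.+1 <= r then x 0 l else 0).
have ST r : r \in S -> 0 <= r <= T.
  move=> /Sp/mem_node[i im ->]; have /andP[-> /le_trans] := node_bounds pp im.
  exact.
have [|||P [K [K0 PE PN PD]]] := @path_section R T S _ v m%:R _ ST.
- by [].
- by move=> r; rewrite /v big1// => l _; rewrite mxE if_same.
- move=> x y r; rewrite /v -sumrB (le_trans (ler_norm_sum _ _ _))//.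
  have -> : m%:R * `|x - y| = \sum_(l < m) `|x - y|.
    by rewrite sumr_const card_ord mulr_natl.
  apply: ler_sum => l _; case: ifP => _; last by rewrite subrr normr0.
  by have := row_norm_ge (x - y) l; rewrite !mxE.
have Px (x : nat -> R) r : r \in S ->
    P (\row_l x l) r = \sum_(0 <= l < index r (0 :: p)) x l.
  move=> rS; rewrite PE//.
  have ip : (index r (0%R :: p) <= m)%N.
    by rewrite -ltnS -[X in (_ < X)%N]/(size (0%R :: p)) index_mem Sp.
  have rE : r = node p (index r (0 :: p)) by rewrite /node nth_index ?Sp.
  case: eqVneq => [->|r0]; first by rewrite /= eqxx big_geq.
  rewrite -(sum_below x (fun i j => @node_lt _ p b i j pp) ip) -rE.
  by apply: eq_bigr => l _; rewrite mxE.
exists P, K; split=> // w r rS.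
rewrite (Px (fun l => w (node p l.+1) - w (node p l)))//.
rewrite (telescope_sumr (fun l => w (node p l)))// /node nth_index ?Sp//=.
by rewrite path_start subr0.
Qed.

(** * Increments of the canonical process *)

Section GIncrements.
Context {R : realType} {T slo shi : R} {E : (Omega T -> R) -> R}.
Context (T0 : 0 < T).

Let cylH : H0 T = cyl T :> set (Omega T -> R).
Proof. by apply: H0_cyl; rewrite lexx ltW. Qed.

Lemma cyl_sexp : sublinear_expectation (H0 T) E ->
  sublinear_expectation (cyl T) E.
Proof. by rewrite cylH. Qed.

Context {Om : Type} {H : set (Om -> R)} {E' : (Om -> R) -> R}.
Context {xi : nat -> Om -> R}.
Context (sE : sublinear_expectation (cyl T) E).
Context (sE' : sublinear_expectation H E').
Context (xi_ind : forall i,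
  independent_of H E' (xi i.+1) (fun w => \row_(j < i.+1) xi j w)).
Context (xi_law : forall (m : nat) (t : nat -> R) (phi : 'rV[R]_m.+1 -> R),
  t 0%N = 0 -> (forall i, (i <= m)%N -> t i < t i.+1) -> t m.+1 <= T ->
  C_lLip phi ->
  E (fun w => phi (\row_(i < m.+1) (w (t i.+1) - w (t i)))) =
  E' (fun w => phi (\row_(i < m.+1) (Num.sqrt (t i.+1 - t i) * xi i w)))).

Lemma plip_entry n (i : 'I_n) (f : R -> R) : plip Num.norm (@ndist R R) f ->
  plip Num.norm (@ndist R 'rV[R]_n) (fun x => f (x 0 i)).
Proof.
apply: (plip_comp _ _ _ ler01) => [x|x y|a|x|x y].
- exact: norm0.
- exact: ndist0.
- exact: norm0.
- by rewrite mul1r (le_trans (row_norm_ge x i))// lerDr.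
- by rewrite mul1r /ndist; have := row_norm_ge (x - y) i; rewrite !mxE.
Qed.

Lemma increment_law (s t : R) : 0 <= s -> s < t -> t <= T ->
  exists2 i, (i <= 1)%N & forall f, plip Num.norm (@ndist R R) f ->
    E (fun w : Omega T => f (w t - w s)) = E' (fun w => f (Num.sqrt (t - s) * xi i w)).
Proof.
move=> s0 st tT; case: (eqVneq s 0) => [s_eq0|s_neq0].
  exists 0%N => // f fp.
  pose tt i : R := if i is 0%N then 0 else t.
  have := @xi_law 0 tt (fun x => f (x 0 0)) erefl _ tT.
  have -> : (fun w : Omega T => f ((\row_(i < 1) (w (tt i.+1) - w (tt i))) 0 0)) =
    (fun w : Omega T => f (w t - w s)) by apply/funext => w; rewrite mxE s_eq0.
  have -> : (fun w => f ((\row_(i < 1) (Num.sqrt (tt i.+1 - tt i) * xi i w)) 0 0)) =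
    (fun w => f (Num.sqrt (t - s) * xi 0%N w)).
    by apply/funext => w; rewrite mxE s_eq0.
  apply; last by apply/C_lLipP; exact: plip_entry.
  by case=> // _; exact: le_lt_trans s0 st.
have {s_neq0}s_gt0 : 0 < s by rewrite lt_neqAle eq_sym s_neq0.
exists 1%N => // f fp.
pose tt i : R := if i is 0%N then 0 else if i is 1%N then s else t.
have := @xi_law 1 tt (fun x => f (x 0 ord_max)) erefl _ tT.
have -> : (fun w : Omega T => f ((\row_(i < 2) (w (tt i.+1) - w (tt i))) 0 ord_max)) =
  (fun w : Omega T => f (w t - w s)) by apply/funext => w; rewrite mxE.
have -> : (fun w => f ((\row_(i < 2) (Num.sqrt (tt i.+1 - tt i) * xi i w)) 0 ord_max))
  = (fun w => f (Num.sqrt (t - s) * xi 1%N w)).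
  by apply/funext => w; rewrite mxE.
apply; last by apply/C_lLipP; exact: plip_entry.
by do 2?case=> //.
Qed.

Definition cylN (S : seq R) : Omega T * R -> R := pairN (pnorm S).
Definition cylD (S : seq R) : Omega T * R -> Omega T * R -> R := pairD (pdist S).

Lemma pdistxx (S : seq R) (w : Omega T) : pdist S w w = 0.
Proof. by rewrite /pdist big1// => r _; rewrite subrr normr0. Qed.

Lemma cyl_increment_rv (s t : R) (S : seq R) f : 0 <= s <= t -> t <= T ->
  (forall r, r \in S -> 0 <= r <= s) -> plip (cylN S) (cylD S) f ->
  cyl T (fun w : Omega T => f (w, w t - w s)).
Proof.
move=> /andP[s0 st] tT Ss fp; have t0 := le_trans s0 st.
exists [:: s, t & S].
  move=> r; rewrite !in_cons => /or3P[/eqP ->|/eqP ->|/Ss/andP[-> rs]].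
  - by rewrite s0 (le_trans st).
  - by rewrite t0.
  - by rewrite (le_trans rs) ?(le_trans st).
have K0 : 0 <= 1 :> R by [].
apply: (plip_comp (g := fun w : Omega T => (w, w t - w s)) _ _ _ K0 _ _ fp).
- exact: pnorm_ge0.
- exact: pdist_ge0.
- by move=> z; rewrite addr_ge0// pnorm_ge0.
- move=> w; rewrite /cylN /pairN /pnorm !big_cons /= mul1r.
  have := ler_normB (w t) (w s); lra.
- move=> w w'; rewrite /cylD /pairD /pdist !big_cons /= mul1r /ndist.
  have -> : w t - w s - (w' t - w' s) = w t - w' t - (w s - w' s) by ring.
  have := ler_normB (w t - w' t) (w s - w' s); lra.
Qed.

(** The increment of the path over [s,t] is independent of the past: with the
    past encoded by the increments over a partition of [0,s], both sides are
    expectations of functions of the [xi]'s, of which the last one is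
    independent of the others. *)
Lemma increment_independent (s t : R) (S : seq R) f : 0 <= s -> s < t -> t <= T ->
  (forall r, r \in S -> 0 <= r <= s) -> plip (cylN S) (cylD S) f ->
  plip (pnorm S) (pdist S) (fun w => E (fun w' : Omega T => f (w, w' t - w' s))) /\
  E (fun w : Omega T => f (w, w t - w s)) = E (fun w => E (fun w' : Omega T => f (w, w' t - w' s))).
Proof.
move=> s0 st tT Ss fp; have sT : s <= T := le_trans (ltW st) tT.
have stT : 0 <= s <= t by rewrite s0 ltW.
have gp : plip (pnorm S) (pdist S) (fun w => E (fun w' : Omega T => f (w, w' t - w' s))).
  apply: (plip_average_pair sE _ (pnorm_ge0 S) (pdist_ge0 S) (pdistxx S) fp).
  move=> h hp; apply: (@cyl_increment_rv s t [::] (fun z => h z.2)) => //.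
  apply: (plip_comp _ _ _ ler01 _ _ hp) => [z|z z'|z|z|z z'].
  - by rewrite addr_ge0// pnorm_ge0.
  - by rewrite addr_ge0 ?pdist_ge0 ?ndist0.
  - exact: norm0.
  - by rewrite mul1r /cylN /pairN /pnorm big_nil add0r lerDr.
  - by rewrite mul1r /cylD /pairD /pdist big_nil add0r.
split=> //; set g := (fun w => E _) in gp *.
have f_agree (w w' : Omega T) (y : R) : (forall r, r \in S -> w r = w' r) -> f (w, y) = f (w', y).
  move=> ww; apply/eqP; rewrite -subr_eq0 -normr_le0.
  have [C [k [_ fl]]] := fp; rewrite (le_trans (fl _ _))//.
  rewrite /cylD /pairD /= /ndist subrr normr0 addr0.
  rewrite /pdist big_seq big1 ?mulr0// => r /ww ->.
  by rewrite subrr normr0.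
case: (eqVneq s 0) => [s_eq0|s_neq0].
  (* at time 0 the past is trivial *)
  have [w0 _] := @path_interpolation R T [::] (fun=> 0).
  have S_agree (w : Omega T) (r : R) : r \in S -> w r = w0 r.
    move=> /Ss; rewrite s_eq0 => /andP[r0 r1].
    by have -> : r = 0 by [apply/eqP; rewrite eq_le r0 r1]; rewrite !path_start.
  have -> : (fun w : Omega T => f (w, w t - w s)) = (fun w : Omega T => f (w0, w t - w s)).
    by apply/funext => w; apply: f_agree => r /(S_agree w).
  have -> : g = fun=> g w0.
    by apply/funext => w; apply: plip_agree gp _ => r /(S_agree w).
  by rewrite (sexp_cst sE).
have {s_neq0}s_gt0 : 0 < s by rewrite lt_neqAle eq_sym s_neq0.
have [p pp Sp] := partition_of s_gt0 Ss.
case: p pp Sp => [|x0 p'] pp Sp.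
  by move: (node_last pp) s_gt0; rewrite /node /= => <-; rewrite ltxx.
set p := x0 :: p' in pp Sp; pose m := size p'.
pose tt i := if (i <= m.+1)%N then node p i else t.
have tt_node i : (i <= m.+1)%N -> tt i = node p i by rewrite /tt => ->.
have tts : tt m.+1 = s by rewrite tt_node// (node_last pp).
have ttt : tt m.+2 = t by rewrite /tt ltnn.
have tt0 : tt 0%N = 0 by [].
have tt_lt i : (i <= m.+1)%N -> tt i < tt i.+1.
  rewrite leq_eqVlt => /orP[/eqP ->|im]; first by rewrite tts ttt.
  by rewrite !tt_node ?(ltnW im)// (node_lt pp).
have [P [K [K0 _ P_incr PN PD]]] := path_of_increments pp sT Sp.
pose inc (w : Omega T) : 'rV[R]_m.+1 := \row_(l < m.+1) (w (tt l.+1) - w (tt l)).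
have P_inc (w : Omega T) (r : R) : r \in S -> P (inc w) r = w r.
  move=> rS; rewrite -[RHS]P_incr//; congr (P _ r); apply/rowP => l.
  by rewrite !mxE !tt_node// ltnW.
pose q l := Num.sqrt (tt l.+1 - tt l).
pose scale (x : 'rV[R]_m.+1) : 'rV[R]_m.+1 := \row_l (q l * x 0 l).
pose Kq := \sum_(l < m.+2) q l.
have q0 l : 0 <= q l by exact: sqrtr_ge0.
have Kq0 : 0 <= Kq by exact: sumr_ge0.
have qK (l : 'I_m.+2) : q l <= Kq by rewrite /Kq (bigD1 l)//= lerDl sumr_ge0.
have scale_norm x : `|scale x| <= Kq * `|x|.
  apply: row_norm_le => [|l]; first exact: mulr_ge0.
  rewrite mxE normrM ger0_norm//; apply: ler_pM => //; last exact: row_norm_ge.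
  exact: (qK (widen_ord (leqnSn _) l)).
have scale_sub x y : scale x - scale y = scale (x - y).
  by apply/rowP => l; rewrite !mxE mulrBr.
pose F (z : 'rV[R]_m.+1 * R) := f (P (scale z.1), q m.+1 * z.2).
have Fp : plip Num.norm (@ndist R ('rV[R]_m.+1 * R)%type) F.
  have K1 : 0 <= (1 + K) * (1 + Kq) by rewrite mulr_ge0// addr_ge0.
  apply: (plip_comp (g := fun z : 'rV[R]_m.+1 * R => (P (scale z.1), q m.+1 * z.2))
     _ _ _ K1 _ _ fp) => [z|z z'|z|z|z z'].
  - exact: norm0.
  - exact: ndist0.
  - by rewrite addr_ge0// pnorm_ge0.
  - rewrite /cylN /pairN /= normrM ger0_norm//.
    have h1 : pnorm S (P (scale z.1)) <= K * (1 + Kq * `|z|).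
      rewrite (le_trans (PN _))// ler_wpM2l// lerD2l (le_trans (scale_norm _))//.
      by rewrite ler_wpM2l// pair_norm_fst.
    have h2 : q m.+1 * `|z.2| <= Kq * `|z|.
      by rewrite ler_pM ?pair_norm_snd//; exact: (qK ord_max).
    have := normr_ge0 z; have := mulr_ge0 Kq0 (normr_ge0 z).
    have := mulr_ge0 K0 Kq0; have := mulr_ge0 K0 (normr_ge0 z); lra.
  - rewrite /cylD /pairD /=.
    have h1 : pdist S (P (scale z.1)) (P (scale z'.1)) <= K * (Kq * ndist z z').
      rewrite (le_trans (PD _ _))// ler_wpM2l// /ndist scale_sub.
      by rewrite (le_trans (scale_norm _))// ler_wpM2l// (pair_norm_fst (z - z')).
    have h2 : ndist (q m.+1 * z.2) (q m.+1 * z'.2) <= Kq * ndist z z'.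
      rewrite /ndist -mulrBr normrM ger0_norm//.
      by rewrite ler_pM ?(pair_norm_snd (z - z'))//; exact: (qK ord_max).
    have := ndist0 z z'; have := mulr_ge0 K0 (ndist0 z z'); lra.
have EF := independent_plip sE' (xi_ind m) Fp.
have F_law : E (fun w : Omega T => f (w, w t - w s)) =
    E' (fun w => F (\row_(j < m.+1) xi j w, xi m.+1 w)).
  pose phi (x : 'rV[R]_m.+2) :=
    f (P (\row_(l < m.+1) x 0 (widen_ord (leqnSn _) l)), x 0 ord_max).
  have phip : C_lLip phi.
    apply/C_lLipP; have K1 : 0 <= 1 + K by rewrite addr_ge0.
    pose rst (x : 'rV[R]_m.+2) : 'rV[R]_m.+1 :=
      \row_(l < m.+1) x 0 (widen_ord (leqnSn _) l).
    have rst_norm x : `|rst x| <= `|x|.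
      by apply: row_norm_le => // l; rewrite mxE; exact: row_norm_ge.
    have rst_sub x y : rst x - rst y = rst (x - y).
      by apply/rowP => l; rewrite !mxE.
    apply: (plip_comp (g := fun x => (P (rst x), x 0 ord_max)) _ _ _ K1 _ _ fp)
      => [x|x y|z|x|x y].
    - exact: norm0.
    - exact: ndist0.
    - by rewrite addr_ge0// pnorm_ge0.
    - rewrite /cylN /pairN /=; have := row_norm_ge x ord_max.
      have : pnorm S (P (rst x)) <= K * (1 + `|x|).
        by rewrite (le_trans (PN _))// ler_wpM2l// lerD2l.
      have := normr_ge0 x; lra.
    - rewrite /cylD /pairD /=; have := row_norm_ge (x - y) ord_max.
      have : pdist S (P (rst x)) (P (rst y)) <= K * `|x - y|.
        by rewrite (le_trans (PD _ _))// ler_wpM2l// /ndist rst_sub.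
      by rewrite /ndist !mxE; lra.
  have /= := xi_law tt0 tt_lt _ phip; rewrite ttt => /(_ tT).
  have -> : (fun w : Omega T => phi (\row_(i < m.+2) (w (tt i.+1) - w (tt i)))) =
      (fun w : Omega T => f (w, w t - w s)).
    apply/funext => w; rewrite /phi mxE /= ttt tts; apply: f_agree => r rS.
    rewrite -[RHS](P_inc _ _ rS); congr (P _ r).
    by apply/rowP => l; rewrite !mxE.
  move=> ->; congr E'; apply/funext => w; rewrite /phi /F /= mxE.
  congr (f (P _, _)); apply/rowP => l; by rewrite !mxE.
rewrite F_law EF.
have F_avg (w0 : Omega T) :
    E' (fun w' => f (w0, q m.+1 * xi m.+1 w')) = g w0.
  pose phi (x : 'rV[R]_m.+2) := f (w0, x 0 ord_max).
  have phip : C_lLip phi.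
    apply/C_lLipP.
    have f0p := plip_freeze_pair (pnorm_ge0 S) (@pdistxx S) w0 fp.
    exact: (plip_entry ord_max f0p).
  have /= := xi_law tt0 tt_lt _ phip; rewrite ttt => /(_ tT).
  have -> : (fun w : Omega T => phi (\row_(i < m.+2) (w (tt i.+1) - w (tt i)))) =
      (fun w : Omega T => f (w0, w t - w s)).
    by apply/funext => w; rewrite /phi mxE /= ttt tts.
  by rewrite /g => ->; congr E'; apply/funext => w; rewrite /phi /= mxE.
have -> : (fun w => E' (fun w' => F (\row_(j < m.+1) xi j w, xi m.+1 w'))) =
    (fun w => g (P (\row_(l < m.+1) (q l * xi l w)))).
  apply/funext => w; rewrite -F_avg /F /=; congr E'; apply/funext => w'.
  by congr (f (P _, _)); apply/rowP => l; rewrite !mxE.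
have gPp : C_lLip (g \o P).
  by apply/C_lLipP; apply: (plip_comp _ _ _ K0 PN PD gp) => [x|x y|w];
    [exact: norm0 | exact: ndist0 | exact: pnorm_ge0].
have tt_lt2 i : (i <= m)%N -> tt i < tt i.+1 by move=> /leqW; exact: tt_lt.
have /= <- := xi_law tt0 tt_lt2 _ gPp; last by rewrite tts.
congr E; apply/funext => w; apply: plip_agree gp _ => r; exact: P_inc.
Qed.
End GIncrements.

(** * Moments of the increments *)

Section PlipReal.
Context {R : realType}.

Lemma plipR_id : plip Num.norm (@ndist R R) (fun x => x).
Proof. by exists 1, 0%N; split=> // x y; rewrite expr0 !mul1r. Qed.

Lemma plipR_lin c : plip Num.norm (@ndist R R) (fun x => c * x).
Proof. by apply: plip_scale; exact: plipR_id. Qed.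

Lemma plipR_sqr c d : plip Num.norm (@ndist R R) (fun x => c * (x ^+ 2 - d)).
Proof.
apply: plip_scale; apply: (@plip_add _ _ _ _ (@norm0 R R) (@ndist0 R R)).
  apply: plip_exp; [exact: norm0|exact: ndist0|exact: ndist_norm|exact: plipR_id].
exact: plip_cst.
Qed.

Lemma plipR_sqr2 c d :
  plip Num.norm (@ndist R R) (fun x => (c * (x ^+ 2 - d)) ^+ 2).
Proof.
by apply: plip_exp; [exact: norm0|exact: ndist0|exact: ndist_norm|exact: plipR_sqr].
Qed.
End PlipReal.

Section GNormal.
Context {R : realType} {Om : Type} {H : set (Om -> R)} {E : (Om -> R) -> R}.
Context (sE : sublinear_expectation H E) {slo shi : R} {xi : Om -> R}.
Context (xiG : G_normal slo shi H E xi).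

Lemma G_normal_rv f : plip Num.norm (@ndist R R) f -> H (fun w => f (xi w)).
Proof. by move=> /C_lLipP; case: xiG => + _ _; apply. Qed.

(** With an independent copy [xi'], the mean [e] of [c * xi] satisfies
    [2 e = E (c xi + c xi') = sqrt 2 * e]. *)
Lemma G_normal_mean c : E (fun w => c * xi w) = 0.
Proof.
case: xiG => xiH [xi' [same ind stable]] _.
have linp := @plipR_lin R c; have lin : C_lLip (fun x : R => c * x).
  exact/C_lLipP.
have e_xi' : E (fun w => c * xi' w) = E (fun w => c * xi w) by exact: same.
set e := E (fun w => c * xi w) in e_xi' *.
have HX : H (fun w => c * xi w) := G_normal_rv linp.
have sum2 : E (fun w => c * xi w + c * xi' w) = e + e.
  have -> : E (fun w => c * xi w + c * xi' w) =
      E (fun w => E (fun w' => c * xi w + c * xi' w')).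
    apply: (independent_plip (f := fun z : R * R => c * z.1 + c * z.2) sE ind).
    exists (2 * `|c|), 0%N; split=> [|z z']; first by rewrite mulr_ge0.
    rewrite expr0 mulr1.
    have -> : c * z.1 + c * z.2 - (c * z'.1 + c * z'.2) =
      c * (z.1 - z'.1) + c * (z.2 - z'.2) by ring.
    rewrite (le_trans (ler_normD _ _))// !normrM -mulrDr -mulrA mulrCA ler_wpM2l//.
    have := pair_norm_fst (z - z'); have := pair_norm_snd (z - z').
    by rewrite /ndist /=; lra.
  rewrite -(sexp_addc sE e HX); congr E; apply/funext => w.
  have Hxi' : H (fun w' => c * xi' w') by exact: (plip_snd ind linp).
  by under eq_fun do rewrite addrC; rewrite (sexp_addc sE _ Hxi') e_xi' addrC.
have sumS : E (fun w => c * xi w + c * xi' w) = Num.sqrt 2 * e.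
  have := stable 1 1 ler01 ler01 _ lin; rewrite !expr1n /= => st.
  transitivity (E (fun w => c * (1 * xi w + 1 * xi' w))).
    by congr E; apply/funext => w; rewrite !mul1r mulrDr.
  rewrite [LHS]st -(sexp_homogeneous sE (sqrtr_ge0 _) HX); congr E.
  by apply/funext => w /=; rewrite mulrCA; congr (Num.sqrt _ * _).
have /eqP : (2 - Num.sqrt 2) * e = 0 by rewrite mulrBl -sumS sum2; ring.
rewrite mulf_eq0 => /orP[/eqP h|/eqP //].
have : Num.sqrt 2 ^+ 2 = 2 :> R by rewrite sqr_sqrtr.
have -> : Num.sqrt 2 = 2 :> R by lra.
by rewrite expr2 => h2; exfalso; lra.
Qed.

Lemma G_normal_var c : 0 <= c -> E (fun w => c * (xi w ^+ 2 - shi ^+ 2)) = 0.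
Proof.
move=> c0; case: xiG => _ _ /(_ c); rewrite /Gfun.
have -> : Num.max c 0 = c by apply/max_idPl.
have -> : Num.max (- c) 0 = 0 by apply/max_idPr; rewrite oppr_le0.
rewrite mulr0 subr0 => h.
have Hsq : H (fun w => c * xi w ^+ 2).
  have := G_normal_rv (@plipR_sqr R c 0).
  by under eq_fun do rewrite subr0.
have -> : (fun w => c * (xi w ^+ 2 - shi ^+ 2)) =
    (fun w => c * xi w ^+ 2 + - (c * shi ^+ 2)).
  by apply/funext => w; ring.
rewrite (sexp_addc sE _ Hsq).
have -> : E (fun w => c * xi w ^+ 2) = shi ^+ 2 * c by lra.
ring.
Qed.
End GNormal.

(** The properties of the canonical process on which the proof rests: [v] is
    the upper variance and [K] bounds the fourth moment of the increments. *)
Record G_brownian {R : realType} {T : R} (E : (Omega T -> R) -> R) (v K : R) :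
    Prop := GBrownian {
  gb_sexp : sublinear_expectation (cyl T) E ;
  gb_v0 : 0 < v ;
  gb_mean : forall s t c : R, 0 <= s -> s < t -> t <= T ->
    E (fun w => c * (w t - w s)) = 0 ;
  gb_var : forall s t c : R, 0 <= s -> s < t -> t <= T -> 0 <= c ->
    E (fun w => c * ((w t - w s) ^+ 2 - v * (t - s))) = 0 ;
  gb_fourth : forall s t : R, 0 <= s -> s < t -> t <= T ->
    E (fun w => ((w t - w s) ^+ 2 - v * (t - s)) ^+ 2) <= K * (t - s) ^+ 2 ;
  gb_indep : forall (s t : R) (S : seq R) f, 0 <= s -> s < t -> t <= T ->
    (forall r, r \in S -> 0 <= r <= s) -> plip (cylN S) (cylD S) f ->
    plip (pnorm S) (pdist S)
      (fun w => E (fun w' : Omega T => f (w, w' t - w' s))) /\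
    E (fun w => f (w, w t - w s)) =
      E (fun w => E (fun w' : Omega T => f (w, w' t - w' s))) }.

Lemma G_expectation_brownian {R : realType} {T slo shi : R}
    (E : (Omega T -> R) -> R) : 0 < T -> 0 < shi ->
  G_expectation slo shi E -> exists K, G_brownian E (shi ^+ 2) K.
Proof.
move=> T0 shi0 [sEH [Om [H [E' [xi [sE' xiG xi_ind xi_law]]]]]].
have sE := cyl_sexp T0 sEH.
pose M i := E' (fun w => (1 * (xi i w ^+ 2 - shi ^+ 2)) ^+ 2).
have M0 i : 0 <= M i.
  apply: (sexp_ge0 sE'); last by move=> w; exact: sqr_ge0.
  exact: (G_normal_rv (xiG i) (plipR_sqr2 _ _)).
exists (M 0%N + M 1%N); split => //.
- by rewrite exprn_gt0.
- move=> s t c s0 st tT.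
  have [i _ law] := @increment_law _ _ E _ E' xi xi_law _ _ s0 st tT.
  rewrite (law _ (plipR_lin c)).
  by under eq_fun do rewrite mulrA; exact: (G_normal_mean sE' (xiG i)).
- move=> s t c s0 st tT c0.
  have [i _ law] := @increment_law _ _ E _ E' xi xi_law _ _ s0 st tT.
  have ts : 0 <= t - s by rewrite subr_ge0 ltW.
  rewrite (law _ (plipR_sqr c _)).
  have -> : (fun w => c * ((Num.sqrt (t - s) * xi i w) ^+ 2 -
      shi ^+ 2 * (t - s))) = fun w => (c * (t - s)) * (xi i w ^+ 2 - shi ^+ 2).
    by apply/funext => w; rewrite exprMn sqr_sqrtr//; ring.
  by apply: (G_normal_var sE' (xiG i)); exact: mulr_ge0.
- move=> s t s0 st tT.
  have [i i1 law] := @increment_law _ _ E _ E' xi xi_law _ _ s0 st tT.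
  have ts : 0 <= t - s by rewrite subr_ge0 ltW.
  have := law _ (plipR_sqr2 1 (shi ^+ 2 * (t - s))).
  under eq_fun do rewrite mul1r; move=> ->.
  have -> : (fun w => (1 * ((Num.sqrt (t - s) * xi i w) ^+ 2 -
      shi ^+ 2 * (t - s))) ^+ 2) =
      fun w => (t - s) ^+ 2 * (1 * (xi i w ^+ 2 - shi ^+ 2)) ^+ 2.
    by apply/funext => w; rewrite !mul1r exprMn sqr_sqrtr//; ring.
  rewrite (sexp_homogeneous sE'); first 1 last.
  + exact: sqr_ge0.
  + exact: (G_normal_rv (xiG i) (plipR_sqr2 _ _)).
  rewrite mulrC ler_wpM2r ?sqr_ge0//.
  by case: i i1 {law} => [|[|//]] _; rewrite -/(M _) ?lerDl ?lerDr.
- move=> s t S f s0 st tT.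
  exact: (@increment_independent _ _ E _ _ E' xi sE sE' xi_ind xi_law _ _ _ _ s0 st tT).
Qed.

(** * The completed expectation *)

Section Completion.
Context {R : realType} {T : R} {E : (Omega T -> R) -> R} {v K : R}.
Context (T0 : 0 < T) (gb : G_brownian E v K).
Let sE : sublinear_expectation (cyl T) E := gb_sexp gb.

(** A sequence that represents a random variable of the completion is encoded
    as a function on the product of [nat] and the paths. The extended
    expectation then is a sublinear expectation on a lattice of functions. *)
Definition EL (X : nat * Omega T -> R) : R := Eext E (fun n w => X (n, w)).

Definition Lc (s : R) : set (nat * Omega T -> R) :=
  [set X | (forall n, cyl s (fun w => X (n, w))) /\
     forall e : R, 0 < e -> exists n0, forall m n, (n0 <= m)%N -> (n0 <= n)%N ->
       E (fun w => `|X (m, w) - X (n, w)|) < e].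

Lemma L1G_Lc t (A : rvseq T) : 0 <= t <= T ->
  L1G E t A -> Lc t (fun p => A p.1 p.2).
Proof.
move=> tT [A1 A2]; split=> [n|]; last exact: A2.
by rewrite -H0_cyl//; exact: A1.
Qed.

Lemma Lc_le s t : s <= t -> Lc s `<=` Lc t.
Proof. by move=> st X [X1 X2]; split=> // n; exact: (cyl_le st). Qed.

Lemma EL_cvg X : Lc T X -> E (fun w => X (n, w)) @[n --> \oo] --> EL X.
Proof.
move=> [X1 X2]; apply: cauchy_cvg; apply/cauchy_ballP => e e0.
have [n0 n0P] := X2 e e0.
pose A := [set x | exists2 n, (n0 <= n)%N & x = E (fun w => X (n, w))].
exists (A, A); first by split; exists n0 => // n nn; exists n.
move=> [x y] [/= [m mn0 ->] [n nn0 ->]].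
rewrite -ball_normE /=; apply: le_lt_trans (n0P m n mn0 nn0).
exact: (sexp_dist sE).
Qed.

Lemma EL_unique X l : (E (fun w => X (n, w)) @[n --> \oo] --> l) -> EL X = l.
Proof. by move=> /cvg_lim; apply; exact: Rhausdorff. Qed.

Lemma EL_snd X : EL (fun p => X p.2) = E X.
Proof. by apply: EL_unique => /=; exact: cvg_cst. Qed.

Lemma Lc_snd s X : cyl s X -> Lc s (fun p => X p.2).
Proof.
move=> Xs; split=> // e e0; exists 0%N => m n _ _ /=.
by under eq_fun do rewrite subrr normr0; rewrite (sexp_cst sE).
Qed.

Lemma Lc_lip2 (f : R -> R -> R) (L : R) s X Y : 0 < L -> s <= T ->
  (forall X Y : Omega T -> R, cyl s X -> cyl s Y ->
     cyl s (fun w => f (X w) (Y w))) ->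
  (forall x y x' y', `|f x y - f x' y'| <= L * (`|x - x'| + `|y - y'|)) ->
  Lc s X -> Lc s Y -> Lc s (fun p => f (X p) (Y p)).
Proof.
move=> L0 sT fcyl fL [X1 X2] [Y1 Y2]; split=> [n|e e0]; first exact: fcyl.
have eL : 0 < e / (2 * L) by rewrite divr_gt0// mulr_gt0.
have [n1 h1] := X2 _ eL; have [n2 h2] := Y2 _ eL.
exists (maxn n1 n2) => m n; rewrite !geq_max => /andP[m1 m2] /andP[nn1 nn2].
have cX k := cyl_le sT (X1 k); have cY k := cyl_le sT (Y1 k).
have cf k := cyl_le sT (fcyl _ _ (X1 k) (Y1 k)).
have cXX := cyl_abs (cyl_sub (cX m) (cX n)).
have cYY := cyl_abs (cyl_sub (cY m) (cY n)).
apply: (@le_lt_trans _ _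
    (L * E (fun w => `|X (m, w) - X (n, w)| + `|Y (m, w) - Y (n, w)|))).
  rewrite -(sexp_homogeneous sE (ltW L0) (cyl_add cXX cYY)).
  apply: (sexp_monotone sE) => [||w]; last exact: fL.
    exact/cyl_abs/cyl_sub.
  exact/cyl_scale/cyl_add.
rewrite -ltr_pdivlMl//; apply: le_lt_trans (sexp_add sE cXX cYY) _.
have := h1 m n m1 nn1; have := h2 m n m2 nn2.
have -> : e / (2 * L) = 2^-1 * (L^-1 * e) by rewrite invfM; ring.
lra.
Qed.

Lemma Lc_add s X Y : s <= T -> Lc s X -> Lc s Y -> Lc s (fun p => X p + Y p).
Proof.
move=> sT; apply: (@Lc_lip2 +%R 1) => //; first exact: cyl_add.
by move=> x y x' y'; rewrite mul1r opprD addrACA; exact: ler_normD.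
Qed.

Lemma Lc_max s X Y : s <= T -> Lc s X -> Lc s Y ->
  Lc s (fun p => Num.max (X p) (Y p)).
Proof.
move=> sT; apply: (@Lc_lip2 Num.max 1) => //; first exact: cyl_max.
move=> x y x' y'; rewrite mul1r.
have -> : Num.max x y - Num.max x' y' = (Num.max x y - Num.max x' y) +
  (Num.max x' y - Num.max x' y') by ring.
rewrite (le_trans (ler_normD _ _))// lerD ?max_lip//.
by rewrite ![Num.max x' _]maxC max_lip.
Qed.

Lemma Lc_bmul s a X : s <= T -> bcyl s a -> Lc s X ->
  Lc s (fun p => a p.2 * X p).
Proof.
move=> sT [S Ss aS] [X1 X2]; have [C [C0 aC _]] := aS.
have as_ : cyl s a by apply: bcyl_cyl; exists S.
split=> [n|e e0]; first exact: cyl_mul.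
have eC : 0 < e / (C + 1) by rewrite divr_gt0// ltr_pwDr.
have [n0 h] := X2 _ eC; exists n0 => m n mn nn.
have cX k := cyl_le sT (X1 k); have ca := cyl_le sT as_.
have cXX := cyl_abs (cyl_sub (cX m) (cX n)).
apply: (@le_lt_trans _ _ ((C + 1) * E (fun w => `|X (m, w) - X (n, w)|))).
  have C1 : 0 <= C + 1 by rewrite addr_ge0.
  rewrite -(sexp_homogeneous sE C1 cXX).
  apply: (sexp_monotone sE) => [||w /=].
  - by apply: cyl_abs; apply: cyl_sub; apply: cyl_mul.
  - exact: cyl_scale.
  by rewrite -mulrBr normrM ler_wpM2r// (le_trans (aC w))// lerDl.
by rewrite -ltr_pdivlMl ?ltr_pwDr// mulrC h.
Qed.

Lemma Lc_scale s c X : s <= T -> Lc s X -> Lc s (fun p => c * X p).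
Proof. by move=> sT; apply: (Lc_bmul sT); exact: bcyl_cst. Qed.

Lemma EL_sexp : sublinear_expectation (Lc T) EL.
Proof.
have TT := lexx T; split.
- by move=> c; apply: (Lc_snd (X := fun=> c)); exact: cyl_cst.
- by move=> X Y; exact: Lc_add.
- by move=> c X; exact: Lc_scale.
- by move=> X Y; exact: Lc_max.
- move=> X Y HX HY XY; apply: (ler_cvg_to (EL_cvg HX) (EL_cvg HY)).
  by apply: nearW => n; apply: (sexp_monotone sE) (HX.1 n) (HY.1 n) _ => w.
- by move=> c; rewrite (EL_snd (fun=> c)) (sexp_cst sE).
- move=> X Y HX HY.
  have HXY : Lc T (fun p => X p - Y p).
    have := Lc_add TT HX (Lc_scale (-1) TT HY).
    by under eq_fun do rewrite mulN1r.
  apply: (ler_cvg_to (cvgB (EL_cvg HX) (EL_cvg HY)) (EL_cvg HXY)).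
  by apply: nearW => n; exact: (sexp_subadditive sE (HX.1 n) (HY.1 n)).
- move=> c X c0 HX; apply: EL_unique.
  under eq_fun do rewrite (sexp_homogeneous sE c0 (HX.1 _)).
  by apply: cvgM; [exact: cvg_cst | exact: EL_cvg].
Qed.

Lemma Lc_opp s X : s <= T -> Lc s X -> Lc s (fun p => - X p).
Proof.
by move=> sT HX; have := Lc_scale (-1) sT HX; under eq_fun do rewrite mulN1r.
Qed.

Lemma Lc_sub s X Y : s <= T -> Lc s X -> Lc s Y -> Lc s (fun p => X p - Y p).
Proof. by move=> sT HX HY; exact: (Lc_add sT HX (Lc_opp sT HY)). Qed.

Lemma Lc_abs s X : s <= T -> Lc s X -> Lc s (fun p => `|X p|).
Proof.
move=> sT HX; have := Lc_max sT HX (Lc_opp sT HX).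
by under eq_fun do rewrite maxrN.
Qed.

Lemma Lc_cst s c : Lc s (fun=> c).
Proof. by apply: (Lc_snd (X := fun=> c)); exact: cyl_cst. Qed.

Lemma Lc_sum s n (X : nat -> nat * Omega T -> R) : s <= T ->
  (forall i, (i < n)%N -> Lc s (X i)) ->
  Lc s (fun p => \sum_(0 <= i < n) X i p).
Proof.
move=> sT; elim: n => [|n IH] HX.
  by under eq_fun do rewrite big_geq//; exact: Lc_cst.
under eq_fun do rewrite big_nat_recr//=.
by apply: (Lc_add sT); [apply: IH => i /ltnW; exact: HX | exact: HX].
Qed.

(** ** Density *)

Lemma cyl_bcyl_approx s X e : s <= T -> 0 < e -> cyl s X ->
  exists2 Z, bcyl s Z & E (fun w => `|X w - Z w|) <= e.
Proof.
move=> sT e0 [S Ss XS].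
have [C [k [C0 cut]]] := plip_cutoff (pnorm_ge0 S) (pdist_ge0 S)
  (pnorm_dist S) (pdist_le S) XS.
have cW : cyl s (fun w : Omega T => C * (1 + pnorm S w) ^+ k).
  exists S => //.
  have -> : (fun w : Omega T => C * (1 + pnorm S w) ^+ k) =
      (fun w => C * (1 + 1 * pnorm S w) ^+ k).
    by apply/funext => w; rewrite mul1r.
  apply: plip_scale.
  exact: (plip_weight (pnorm_ge0 S) (pdist_ge0 S) (pnorm_dist S) (pdist_le S)).
set M := E (fun w => C * (1 + pnorm S w) ^+ k).
have [n nM] : exists n : nat, n.+1%:R^-1 * M <= e.
  exists (Num.truncn (M / e)); rewrite ler_pdivrMl// -ler_pdivrMr//.
  exact/ltW/truncnS_gt.
have [g gb_ gX] := cut n; exists g; first by exists S.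
have n0 : 0 <= n.+1%:R^-1 :> R by rewrite invr_ge0.
apply: le_trans nM; rewrite -(sexp_homogeneous sE n0 (cyl_le sT cW)).
apply: (sexp_monotone sE) => [||w]; last exact: gX.
  apply: (cyl_le sT); apply: cyl_abs; apply: cyl_sub; first by exists S.
  by apply: bcyl_cyl; exists S.
exact/cyl_scale/(cyl_le sT).
Qed.

Lemma Lc_cyl_approx s X e : s <= T -> 0 < e -> Lc s X ->
  exists2 Z, cyl s Z & EL (fun p => `|X p - Z p.2|) <= e.
Proof.
move=> sT e0 HX; have [X1 X2] := HX; have [n0 h] := X2 _ e0.
exists (fun w => X (n0, w)) => //.
have HD : Lc T (fun p => `|X p - X (n0, p.2)|).
  apply: (Lc_le sT); apply: (Lc_abs sT); apply: (Lc_sub sT) => //.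
  exact: (Lc_snd (X := fun w => X (n0, w))).
apply: (ler_cvg_to (EL_cvg HD) (cvg_cst e)).
near=> n; apply/ltW; apply: (h n n0) => //.
by near: n; exact: nbhs_infty_ge.
Unshelve. all: by end_near. Qed.

Lemma Lc_bcyl_approx s X e : s <= T -> 0 < e -> Lc s X ->
  exists2 Z, bcyl s Z & EL (fun p => `|X p - Z p.2|) <= e.
Proof.
move=> sT e0 HX; have e2 : 0 < e / 2 by rewrite divr_gt0.
have [Y HY XY] := Lc_cyl_approx sT e2 HX.
have [Z HZ YZ] := cyl_bcyl_approx sT e2 HY.
exists Z => //; have cZ := bcyl_cyl HZ.
have LX := Lc_le sT HX; have LY := Lc_le sT (Lc_snd HY).
have LZ := Lc_le sT (Lc_snd cZ); have TT := lexx T.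
have LXY := Lc_abs TT (Lc_sub TT LX LY).
have LYZ := Lc_abs TT (Lc_sub TT LY LZ).
apply: (@le_trans _ _ (EL (fun p => `|X p - Y p.2| + `|Y p.2 - Z p.2|))).
  apply: (sexp_monotone EL_sexp) => [||p]; last exact: ler_distD.
    exact/(Lc_abs TT)/(Lc_sub TT).
  exact: Lc_add.
apply: le_trans (sexp_add EL_sexp LXY LYZ) _.
have := EL_snd (fun w => `|Y w - Z w|); cbn beta => ->.
by rewrite [e]splitr lerD.
Qed.

(** ** Neutral random variables *)

(** [Y] is neutral after time [s] when adding it to a random variable known at
    time [s] does not change the expectation, which is how the vanishing of the
    conditional expectation of [Y] given the past of [s] is used. *)
Definition neutral (s : R) (Y : nat * Omega T -> R) : Prop :=
  forall X, Lc s X -> EL (fun p => X p + Y p) = EL X.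

Lemma neutral_le s t Y : s <= t -> neutral t Y -> neutral s Y.
Proof. by move=> st nY X HX; apply: nY; exact: (Lc_le st). Qed.

Lemma eq_of_eps (a b : R) : (forall e, 0 < e -> `|a - b| <= e) -> a = b.
Proof.
move=> h; apply/eqP; rewrite -subr_eq0 -normr_le0.
by apply/ler_addgt0Pr => e e0; rewrite add0r; exact: h.
Qed.

Lemma neutral_dense s Y : s <= T -> Lc T Y ->
  (forall X, bcyl s X -> EL (fun p => X p.2 + Y p) = E X) -> neutral s Y.
Proof.
move=> sT HY nY X HX; apply: eq_of_eps => e e0; have TT := lexx T.
have e2 : 0 < e / 2 by rewrite divr_gt0.
have [Z HZ XZ] := Lc_bcyl_approx sT e2 HX.
have LX := Lc_le sT HX; have LZ := Lc_le sT (Lc_snd (bcyl_cyl HZ)).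
have -> : EL (fun p => X p + Y p) - EL X =
  (EL (fun p => X p + Y p) - EL (fun p => Z p.2 + Y p)) +
  (EL (fun p => Z p.2) - EL X) by rewrite nY// EL_snd; ring.
rewrite (le_trans (ler_normD _ _))// [e]splitr lerD//.
  apply: le_trans (sexp_dist EL_sexp (Lc_add TT LX HY) (Lc_add TT LZ HY)) _.
  apply: le_trans XZ; rewrite le_eqVlt; apply/orP; left; apply/eqP; congr EL.
  by apply/funext => p; congr `|_|; ring.
by rewrite distrC; apply: le_trans (sexp_dist EL_sexp LX LZ) XZ.
Qed.

Lemma neutral_lim s Y : s <= T -> Lc T Y ->
  (forall e, 0 < e -> exists2 Z, Lc T Z /\ neutral s Z &
     EL (fun p => `|Y p - Z p|) <= e) -> neutral s Y.
Proof.
move=> sT HY h X HX; apply: eq_of_eps => e e0; have [Z [HZ nZ] YZ] := h e e0.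
have TT := lexx T; have LX := Lc_le sT HX.
rewrite -(nZ X HX).
apply: le_trans (sexp_dist EL_sexp (Lc_add TT LX HY) (Lc_add TT LX HZ)) _.
apply: le_trans YZ; rewrite le_eqVlt; apply/orP; left; apply/eqP; congr EL.
by apply/funext => p; congr `|_|; ring.
Qed.

(** Backward in time: each term is neutral for the sum of the earlier ones. *)
Lemma neutral_sum n (s : nat -> R) (Y : nat -> nat * Omega T -> R) :
  (forall i, (i <= n)%N -> s i <= T) ->
  (forall i, (i < n)%N -> s i <= s i.+1) ->
  (forall i, (i < n)%N -> Lc (s i.+1) (Y i) /\ neutral (s i) (Y i)) ->
  neutral (s 0%N) (fun p => \sum_(0 <= i < n) Y i p).
Proof.
move=> sT smon HY X HX.
have s0n m : (m <= n)%N -> s 0%N <= s m.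
  by elim: m => // m IH mn; rewrite (le_trans (IH (ltnW mn)))// smon.
have sle i m : (i <= m)%N -> (m <= n)%N -> s i <= s m.
  elim: m => [|m IH]; first by rewrite leqn0 => /eqP ->.
  rewrite leq_eqVlt => /orP[/eqP -> //|im mn].
  by rewrite (le_trans (IH im (ltnW mn)))// smon.
have HS m : (m <= n)%N -> Lc (s m) (fun p => X p + \sum_(0 <= i < m) Y i p).
  move=> mn; have sm := sT m mn; apply: (Lc_add sm).
    exact: (Lc_le (s0n m mn)).
  apply: (Lc_sum sm) => i im; apply: (Lc_le (sle i.+1 m im mn)).
  by have [] := HY i (leq_trans im mn).
suff : forall m, (m <= n)%N -> EL (fun p => X p + \sum_(0 <= i < m) Y i p) = EL X.
  exact.
elim=> [|m IH] mn.
  by congr EL; apply/funext => p; rewrite big_geq// addr0.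
rewrite -(IH (ltnW mn)) -((HY m mn).2 _ (HS m (ltnW mn))).
by congr EL; apply/funext => p; rewrite big_nat_recr//= addrA.
Qed.

(** ** Increments of the canonical process are neutral *)

Lemma cylN_ge0 (S : seq R) (z : Omega T * R) : 0 <= cylN S z.
Proof. by rewrite addr_ge0// pnorm_ge0. Qed.

Lemma cylD_ge0 (S : seq R) (z z' : Omega T * R) : 0 <= cylD S z z'.
Proof. by rewrite addr_ge0// ?pdist_ge0// ndist0. Qed.

Lemma cylD_le (S : seq R) (z z' : Omega T * R) :
  cylD S z z' <= cylN S z + cylN S z'.
Proof.
rewrite /cylD /pairD /cylN /pairN addrACA lerD//; first exact: pdist_le.
exact: ndist_norm.
Qed.

Lemma plip_past (S : seq R) (X : Omega T -> R) : plip (pnorm S) (pdist S) X ->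
  plip (cylN S) (cylD S) (fun z => X z.1).
Proof.
apply: (plip_comp (g := fst) (@cylN_ge0 S) (@cylD_ge0 S) (pnorm_ge0 S) ler01).
- by move=> z; rewrite mul1r /cylN /pairN; have := normr_ge0 z.2; lra.
- by move=> z z'; rewrite mul1r /cylD /pairD lerDl ndist0.
Qed.

Lemma plip_incr (S : seq R) (f : R -> R) : plip Num.norm (@ndist R R) f ->
  plip (cylN S) (cylD S) (fun z : Omega T * R => f z.2).
Proof.
apply: (plip_comp (g := snd) (@cylN_ge0 S) (@cylD_ge0 S) (@norm0 R R) ler01).
- by move=> z; rewrite mul1r /cylN /pairN; have := pnorm_ge0 S z.1; lra.
- by move=> z z'; rewrite mul1r /cylD /pairD lerDr pdist_ge0.
Qed.

(** Freezing the past, the increment contributes [a * f] of mean zero. *)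
Lemma neutral_incr s t a (f : R -> R) : 0 <= s -> s < t -> t <= T ->
  cyl s a -> plip Num.norm (@ndist R R) f ->
  (forall w : Omega T, E (fun w' => a w * f (w' t - w' s)) = 0) ->
  neutral s (fun p => a p.2 * f (p.2 t - p.2 s)).
Proof.
move=> s0 st tT ca fp Ef X [X1 _]; rewrite /EL /Eext.
suff -> : (fun n => E (fun w => X (n, w) + a w * f (w t - w s))) =
  (fun n => E (fun w => X (n, w))) by [].
apply/funext => n; have [S [Ss XS aS]] := cyl_common (X1 n) ca.
pose F (z : Omega T * R) := X (n, z.1) + a z.1 * f z.2.
have Fp : plip (cylN S) (cylD S) F.
  apply: (plip_add (@cylN_ge0 S) (@cylD_ge0 S)).
    exact: (plip_past XS).
  apply: (plip_mul (@cylN_ge0 S) (@cylD_ge0 S) (@cylD_le S)).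
    exact: plip_past.
  exact: plip_incr.
have [_ /= ->] := gb_indep gb s0 st tT Ss Fp.
congr E; apply/funext => w; rewrite /F /=.
under eq_fun do rewrite addrC.
have stT : 0 <= s <= t by rewrite s0 ltW.
rewrite (sexp_addc sE _ _) ?Ef ?add0r//.
apply: cyl_scale; apply: (@cyl_increment_rv _ _ s t [::] (fun z => f z.2)) => //.
exact: plip_incr.
Qed.

Lemma neutral_mean s t a : 0 <= s -> s < t -> t <= T -> cyl s a ->
  neutral s (fun p => a p.2 * (p.2 t - p.2 s)).
Proof.
move=> s0 st tT ca; apply: (@neutral_incr s t a (fun x => x)) => //.
  exact: plipR_id.
by move=> w; exact: (gb_mean gb).
Qed.

Lemma neutral_var s t a : 0 <= s -> s < t -> t <= T -> cyl s a ->
  (forall w, 0 <= a w) ->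
  neutral s (fun p => a p.2 * ((p.2 t - p.2 s) ^+ 2 - v * (t - s))).
Proof.
move=> s0 st tT ca a0.
apply: (@neutral_incr s t a (fun x => x ^+ 2 - v * (t - s))) => //.
  have := @plipR_sqr R 1 (v * (t - s)).
  by under eq_fun do rewrite mul1r.
by move=> w; apply: (gb_var gb).
Qed.
End Completion.
Arguments EL {R T} E X.
Arguments Lc {R T} E s _.
Arguments neutral {R T} E s Y.

(** * Sums over grids *)

Section ConsecutiveSums.
Context {R : realType}.

Fixpoint lsum (F : R -> R -> R) (a : R) (s : seq R) : R :=
  if s is x :: s' then F a x + lsum F x s' else 0.

Lemma lsumE F a s :
  \sum_(0 <= j < size s) F (nth 0 (a :: s) j) (nth 0 (a :: s) j.+1) = lsum F a s.
Proof.
elim: s a => [|x s IH] a; first by rewrite big_geq.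
by rewrite big_nat_recl//= -(IH x).
Qed.

Lemma lsum_node F s :
  \sum_(0 <= j < size s) F (node s j) (node s j.+1) = lsum F 0 s.
Proof. exact: lsumE. Qed.

Lemma lsum_cat F a s s' : lsum F a (s ++ s') = lsum F a s + lsum F (last a s) s'.
Proof. by elim: s a => [|x s IH] a /=; rewrite ?add0r// IH addrA. Qed.

Definition grid (s t : R) (n : nat) (i : nat) : R := s + (t - s) / n%:R * i%:R.

Definition gridseq s t n : seq R := mkseq (fun i => grid s t n i.+1) n.

Lemma grid0 s t n : grid s t n 0 = s.
Proof. by rewrite /grid mulr0 addr0. Qed.

Lemma grid_last s t n : (0 < n)%N -> grid s t n n = t.
Proof.
by move=> n0; rewrite /grid mulfVK ?pnatr_eq0 -?lt0n// addrC subrK.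
Qed.

Lemma grid_step s t n i : grid s t n i.+1 - grid s t n i = (t - s) / n%:R.
Proof. by rewrite /grid -natr1; ring. Qed.

Lemma grid_lt s t n i : s < t -> (0 < n)%N -> grid s t n i < grid s t n i.+1.
Proof.
by move=> st n0; rewrite -subr_gt0 grid_step divr_gt0 ?subr_gt0 ?ltr0n.
Qed.

Lemma grid_le s t n i j : s < t -> (0 < n)%N -> (i <= j)%N ->
  grid s t n i <= grid s t n j.
Proof.
move=> st n0; elim: j => [|j IH]; first by rewrite leqn0 => /eqP ->.
rewrite leq_eqVlt => /orP[/eqP -> //|ij].
by rewrite (le_trans (IH ij))// ltW// grid_lt.
Qed.

Lemma nth_gridseq s t n i : (i <= n)%N ->
  @nth R 0 (s :: gridseq s t n) i = grid s t n i.
Proof.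
case: i => [_|i ni] /=; first by rewrite grid0.
by rewrite nth_mkseq.
Qed.

Lemma gridseq_partition s t n : s < t -> (0 < n)%N ->
  itv_partition s t (gridseq s t n).
Proof.
move=> st n0; split.
  apply/(pathP 0) => i; rewrite size_mkseq => ni.
  by rewrite nth_gridseq ?(ltnW ni)// [X in _ < X]nth_mkseq// grid_lt.
apply/eqP; rewrite -nth_last size_mkseq; case: n n0 => // n _.
by rewrite nth_mkseq//= grid_last.
Qed.

Lemma lsum_grid F s t n :
  lsum F s (gridseq s t n) =
  \sum_(0 <= i < n) F (grid s t n i) (grid s t n i.+1).
Proof.
rewrite -lsumE size_mkseq !big_nat; apply: eq_bigr => i /= ni.
by rewrite nth_gridseq ?(ltnW ni)// nth_mkseq.
Qed.

Lemma gridseq_mesh s t n d : (t - s) / n%:R < d ->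
  path (fun x y => y - x < d) s (gridseq s t n).
Proof.
move=> nd; apply/(pathP 0) => i; rewrite size_mkseq => ni.
by rewrite nth_gridseq ?(ltnW ni)// [X in X - _]nth_mkseq// grid_step.
Qed.

Lemma small_ratio (a d : R) : 0 < d ->
  exists n0 : nat, (0 < n0)%N /\ forall n, (n0 <= n)%N -> a / n%:R < d.
Proof.
move=> d0; exists (Num.truncn (`|a| / d)).+1; split=> // n n0n.
have n0 : 0 < n%:R :> R by rewrite ltr0n (leq_trans _ n0n).
rewrite ltr_pdivrMr// (le_lt_trans (ler_norm a))// mulrC -ltr_pdivrMr//.
by rewrite (lt_le_trans (truncnS_gt _))// ler_nat.
Qed.
End ConsecutiveSums.

(** * The quadratic variation *)

Section QuadraticVariation.
Context {R : realType} {T : R} {E : (Omega T -> R) -> R} {v K : R}.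
Context (T0 : 0 < T) (gb : G_brownian E v K).
Let sE : sublinear_expectation (cyl T) E := gb_sexp gb.
Let sEL := EL_sexp gb.
Let TT := lexx T.

Definition centred (s t : R) n i (w : Omega T) : R :=
  (w (grid s t n i.+1) - w (grid s t n i)) ^+ 2 - v * ((t - s) / n%:R).

Definition centred_sum s t n m (w : Omega T) : R :=
  \sum_(0 <= i < m) centred s t n i w.

Section Grid.
Context {s t : R} {n : nat}.
Context (s0 : 0 <= s) (st : s < t) (tT : t <= T) (n0 : (0 < n)%N).
Let g := grid s t n.

Let g0 i : 0 <= g i.
Proof. by rewrite (le_trans s0)// -[X in X <= _](grid0 s t n) grid_le. Qed.

Let gT i : (i <= n)%N -> g i <= T.
Proof.
by move=> ni; rewrite (le_trans _ tT)// -[X in _ <= X](@grid_last _ s t n)// grid_le.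
Qed.

Lemma cyl_centred i : cyl (g i.+1) (centred s t n i).
Proof.
apply: cyl_sub; last exact: cyl_cst.
apply: cyl_sqr; apply: cyl_sub; apply: cyl_eval; rewrite g0 ?lexx//=.
by rewrite ltW// grid_lt.
Qed.

Lemma cyl_centred_sum m : cyl (g m) (centred_sum s t n m).
Proof.
apply: cyl_sum => i im; apply: (cyl_le (grid_le st n0 im)).
exact: cyl_centred.
Qed.

Lemma neutral_centred i a : (i < n)%N -> cyl (g i) a -> (forall w, 0 <= a w) ->
  neutral E (g i) (fun p => a p.2 * centred s t n i p.2).
Proof.
move=> ni ca a0.
have := neutral_var gb (g0 i) (grid_lt i st n0) (gT ni) ca a0.
by under eq_fun do rewrite grid_step.
Qed.

(** Law of large numbers, by orthogonality of the positive part of the partial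
    sum and of the next term. *)
Lemma centred_sum_sqr m : (m <= n)%N ->
  E (fun w => Num.max (centred_sum s t n m w) 0 ^+ 2) <=
    m%:R * (K * ((t - s) / n%:R) ^+ 2).
Proof.
elim: m => [|m IH] mn.
  rewrite mul0r (sexp_le_cst sE)// => [|w].
    apply: cyl_sqr; apply: cyl_max; last exact: cyl_cst.
    by apply: (cyl_le (gT mn)); exact: cyl_centred_sum.
  by rewrite /centred_sum big_geq// maxxx expr0n.
have cS := cyl_centred_sum m; have cp := cyl_max cS (cyl_cst _ 0).
have cS' := cyl_centred_sum m.+1; have cp' := cyl_max cS' (cyl_cst _ 0).
have ca := cyl_scale 2 cp.
have cy := cyl_centred m.
have := neutral_centred mn ca _.
move=> /(_ _)/(_ _ (Lc_snd gb (cyl_sqr cp))) nE.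
have {}nE : E (fun w => Num.max (centred_sum s t n m w) 0 ^+ 2 +
      2 * Num.max (centred_sum s t n m w) 0 * centred s t n m w) =
    E (fun w => Num.max (centred_sum s t n m w) 0 ^+ 2).
  rewrite -[RHS]EL_snd -nE; last by move=> w; rewrite mulr_ge0// le_max lexx orbT.
  by rewrite -[LHS]EL_snd.
have le_T (X : Omega T -> R) : cyl (g m.+1) X -> cyl T X.
  exact: (cyl_le (gT mn)).
have le_T' (X : Omega T -> R) : cyl (g m) X -> cyl T X.
  exact: (cyl_le (gT (ltnW mn))).
have c1 := le_T' _ (cyl_sqr cp).
have c2 := cyl_mul (le_T' _ ca) (le_T _ cy).
have c3 := le_T _ (cyl_sqr cy).
apply: (@le_trans _ _ (E (fun w => (Num.max (centred_sum s t n m w) 0 ^+ 2 +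
    2 * Num.max (centred_sum s t n m w) 0 * centred s t n m w) +
    centred s t n m w ^+ 2))).
  apply: (sexp_monotone sE) => [||w].
  - exact: (le_T _ (cyl_sqr cp')).
  - by apply: cyl_add => //; exact: cyl_add.
  rewrite /centred_sum big_nat_recr//= -/(centred_sum s t n m w).
  move: (centred_sum _ _ _ _ _) (centred _ _ _ _ _) => x y.
  have -> : Num.max x 0 ^+ 2 + 2 * Num.max x 0 * y + y ^+ 2 =
    (Num.max x 0 + y) ^+ 2 by ring.
  have x0 : x <= Num.max x 0 by rewrite le_max lexx.
  case: (leP (x + y) 0) => [_|xy]; first by rewrite expr0n sqr_ge0.
  by rewrite lerXn2r ?nnegrE ?lerD2r// ltW// (lt_le_trans xy)// lerD2r.
apply: le_trans (sexp_add sE (cyl_add c1 c2) c3) _.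
rewrite nE -natr1 mulrDl mul1r lerD// ?IH// ?(ltnW mn)//.
have := gb_fourth gb (g0 m) (grid_lt m st n0) (gT mn).
by rewrite -/g /g grid_step.
Qed.
End Grid.

Lemma centred_sum_small s t e : 0 <= s -> s < t -> t <= T -> 0 < e ->
  exists n0 : nat, forall n, (n0 <= n)%N -> (0 < n)%N ->
    E (fun w => Num.max (centred_sum s t n n w) 0) <= e.
Proof.
move=> s0 st tT e0; have e2 : 0 < e / 2 by rewrite divr_gt0.
have [n0 [_ n0P]] := small_ratio (K * (t - s) ^+ 2) (mulr_gt0 e2 e2).
exists n0 => n n0n n_gt0.
have cS := cyl_centred_sum s0 st n_gt0 n.
rewrite grid_last// in cS.
have cp := cyl_le tT (cyl_max cS (cyl_cst _ 0)).
have := sexp_abs_le_sqr sE e2 cp (cyl_sqr cp).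
have -> : (fun w => `|Num.max (centred_sum s t n n w) 0|) =
    (fun w => Num.max (centred_sum s t n n w) 0).
  by apply/funext => w; rewrite ger0_norm// le_max lexx orbT.
move=> /le_trans; apply; rewrite [leRHS]splitr lerD2r ler_pdivrMl//.
apply: (le_trans (centred_sum_sqr s0 st tT n_gt0 (leqnn n))).
have -> : n%:R * (K * ((t - s) / n%:R) ^+ 2) = K * (t - s) ^+ 2 / n%:R.
  have nn : n%:R != 0 :> R by rewrite pnatr_eq0 -lt0n.
  by field.
exact/ltW/n0P.
Qed.

Context {Q : R -> rvseq T} (Qqv : quadratic_variation E Q).

Lemma Lc_Q t : 0 <= t <= T -> Lc E t (fun p => Q t p.1 p.2).
Proof. by move=> tT; apply: (L1G_Lc tT); have [] := Qqv tT. Qed.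

Let sqsum (s : seq R) (w : Omega T) := lsum (fun x y => (w y - w x) ^+ 2) 0 s.

Lemma Q_partition t e : 0 <= t <= T -> 0 < e -> exists2 d : R, 0 < d &
  forall s, itv_partition 0 t s -> path (fun x y => y - x < d) 0 s ->
    EL E (fun p => `|sqsum s p.2 - Q t p.1 p.2|) < e.
Proof.
move=> tT e0; have [_ /(_ e e0)[d d0 dP]] := Qqv tT; exists d => // s sp ss.
have := dP s sp; rewrite /L1G_dist /EL /=.
have -> : (fun n w => `|sqsum s w - Q t n w|) = (fun n w =>
  `|\sum_(0 <= k < size s) (w (node s k.+1) - w (node s k)) ^+ 2 - Q t n w|).
  apply/funext => n; apply/funext => w; congr `|_ - _|.
  by rewrite /sqsum -lsum_node.
apply=> k ks; by have /(pathP 0)/(_ k ks) := ss.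
Qed.

(** Both [Q t] and [Q s] are limits along partitions of [0,t] and [0,s] that
    coincide on [0,s]; the difference is a sum over a grid of [s,t]. *)
Lemma Q_grid s t e : 0 <= s -> s < t -> t <= T -> 0 < e ->
  exists n0 : nat, forall n, (n0 <= n)%N -> (0 < n)%N ->
    EL E (fun p => `|Q t p.1 p.2 - Q s p.1 p.2 -
      \sum_(0 <= i < n) (p.2 (grid s t n i.+1) - p.2 (grid s t n i)) ^+ 2|) <= e.
Proof.
move=> s0 st tT e0; have e2 : 0 < e / 2 by rewrite divr_gt0.
have t0 := le_trans s0 (ltW st); have sT := le_trans (ltW st) tT.
have sTT : 0 <= s <= T by rewrite s0.
have tTT : 0 <= t <= T by rewrite t0.
have [d d0 dP] := Q_partition tTT e2; have [d' d'0 d'P] := Q_partition sTT e2.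
have [ps [psP psd psd']] : exists ps, [/\ itv_partition 0 s ps,
    path (fun x y => y - x < d) 0 ps & path (fun x y => y - x < d') 0 ps].
  have [s_eq0|s_neq0] := eqVneq s 0.
    by exists [::]; split=> //; split=> //=; rewrite s_eq0.
  have s_gt0 : 0 < s by rewrite lt_neqAle eq_sym s_neq0.
  have [k [k0 kP]] := small_ratio (s - 0) d0.
  have [k' [k'0 k'P]] := small_ratio (s - 0) d'0.
  exists (gridseq 0 s (maxn k k')); split.
  - by apply: gridseq_partition => //; rewrite (leq_trans k0)// leq_maxl.
  - by apply: gridseq_mesh; apply: kP; exact: leq_maxl.
  - by apply: gridseq_mesh; apply: k'P; exact: leq_maxr.
have [n0 [_ n0P]] := small_ratio (t - s) d0.
exists n0 => n n0n n_gt0.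
have ps_last : last 0 ps = s by case: psP => _ /eqP.
have dt : EL E (fun p => `|sqsum (ps ++ gridseq s t n) p.2 - Q t p.1 p.2|) < e / 2.
  apply: dP; first by apply: itv_partition_cat psP _; exact: gridseq_partition.
  by rewrite cat_path psd ps_last gridseq_mesh// n0P.
have ds := d'P _ psP psd'.
pose V (w : Omega T) := lsum (fun x y => (w y - w x) ^+ 2) s (gridseq s t n).
have VE w : V w = \sum_(0 <= i < n) (w (grid s t n i.+1) - w (grid s t n i)) ^+ 2.
  by rewrite /V lsum_grid.
have sumE w : sqsum (ps ++ gridseq s t n) w = sqsum ps w + V w.
  by rewrite /sqsum lsum_cat ps_last.
have cyl_lsum r l : itv_partition 0 r l -> r <= T -> cyl T (sqsum l).
  move=> lP rT; rewrite /sqsum.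
  under eq_fun do rewrite -lsum_node.
  have lb j : (j <= size l)%N -> 0 <= node l j <= T.
    by move=> /(node_bounds lP)/andP[-> /le_trans]; apply.
  apply: cyl_sum => j jl; apply: cyl_sqr; apply: cyl_sub; apply: cyl_eval; apply: lb => //.
  exact: ltnW.
have cs := Lc_snd gb (cyl_lsum _ _ psP sT).
have pst := itv_partition_cat psP (gridseq_partition st n_gt0).
have ct := Lc_snd gb (cyl_lsum _ _ pst tT).
have cQt := Lc_le tT (Lc_Q tTT); have cQs := Lc_le sT (Lc_Q sTT).
have cDt := Lc_abs gb TT (Lc_sub gb TT ct cQt).
have cDs := Lc_abs gb TT (Lc_sub gb TT cs cQs).
apply: (@le_trans _ _ (EL E (fun p =>
  `|sqsum (ps ++ gridseq s t n) p.2 - Q t p.1 p.2| +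
  `|sqsum ps p.2 - Q s p.1 p.2|))).
  apply: (sexp_monotone sEL) => [||p].
  - apply: (Lc_abs gb TT); apply: (Lc_sub gb TT); first exact: (Lc_sub gb TT).
    under eq_fun do rewrite -VE.
    have -> : (fun p : nat * Omega T => V p.2) =
      (fun p => sqsum (ps ++ gridseq s t n) p.2 - sqsum ps p.2).
      by apply/funext => p; rewrite sumE; ring.
    exact: (Lc_sub gb TT).
  - exact: (Lc_add gb TT).
  rewrite -VE -[X in _ <= X + _]normrN.
  apply: le_trans (ler_normD _ _); rewrite sumE le_eqVlt; apply/orP; left.
  by apply/eqP; congr `|_|; ring.
by apply: le_trans (sexp_add sEL cDt cDs) _; rewrite [e]splitr lerD// ltW.
Qed.

Lemma sum_sqr_centred s t n (w : Omega T) : (0 < n)%N ->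
  \sum_(0 <= i < n) (w (grid s t n i.+1) - w (grid s t n i)) ^+ 2 =
  centred_sum s t n n w + v * (t - s).
Proof.
move=> n0; rewrite /centred_sum sumrB sumr_const_nat subn0.
have nn : n%:R != 0 :> R by rewrite pnatr_eq0 -lt0n.
have -> : v * ((t - s) / n%:R) *+ n = v * (t - s).
  by rewrite -[LHS]mulr_natr -!mulrA mulVf// mulr1.
by rewrite subrK.
Qed.

Section QIncrement.
Context {s t : R} (s0 : 0 <= s) (st : s < t) (tT : t <= T).
Let sTT : 0 <= s <= T. Proof. by rewrite s0 (le_trans (ltW st)). Qed.
Let tTT : 0 <= t <= T. Proof. by rewrite tT (le_trans s0 (ltW st)). Qed.

Lemma Lc_dQ : Lc E t (fun p => Q t p.1 p.2 - Q s p.1 p.2).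
Proof.
by apply: (Lc_sub gb tT); [exact: Lc_Q | apply: (Lc_le (ltW st)); exact: Lc_Q].
Qed.

Let Lc_csum n : (0 < n)%N -> Lc E T (fun p => centred_sum s t n n p.2).
Proof.
move=> n0; apply: (Lc_snd gb); apply: (cyl_le tT).
by have := cyl_centred_sum s0 st n0 n; rewrite grid_last.
Qed.

(** The distance of the increment of the quadratic variation to the interval
    [0, v * (t - s)] in which it lies quasi-surely. *)
Definition excess (p : nat * Omega T) : R :=
  Num.max (`|Q t p.1 p.2 - Q s p.1 p.2 - v * (t - s) / 2| - v * (t - s) / 2) 0.

Lemma excess_ge0 p : 0 <= excess p.
Proof. by rewrite le_max lexx orbT. Qed.

Lemma dQ_bounds p : - excess p <= Q t p.1 p.2 - Q s p.1 p.2 <=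
  v * (t - s) + excess p.
Proof.
have : `|Q t p.1 p.2 - Q s p.1 p.2 - v * (t - s) / 2| - v * (t - s) / 2 <=
  excess p by rewrite le_max lexx.
rewrite lerBlDr ler_norml => /andP[h1 h2]; apply/andP; split; lra.
Qed.

Lemma Lc_excess : Lc E t excess.
Proof.
apply: (Lc_max gb tT); last exact: (Lc_cst gb).
apply: (Lc_sub gb tT); last exact: (Lc_cst gb).
apply: (Lc_abs gb tT); apply: (Lc_sub gb tT); last exact: (Lc_cst gb).
exact: Lc_dQ.
Qed.

(** The increment is the limit of sums of squares, which are nonnegative and
    exceed [v * (t - s)] by little according to the law of large numbers. *)
Lemma EL_excess : EL E excess = 0.
Proof.
have cE := Lc_le tT Lc_excess; have cd := Lc_le tT Lc_dQ.
apply/eqP; rewrite eq_le; apply/andP; split; last first.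
  by apply: (sexp_ge0 sEL cE) => p; rewrite le_max lexx orbT.
apply/ler_addgt0Pr => e e0; rewrite add0r; have e2 : 0 < e / 2 by rewrite divr_gt0.
have [n1 n1P] := Q_grid s0 st tT e2.
have [n2 n2P] := centred_sum_small s0 st tT e2.
pose n := (maxn n1 n2).+1.
have n1n : (n1 <= n)%N by rewrite leqW// leq_maxl.
have n2n : (n2 <= n)%N by rewrite leqW// leq_maxr.
have cS := Lc_csum (ltn0Sn (maxn n1 n2)).
have cp := Lc_max gb TT cS (Lc_cst gb T 0).
have cV : Lc E T (fun p => \sum_(0 <= i < n)
    (p.2 (grid s t n i.+1) - p.2 (grid s t n i)) ^+ 2).
  under eq_fun do rewrite sum_sqr_centred//.
  by apply: (Lc_add gb TT) => //; exact: (Lc_cst gb).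
have cD := Lc_abs gb TT (Lc_sub gb TT cd cV).
have := n1P n n1n isT; have := n2P n n2n isT; rewrite -EL_snd => h2 h1.
apply: (@le_trans _ _ (EL E (fun p => `|Q t p.1 p.2 - Q s p.1 p.2 -
      \sum_(0 <= i < n) (p.2 (grid s t n i.+1) - p.2 (grid s t n i)) ^+ 2| +
      Num.max (centred_sum s t n n p.2) 0))).
  apply: (sexp_monotone sEL) => //; first exact: (Lc_add gb TT).
  move=> p; rewrite /excess; set q := Q t _ _ - _.
  have V0 : 0 <= \sum_(0 <= i < n)
      (p.2 (grid s t n i.+1) - p.2 (grid s t n i)) ^+ 2.
    by apply: sumr_ge0 => i _; exact: sqr_ge0.
  have := sum_sqr_centred s t p.2 (ltn0Sn (maxn n1 n2)).
  rewrite -/n; move: V0; move: (\sum_(_ <= i < _) _) => V V0 VE.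
  have S0 : 0 <= Num.max (centred_sum s t n n p.2) 0 by rewrite le_max lexx orbT.
  have S1 : centred_sum s t n n p.2 <= Num.max (centred_sum s t n n p.2) 0.
    by rewrite le_max lexx.
  rewrite ge_max addr_ge0// andbT.
  have vts : 0 <= v * (t - s) / 2.
    by rewrite divr_ge0// mulr_ge0 ?(ltW (gb_v0 gb))// subr_ge0 ltW.
  have : `|q - v * (t - s) / 2| <= `|q - V| + `|V - v * (t - s) / 2|.
    exact: ler_distD.
  have : `|V - v * (t - s) / 2| <= v * (t - s) / 2 +
      Num.max (centred_sum s t n n p.2) 0.
    by rewrite ler_norml; apply/andP; split; lra.
  lra.
apply: le_trans (sexp_add sEL cD cp) _.
by rewrite [e]splitr lerD.
Qed.

(** The compensated increment is the limit of sums of centred squares, which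
    are neutral as [v] is the upper variance. *)
Lemma neutral_dQ M : 0 <= M ->
  neutral E s (fun p => M * (Q t p.1 p.2 - Q s p.1 p.2 - v * (t - s))).
Proof.
move=> M0; have cd := Lc_le tT Lc_dQ.
have cY := Lc_sub gb TT cd (Lc_cst gb T (v * (t - s))).
have /andP[_ sT] := sTT.
apply: (neutral_lim gb sT (Lc_scale gb M TT cY)) => e e0.
have M1 : 0 < M + 1 by rewrite ltr_wpDl.
have [n0 n0P] := Q_grid s0 st tT (divr_gt0 e0 M1).
pose n := n0.+1; have n_gt0 : (0 < n)%N by [].
exists (fun p => \sum_(0 <= i < n) M * centred s t n i p.2).
  split.
    apply: (Lc_sum gb TT) => i ni; apply: (Lc_scale gb _ TT); apply: (Lc_snd gb).
    apply: (@cyl_le _ _ (grid s t n i.+1)).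
      by rewrite (le_trans _ tT)// -[leRHS](@grid_last _ s t n)// grid_le.
    exact: cyl_centred.
  rewrite -[X in neutral _ X _](grid0 s t n).
  apply: (neutral_sum gb (s := grid s t n)) => [i ni|i ni|i ni].
  - by rewrite (le_trans _ tT)// -[leRHS](@grid_last _ s t n)// grid_le.
  - by rewrite ltW// grid_lt.
  split.
    apply: (Lc_scale gb).
      by rewrite (le_trans _ tT)// -[leRHS](@grid_last _ s t n)// grid_le.
    by apply: (Lc_snd gb); exact: cyl_centred.
  apply: (neutral_centred s0 st tT n_gt0 (a := fun=> M)) => //.
  exact: cyl_cst.
have := n0P n (leqnSn _) isT.
have cV : Lc E T (fun p => \sum_(0 <= i < n)
    (p.2 (grid s t n i.+1) - p.2 (grid s t n i)) ^+ 2).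
  under eq_fun do rewrite sum_sqr_centred//.
  by apply: (Lc_add gb TT); [exact: Lc_csum | exact: (Lc_cst gb)].
have cD := Lc_abs gb TT (Lc_sub gb TT cd cV).
rewrite ler_pdivlMr// mulrC => h; apply: le_trans h.
have M1' := ltW M1.
rewrite -(sexp_homogeneous sEL M1' cD); apply: (sexp_monotone sEL) => [||p].
- apply: (Lc_abs gb TT); apply: (Lc_sub gb TT).
    exact: (Lc_scale gb).
  under eq_fun do rewrite -mulr_sumr.
  by apply: (Lc_scale gb _ TT); exact: Lc_csum.
- exact: (Lc_scale gb).
rewrite -mulr_sumr -mulrBr normrM (ger0_norm M0) sum_sqr_centred//.
have -> : Q t p.1 p.2 - Q s p.1 p.2 - v * (t - s) -
    \sum_(0 <= i < n) centred s t n i p.2 =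
  Q t p.1 p.2 - Q s p.1 p.2 - (centred_sum s t n n p.2 + v * (t - s)).
  by rewrite /centred_sum; ring.
by rewrite ler_wpM2r// lerDl.
Qed.
End QIncrement.

Lemma EL_Q0 : EL E (fun p => `|Q 0 p.1 p.2|) = 0.
Proof.
have zT : 0 <= (0 : R) <= T by rewrite lexx ltW.
have cQ := Lc_abs gb TT (Lc_le (ltW T0) (Lc_Q zT)).
apply/eqP; rewrite eq_le (sexp_ge0 sEL cQ) ?andbT//.
apply/ler_addgt0Pr => e e0; rewrite add0r.
have [d d0 dP] := Q_partition zT e0.
have := dP [::] _ isT; rewrite /sqsum /=.
under eq_fun do rewrite add0r normrN.
by move=> h; apply/ltW/h; split=> //=.
Qed.
End QuadraticVariation.
Arguments excess {R T} v Q s t p.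

(** * Processes with stationary and independent increments *)

(** An additive function that is nonnegative is monotone, hence linear. *)
Lemma additive_linear {R : realType} (T : R) (m : R -> R) : 0 < T ->
  (forall s t, 0 <= s -> 0 <= t -> s + t <= T -> m (s + t) = m s + m t) ->
  (forall t, 0 <= t <= T -> 0 <= m t) ->
  exists2 lam, 0 <= lam & forall t, 0 <= t <= T -> m t = lam * t.
Proof.
move=> T0 madd mpos; exists (m T / T).
  by apply: divr_ge0; [apply: mpos; rewrite lexx ltW | exact: ltW].
set lam := m T / T.
have m0 : m 0 = 0.
  by have := madd 0 0 (lexx 0) (lexx 0); rewrite addr0 => /(_ (ltW T0)); lra.
have mmono s t : 0 <= s -> s <= t -> t <= T -> m s <= m t.
  move=> s0 st tT; have ts : 0 <= t - s by rewrite subr_ge0.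
  have -> : t = s + (t - s) by rewrite addrC subrK.
  rewrite madd//; last by rewrite addrC subrK.
  by rewrite lerDl mpos// ts/= (le_trans _ tT)// lerBlDr lerDl.
have mnat k x : 0 <= x -> k%:R * x <= T -> m (k%:R * x) = k%:R * m x.
  move=> x0; elim: k => [|k IH]; first by rewrite !mul0r.
  rewrite -natr1 !mulrDl !mul1r => kT; rewrite madd//; last by rewrite mulr_ge0.
  by rewrite IH// (le_trans _ kT)// lerDl.
move=> t /andP[t0]; rewrite le_eqVlt => /orP[/eqP ->|tT].
  by rewrite /lam mulfVK// gt_eqF.
apply: (@eq_of_invn _ _ _ (m T)) => n; set x := T / n.+1%:R.
have n0 : 0 < n.+1%:R :> R by rewrite ltr0n.
have nn : n.+1%:R != 0 :> R by rewrite gt_eqF.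
have x0 : 0 < x by rewrite divr_gt0.
have nx : n.+1%:R * x = T by rewrite mulrC mulfVK.
have TmT : m T = n.+1%:R * m x by rewrite -mnat ?nx// ltW.
have mx : m x = lam * x.
  rewrite /lam TmT; have -> : n.+1%:R * m x / T * x = m x * (n.+1%:R * x / T).
    by ring.
  by rewrite nx mulfV ?mulr1// gt_eqF.
set k := Num.truncn (t / x).
have /andP[kx tk] : k%:R <= t / x < k.+1%:R.
  by apply: truncn_itv; rewrite divr_ge0// ltW.
rewrite ler_pdivlMr// in kx; rewrite ltr_pdivrMr// in tk.
have kn : (k < n.+1)%N.
  by rewrite -(ltr_nat R) -(ltr_pM2r x0) nx (le_lt_trans kx).
have k1T : k.+1%:R * x <= T by rewrite -nx ler_pM2r// ler_nat.
have x0' := ltW x0; have kxT := ltW (le_lt_trans kx tT).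
have lo : k%:R * m x <= m t.
  by rewrite -(mnat k x x0' kxT); apply: mmono => //; [rewrite mulr_ge0 | exact: ltW].
have hi : m t <= k.+1%:R * m x.
  by rewrite -(mnat _ x x0' k1T); apply: mmono => //; exact: ltW.
have lam0 : 0 <= lam.
  by apply: divr_ge0; [apply: mpos; rewrite lexx ltW | exact: ltW].
have -> : n.+1%:R^-1 * m T = lam * x by rewrite TmT mx mulKf.
have lo' : lam * (k%:R * x) <= lam * t by rewrite ler_wpM2l.
have hi' : lam * t <= lam * (k.+1%:R * x) by rewrite ler_wpM2l// ltW.
rewrite -natr1 in hi hi'; rewrite mx in lo hi.
by rewrite ler_norml; apply/andP; split; lra.
Qed.

Section StationaryIndependent.
Context {R : realType} {T : R} {E : (Omega T -> R) -> R} {v K : R}.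
Context (T0 : 0 < T) (gb : G_brownian E v K).
Let sE : sublinear_expectation (cyl T) E := gb_sexp gb.
Let sEL := EL_sexp gb.
Let TT := lexx T.

Definition clip (N y : R) : R := Num.max (Num.min y N) (- N).

Lemma clip_lip N x y : `|clip N x - clip N y| <= `|x - y|.
Proof. exact: le_trans (max_lip _ _ _) (min_lip _ _ _). Qed.

Lemma clip_id N y : `|y| <= N -> clip N y = y.
Proof.
rewrite ler_norml => /andP[h1 h2]; rewrite /clip.
by have -> : Num.min y N = y; [exact/min_idPl | exact/max_idPl].
Qed.

Lemma clip_bound N y : 0 <= N -> `|clip N y| <= N.
Proof.
move=> N0; rewrite ler_norml /clip le_max lexx orbT ge_max ge_min lexx orbT.
by rewrite /= ge0_cp.
Qed.

Lemma clip_nearest N x y : 0 <= N -> `|y| <= N -> `|x - clip N x| <= `|x - y|.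
Proof.
move=> N0 yN; have := ler_norml y N; rewrite yN => /esym/andP[y1 y2].
have [xN|xN] := leP `|x| N; first by rewrite clip_id// subrr normr0.
rewrite /clip; have [x0|x0] := leP 0 x.
  rewrite ger0_norm// in xN.
  have -> : Num.min x N = N by apply/min_idPr; exact: ltW.
  have -> : Num.max N (- N) = N by apply/max_idPl; lra.
  by rewrite [leLHS]ger0_norm; have := ler_norm (x - y); lra.
rewrite ltr0_norm// in xN.
have -> : Num.min x N = x by apply/min_idPl; lra.
have -> : Num.max x (- N) = - N by apply/max_idPr; lra.
have := ler_norm (y - x); rewrite distrC => h.
by rewrite [leLHS]distrC [leLHS]ger0_norm; lra.
Qed.

Lemma Lc_clip N Y : Lc E T Y -> Lc E T (fun p => clip N (Y p)).
Proof.
move=> HY; apply: (Lc_max gb TT); last exact: (Lc_cst gb).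
under eq_fun do rewrite -[Num.min _ _]opprK oppr_min.
apply: (Lc_opp gb TT); apply: (Lc_max gb TT); last exact: (Lc_cst gb).
exact: (Lc_opp gb TT).
Qed.

(** Uniform integrability, by approximation with bounded random variables. *)
Lemma EL_clip Y e : 0 < e -> Lc E T Y ->
  exists2 N, 0 <= N & EL E (fun p => `|Y p - clip N (Y p)|) <= e.
Proof.
move=> e0 HY; have e2 : 0 < e / 2 by rewrite divr_gt0.
have [Z [S Ss [C [C0 ZC Zl]]] YZ] := Lc_bcyl_approx gb TT e2 HY.
have HZ : Lc E T (fun p => Z p.2).
  by apply: (Lc_snd gb); apply: bcyl_cyl; exists S => //; exists C.
have HD := Lc_abs gb TT (Lc_sub gb TT HY HZ).
exists C => //; apply: (@le_trans _ _ (EL E (fun p => 2 * `|Y p - Z p.2|))).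
  apply: (sexp_monotone sEL) => [||p].
  - by apply: (Lc_abs gb TT); apply: (Lc_sub gb TT) => //; exact: Lc_clip.
  - exact: (Lc_scale gb).
  have -> : Y p - clip C (Y p) =
      (Y p - Z p.2) + (clip C (Z p.2) - clip C (Y p)).
    by rewrite (clip_id (ZC p.2)); ring.
  apply: le_trans (ler_normD _ _) _; rewrite mulrDl !mul1r lerD//.
  by rewrite distrC clip_lip.
by rewrite (sexp_homogeneous sEL)//; lra.
Qed.

Context {A : R -> rvseq T} (A_stat : stationary_increments E A).
Context (A_indep : independent_increments E A).

Lemma Lc_A t : 0 <= t <= T -> Lc E t (fun p => A t p.1 p.2).
Proof. by move=> tT; apply: (L1G_Lc tT); exact: A_indep.1. Qed.

Definition dA (s t : R) (p : nat * Omega T) : R := A t p.1 p.2 - A s p.1 p.2.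

Lemma Lc_dA s t : 0 <= s -> s <= t -> t <= T -> Lc E t (dA s t).
Proof.
move=> s0 st tT; apply: (Lc_sub gb tT).
  by apply: Lc_A; rewrite (le_trans s0).
by apply: (Lc_le st); apply: Lc_A; rewrite s0 (le_trans st).
Qed.

Lemma dA_law s t r : 0 <= s -> s <= t -> 0 <= r -> t + r <= T ->
  EL E (dA (s + r) (t + r)) = EL E (dA s t).
Proof.
move=> s0 st r0 trT; apply: eq_of_eps => e e0.
have tT : t <= T by rewrite (le_trans _ trT)// lerDl.
have c1 : Lc E T (dA (s + r) (t + r)).
  apply: (Lc_le trT); apply: Lc_dA => //; first by rewrite addr_ge0.
  by rewrite lerD2r.
have c2 := Lc_le tT (Lc_dA s0 st tT).
have e2 : 0 < e / 2 by rewrite divr_gt0.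
have [N1 N10 h1] := EL_clip e2 c1; have [N2 N20 h2] := EL_clip e2 c2.
(* clipping at the larger level is at least as good *)
pose N := Num.max N1 N2.
have N0 : 0 <= N by rewrite le_max N10.
have better (M x : R) : 0 <= M -> M <= N -> `|x - clip N x| <= `|x - clip M x|.
  by move=> M0 MN; apply: (clip_nearest x N0); rewrite (le_trans (clip_bound _ _)).
have cN Y : Lc E T Y -> Lc E T (fun p => `|Y p - clip N (Y p)|).
  by move=> HY; apply: (Lc_abs gb TT); apply: (Lc_sub gb TT) => //; exact: Lc_clip.
have cM M Y : Lc E T Y -> Lc E T (fun p => `|Y p - clip M (Y p)|).
  by move=> HY; apply: (Lc_abs gb TT); apply: (Lc_sub gb TT) => //; exact: Lc_clip.
have {}h1 : EL E (fun p => `|dA (s + r) (t + r) p - clip N (dA (s + r) (t + r) p)|)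
    <= e / 2.
  apply: le_trans h1; apply: (sexp_monotone sEL) => [||p]; [exact: cN|exact: cM|].
  by apply: better => //; rewrite le_max lexx.
have {}h2 : EL E (fun p => `|dA s t p - clip N (dA s t p)|) <= e / 2.
  apply: le_trans h2; apply: (sexp_monotone sEL) => [||p]; [exact: cN|exact: cM|].
  by apply: better => //; rewrite le_max lexx orbT.
have clipb : C_bLip (clip N).
  apply: blip_C_bLip; exists (N + 1); split=> [|x|x y].
  - by rewrite addr_ge0.
  - by rewrite (le_trans (clip_bound x N0))// lerDl.
  by rewrite (le_trans (clip_lip N x y))// /ndist ler_peMl// lerDr.
have same : EL E (fun p => clip N (dA (s + r) (t + r) p)) =
    EL E (fun p => clip N (dA s t p)).
  exact: (A_stat s0 st r0 trT clipb).
have -> : EL E (dA (s + r) (t + r)) - EL E (dA s t) =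
  (EL E (dA (s + r) (t + r)) - EL E (fun p => clip N (dA (s + r) (t + r) p))) +
  (EL E (fun p => clip N (dA s t p)) - EL E (dA s t)) by rewrite same; ring.
rewrite (le_trans (ler_normD _ _))// [e]splitr lerD//.
  exact: le_trans (sexp_dist sEL c1 (Lc_clip N c1)) h1.
rewrite distrC; exact: le_trans (sexp_dist sEL c2 (Lc_clip N c2)) h2.
Qed.

(** Functionals of the past are functions of the increments over a partition
    of [0,s], for which the independence of the increments of [A] is given; as
    it is given for bounded functions, the increment is clipped. *)
Lemma dA_indep_clip (s t : R) X a (N : R) : 0 < s -> s < t -> t <= T -> 0 <= N ->
  bcyl s X -> bcyl s a -> (forall w, 0 <= a w) ->
  EL E (fun p => X p.2 + a p.2 * clip N (dA s t p)) =
  E (fun w => X w + a w * EL E (fun p => clip N (dA s t p))).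
Proof.
move=> s0 st tT N0 bX ba a0; have [S [Ss XS aS]] := bcyl_common bX ba.
have [p pp Sp] := partition_of s0 Ss; have sT := le_trans (ltW st) tT.
pose m := size p; pose V := 'rV[R]_m; pose W := 'rV[R]_1.
have [P [K' [K'0 _ P_inc PN PD]]] := path_of_increments pp sT Sp.
pose inc (w : Omega T) : V := \row_(l < m) (w (node p l.+1) - w (node p l)).
have agree Y (w : Omega T) : blip (pdist S) Y -> Y (P (inc w)) = Y w.
  move=> hY; have YS : plip (pnorm S) (pdist S) Y.
    by apply: blip_plip hY => *; exact: pdist_ge0.
  by apply: plip_agree YS _ => r; exact: P_inc.
pose phi (z : V * W) := X (P z.1) + a (P z.1) * clip N (z.2 0 0).
have past Y : blip (pdist S) Y -> blip (@ndist R (V * W)%type) (fun z => Y (P z.1)).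
  apply: (blip_comp (g := fun z : V * W => P z.1) _ K'0) => [z z'|z z'].
    exact: ndist0.
  rewrite (le_trans (PD _ _))// ler_wpM2l//; exact: (pair_norm_fst (z - z')).
have phib : C_bLip phi.
  apply: blip_C_bLip; apply: blip_add; first exact: past.
  apply: blip_mul; first exact: past.
  exists (N + 1); split=> [|z|z z'].
  - by rewrite addr_ge0.
  - by rewrite (le_trans (clip_bound _ N0))// lerDl.
  rewrite (le_trans (clip_lip N _ _))//.
  have := row_norm_ge (z.2 - z'.2) 0; rewrite !mxE => h.
  rewrite (le_trans h)// (le_trans (pair_norm_snd (z - z')))// ler_peMl// lerDr//.
pose ts (j : nat) := if j is 0%N then s else t.
have s_lt_T : 0 < s < T by rewrite s0 (lt_le_trans st).
have := A_indep.2 s m 1 (node p) ts s_lt_T (lexx 0) _ _ (lexx s) _ tT phi phib.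
move=> /(_ _ _ _)/=.
have -> : (fun (n : nat) (w : Omega T) => phi (\row_(i < m) (w (node p i.+1) - w (node p i)),
    \row_(j < 1) (A (ts j.+1) n w - A (ts j) n w))) =
    (fun n w => X w + a w * clip N (dA s t (n, w))).
  by apply/funext => n; apply/funext => w; rewrite /phi /= !agree// mxE.
have cd := Lc_clip N (Lc_le tT (Lc_dA (ltW s0) (ltW st) tT)).
have -> : (fun (n : nat) (w : Omega T) => Eext E (fun (k : nat) (w' : Omega T) =>
    phi (\row_(i < m) (w (node p i.+1) - w (node p i)),
    \row_(j < 1) (A (ts j.+1) k w' - A (ts j) k w')))) =
    (fun (n : nat) w => X w + a w * EL E (fun p => clip N (dA s t p))).
  apply/funext => n; apply/funext => w; rewrite addrC.
  rewrite -(sexp_homogeneous sEL (a0 w) cd).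
  rewrite -(sexp_addc sEL (X w) (Lc_scale gb (a w) TT cd)) /EL; congr Eext.
  apply/funext => k; apply/funext => w'.
  by rewrite /phi /= !agree// mxE addrC.
rewrite -(EL_snd (fun w => X w + a w * _)); apply.
- by move=> i im; exact: (node_le pp).
- by rewrite /m (node_last pp).
- by case=> // _; exact: ltW.
Qed.

Lemma neutral_dA s t a : 0 < s -> s < t -> t <= T -> bcyl s a ->
  (forall w, 0 <= a w) ->
  neutral E s (fun p => a p.2 * (dA s t p - EL E (dA s t))).
Proof.
move=> s0 st tT ba a0; set m := EL E (dA s t).
have sT := le_trans (ltW st) tT.
have cdA := Lc_le tT (Lc_dA (ltW s0) (ltW st) tT).
have baT := bcyl_le sT ba.
have caT := Lc_bmul gb TT baT.
have main X : bcyl s X -> EL E (fun p => X p.2 + a p.2 * dA s t p) =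
    E (fun w => X w + a w * m).
  move=> bX; have [S _ [C [C0 aC _]]] := ba.
  apply: eq_of_eps => e e0; have C1 : 0 < 2 * (C + 1) by rewrite mulr_gt0// ltr_wpDl.
  have eC : 0 < e / (2 * (C + 1)) by rewrite divr_gt0.
  have [N N0 h] := EL_clip eC cdA; have cclip := Lc_clip N cdA.
  have := dA_indep_clip s0 st tT N0 bX ba a0.
  set mN := EL E (fun p => clip N _) => indN.
  have cX := Lc_snd gb (cyl_le sT (bcyl_cyl bX)).
  have ca := cyl_le sT (bcyl_cyl ba).
  have cXm c : cyl T (fun w => X w + a w * c).
    apply: cyl_add; first exact: (cyl_le sT (bcyl_cyl bX)).
    by apply: cyl_mul => //; exact: cyl_cst.
  have -> : EL E (fun p => X p.2 + a p.2 * dA s t p) - E (fun w => X w + a w * m) =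
    (EL E (fun p => X p.2 + a p.2 * dA s t p) -
     EL E (fun p => X p.2 + a p.2 * clip N (dA s t p))) +
    (E (fun w => X w + a w * mN) - E (fun w => X w + a w * m)).
    by rewrite indN; ring.
  have C1' : 0 <= C + 1 by rewrite addr_ge0.
  have half : (C + 1) * (e / (2 * (C + 1))) = e / 2.
    by field; rewrite gt_eqF// ltr_wpDl.
  have cD := Lc_abs gb TT (Lc_sub gb TT cdA cclip).
  rewrite (le_trans (ler_normD _ _))// [e]splitr lerD// -half.
    apply: le_trans (sexp_dist sEL (Lc_add gb TT cX (caT _ cdA))
      (Lc_add gb TT cX (caT _ cclip))) _.
    apply: le_trans (ler_wpM2l C1' h); rewrite -(sexp_homogeneous sEL C1' cD).
    apply: (sexp_monotone sEL) => [||p].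
    - apply: (Lc_abs gb TT); apply: (Lc_sub gb TT); apply: (Lc_add gb TT) => //;
        exact: caT.
    - exact: (Lc_scale gb).
    have -> : X p.2 + a p.2 * dA s t p - (X p.2 + a p.2 * clip N (dA s t p)) =
      a p.2 * (dA s t p - clip N (dA s t p)) by ring.
    by rewrite normrM ler_wpM2r// (le_trans (aC _))// lerDl.
  apply: le_trans (sexp_dist sE (cXm mN) (cXm m)) _.
  apply: (sexp_le_cst sE) => [|w]; first exact/cyl_abs/cyl_sub.
  have -> : X w + a w * mN - (X w + a w * m) = a w * (mN - m) by ring.
  rewrite normrM ler_pM// ?(le_trans (aC _)) ?lerDl// distrC.
  by apply: le_trans (sexp_dist sEL cdA cclip) h.
apply: (neutral_dense gb sT).
  by apply: caT; apply: (Lc_sub gb TT) => //; exact: (Lc_cst gb).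
move=> X bX.
have := main (fun w => X w - a w * m).
have -> : (fun w => X w - a w * m + a w * m) = X by apply/funext => w; ring.
move=> <-; last by apply: bcyl_sub => //; apply: bcyl_mul => //; exact: bcyl_cst.
by congr EL; apply/funext => p; ring.
Qed.

Context (A_pos : forall t, 0 <= t <= T -> 0 <= EL E (dA 0 t)).

(** As compensated increments are neutral, the mean of [A] is additive in time;
    by stationarity it only depends on the length of the interval. *)
Lemma A_mean : exists2 lam, 0 <= lam &
  forall s t, 0 <= s -> s <= t -> t <= T -> EL E (dA s t) = lam * (t - s).
Proof.
have shift s t : 0 <= s -> s <= t -> t <= T ->
    EL E (dA s t) = EL E (dA 0 (t - s)).
  move=> s0 st tT; have := @dA_law 0 (t - s) s.
  by rewrite add0r subrK => ->//; rewrite subr_ge0.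
have madd s t : 0 <= s -> 0 <= t -> s + t <= T ->
    EL E (dA 0 (s + t)) = EL E (dA 0 s) + EL E (dA 0 t).
  have EL0 : EL E (dA 0 0) = 0.
    have -> : dA 0 0 = fun=> 0 by apply/funext => p; rewrite /dA subrr.
    exact: (sexp_cst sEL).
  rewrite le_eqVlt => /orP[/eqP <- _ _|s0]; first by rewrite EL0 !add0r.
  rewrite le_eqVlt => /orP[/eqP <- _|t0]; first by rewrite EL0 !addr0.
  move=> stT; have s_lt : s < s + t by rewrite ltrDl.
  have nA := neutral_dA s0 s_lt stT (bcyl_cst s 1) (fun=> ler01).
  have sT := le_trans (ltW s_lt) stT.
  have c0 := Lc_dA (lexx 0) (ltW s0) sT.
  have := nA _ c0.
  rewrite (shift _ _ (ltW s0) (ltW s_lt) stT).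
  have -> : s + t - s = t by ring.
  have -> : (fun p => dA 0 s p + 1 * (dA s (s + t) p - EL E (dA 0 t))) =
      (fun p => dA 0 (s + t) p + - EL E (dA 0 t)).
    by apply/funext => p; rewrite /dA; ring.
  rewrite (sexp_addc sEL); first by move=> <-; rewrite subrK.
  by apply: (Lc_le stT); apply: Lc_dA => //; rewrite ltW// (lt_trans s0).
have [lam lam0 lamP] := additive_linear T0 madd A_pos.
exists lam => // s t s0 st tT; rewrite shift// lamP// subr_ge0 st/=.
by rewrite (le_trans _ tT)// lerBlDr lerDl.
Qed.
End StationaryIndependent.
Arguments dA {R T} A s t p.

(** * Step functions *)

Section StepFunctions.
Context {R : realType}.
Implicit Types (a x y r : R) (s : seq R) (g q : R -> R).

Fixpoint is_step g a s : Prop :=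
  if s is x :: s' then (forall r, a < r <= x -> g r = g x) /\ is_step g x s'
  else True.

Definition stieltjes g q a s : R := lsum (fun x y => g y * (q y - q x)) a s.

Lemma stieltjes_cons g q a x s :
  stieltjes g q a (x :: s) = g x * (q x - q a) + stieltjes g q x s.
Proof. by []. Qed.

Lemma is_step_ext g g' a s : path <%R a s -> (forall r, a < r -> g r = g' r) ->
  is_step g' a s -> is_step g a s.
Proof.
elim: s a => //= x s IH a /andP[ax xs] gg' [h1 h2]; split.
  by move=> r /andP[ar rx]; rewrite !gg'// h1// ar.
by apply: IH => // r xr; apply: gg'; exact: lt_trans xr.
Qed.

Lemma path_lt_last a s : path <%R a s -> a <= last a s.
Proof.
elim: s a => //= x s IH a /andP[ax /IH]; apply: le_trans; exact: ltW.
Qed.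

Lemma path_lt_mem a s x : path <%R a s -> x \in s -> a < x.
Proof.
elim: s a => //= y s IH a /andP[ay ys]; rewrite in_cons => /orP[/eqP ->//|xs].
exact: lt_trans ay (IH _ ys xs).
Qed.

Lemma path_notin a s : path <%R a s -> a \notin s.
Proof. by move=> p; apply/negP => /(path_lt_mem p); rewrite ltxx. Qed.

Lemma step_refine g a s s' : path <%R a s -> path <%R a s' ->
  {subset s <= s'} -> last a s = last a s' -> is_step g a s ->
  is_step g a s' /\ forall q, stieltjes g q a s = stieltjes g q a s'.
Proof.
elim: s' a s => [|y s' IH] a s.
  by case: s => // x s _ _ /(_ x); rewrite mem_head => /(_ isT).
case: s => [_ /= /andP[ay ys'] _ e|x s /= /andP[ax xs] /andP[ay ys'] sub e [gx gs]].
  by have := lt_le_trans ay (path_lt_last ys'); rewrite -e ltxx.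
have [xy|xy] := eqVneq x y.
  subst y; have [] := IH x s => // [z zs|st qe].
    have := sub z; rewrite !in_cons zs orbT => /(_ isT)/orP[/eqP zx|//].
    by move: zs (path_notin xs); rewrite zx => ->.
  by split=> // q; rewrite !stieltjes_cons qe.
have xs' : x \in s'.
  by have := sub x; rewrite !in_cons eqxx (negbTE xy) => /(_ isT).
have yx := path_lt_mem ys' xs'.
have gy : g y = g x by rewrite gx// ay ltW.
have [] := IH y (x :: s) => //=.
- by rewrite yx.
- move=> z zs; have := sub z zs; rewrite in_cons => /orP[/eqP zy|//].
  move: zs; rewrite zy in_cons eq_sym (negbTE xy) /= => /(path_lt_mem xs).
  by rewrite ltNge ltW.
- split=> // r /andP[yr rx]; apply: gx; rewrite rx andbT; exact: lt_trans yr.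
move=> st qe; split.
  by split=> // r /andP[ar ry]; rewrite gy gx// ar/= (le_trans ry)// ltW.
by move=> q; rewrite !stieltjes_cons -qe stieltjes_cons gy; ring.
Qed.

Lemma indic_oc a b r : \1_(`]a, b]%classic) r = ((a < r <= b)%R)%:R :> R.
Proof. by rewrite indicE mem_setE in_itv. Qed.

Definition stepfun (c : nat -> R) a s r : R :=
  \sum_(0 <= j < size s)
    c j * \1_(`]nth 0 (a :: s) j, nth 0 (a :: s) j.+1]%classic) r.

Lemma stepfun_cons c a x s r :
  stepfun c a (x :: s) r =
  c 0%N * ((a < r <= x)%R)%:R + stepfun (fun j => c j.+1) x s r.
Proof. by rewrite /stepfun /= big_nat_recl//= indic_oc. Qed.

Lemma stepfun_le c a s r : path <%R a s -> r <= a -> stepfun c a s r = 0.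
Proof.
elim: s a c => [|x s IH] a c; first by rewrite /stepfun big_geq.
move=> /= /andP[ax xs] ra; rewrite stepfun_cons IH ?(le_trans ra (ltW ax))//.
by rewrite ltNge ra mulr0 addr0.
Qed.

Lemma stepfun_head c a x s r : path <%R a (x :: s) -> a < r <= x ->
  stepfun c a (x :: s) r = c 0%N.
Proof.
move=> /= /andP[ax xs] arx; have /andP[_ rx] := arx.
by rewrite stepfun_cons arx mulr1 stepfun_le// addr0.
Qed.

Lemma stepfun_tail c a x s r : path <%R a (x :: s) -> x < r ->
  stepfun c a (x :: s) r = stepfun (fun j => c j.+1) x s r.
Proof.
by move=> _ xr; rewrite stepfun_cons [r <= x]leNgt xr andbF mulr0 add0r.
Qed.

Lemma stepfun_step c a s : path <%R a s -> is_step (stepfun c a s) a s.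
Proof.
elim: s a c => // x s IH a c p; have /= /andP[ax xs] := p; split.
  by move=> r arx; rewrite !stepfun_head// ax lexx.
by apply: (is_step_ext xs) (IH x _ xs) => r; exact: stepfun_tail.
Qed.

Lemma stepfun_node c a s j : path <%R a s -> (j < size s)%N ->
  stepfun c a s (nth 0 (a :: s) j.+1) = c j.
Proof.
elim: s a c j => // x s IH a c [|j] p js; have /= /andP[ax xs] := p.
  by rewrite stepfun_head// ax lexx.
rewrite stepfun_tail//; first by rewrite (IH x (fun j => c j.+1)).
by apply: (path_lt_mem xs); apply: mem_nth.
Qed.

Lemma stepfun_of_step g a s (f : R -> R) r : path <%R a s -> is_step g a s ->
  a < r <= last a s -> stepfun (fun j => f (g (nth 0 (a :: s) j.+1))) a s r =
  f (g r).
Proof.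
elim: s a => [|x s IH] a p; first by rewrite ltNge => _ /andP[/negP].
have /= /andP[ax xs] := p; move=> [gx gs] /andP[ar rl].
have [rx|xr] := leP r x; first by rewrite stepfun_head ?ar//= gx// ar.
by rewrite stepfun_tail// IH// xr.
Qed.

Lemma stieltjes_stepfun c q a s : path <%R a s ->
  \sum_(0 <= j < size s)
    c j * (q (nth 0 (a :: s) j.+1) - q (nth 0 (a :: s) j)) =
  stieltjes (stepfun c a s) q a s.
Proof.
move=> p; rewrite /stieltjes -lsumE !big_nat; apply: eq_bigr => j /= js.
by rewrite -/(nth 0 (a :: s) j.+1) stepfun_node.
Qed.
End StepFunctions.

Section StepIntegral.
Context {R : realType}.
Local Notation mu := (@lebesgue_measure R).

Lemma Rintegral_step (T : R) (s : seq R) (b : nat -> R) : 0 <= T ->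
  itv_partition 0 T s -> (forall j, 0 <= b j) ->
  \int[mu]_(r in `[0, T]) stepfun b 0 s r =
  \sum_(0 <= j < size s) b j * (node s j.+1 - node s j).
Proof.
move=> T0 sP b0; rewrite /Rintegral.
have mI (x y : R) : measurable (`]x, y]%classic : set R) by [].
have muE (x y : R) : x < y -> mu (`]x, y]%classic) = (y - x)%:E.
  by move=> xy; rewrite lebesgue_measure_itv/= lte_fin xy.
have -> : (\int[mu]_(r in `[0%R, T]) (stepfun b 0 s r)%:E =
    \sum_(j <- index_iota 0 (size s))
     \int[mu]_(r in `[0%R, T])
       ((b j)%:E * (\1_(`]node s j, node s j.+1]%classic) r)%:E))%E.
  rewrite -ge0_integral_sum//.
  - by apply: eq_integral => r _; rewrite /stepfun sumEFin.
  - move=> j; apply: measurable_funeM; apply/measurable_EFinP.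
    exact: measurable_indic.
  - by move=> j r _; rewrite -EFinM lee_fin mulr_ge0.
rewrite (eq_big_seq (fun j => (b j * (node s j.+1 - node s j))%:E)); last first.
  move=> j; rewrite mem_index_iota => /= js.
  rewrite ge0_integralZl//; first 1 last.
  - apply/measurable_EFinP; exact: measurable_indic.
  - by rewrite lee_fin.
  rewrite integral_indic// setIidl.
    rewrite EFinM; congr (_ * _)%E; exact: (muE _ _ (node_lt sP (ltnSn j) js)).
  have /andP[n0 _] := node_bounds sP (ltnW js).
  have /andP[_ n1] := node_bounds sP js.
  move=> r /=; rewrite !in_itv/= => /andP[h1 h2].
  by rewrite (le_trans n0 (ltW h1)) (le_trans h2).
by rewrite sumEFin.
Qed.
End StepIntegral.

(** * Powers *)

Section Powers.
Context {R : realType}.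

(** By convexity, the slope of a chord in [0, M] is at most that of the chord
    from its right end to [M + 1]. *)
Lemma powR_lip (p M : R) : 1 <= p -> 0 <= M -> exists2 L, 0 <= L &
  forall x y : R, 0 <= y -> y <= x -> x <= M -> x `^ p - y `^ p <= L * (x - y).
Proof.
move=> p1 M0; pose z := M + 1.
have z0 : 0 <= z by rewrite addr_ge0.
exists (z `^ p) => [|x y y0 yx xM]; first exact: powR_ge0.
have zy : 1 <= z - y by rewrite /z; lra.
have zy0 : 0 < z - y by rewrite (lt_le_trans ltr01).
pose t := (z - x) / (z - y).
have t0 : 0 <= t by rewrite divr_ge0 ?(ltW zy0)// /z; lra.
have t1 : t <= 1 by rewrite ler_pdivrMr// mul1r lerD2l lerN2.
have tE : 1 - t = (x - y) / (z - y) by rewrite /t; field; rewrite gt_eqF.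
have xE : x = t * y + (1 - t) * z.
  by rewrite tE /t; field; rewrite gt_eqF.
have cvx : x `^ p <= t * y `^ p + (1 - t) * z `^ p.
  rewrite {1}xE; apply: (convex_powR p1 (Itv01 t0 t1));
    by rewrite inE/= in_itv/= andbT.
have tyy : t * y `^ p <= y `^ p by rewrite ler_piMl// powR_ge0.
have : (1 - t) * z `^ p <= (x - y) * z `^ p.
  rewrite ler_wpM2r ?powR_ge0// tE ler_pdivrMr// ler_peMr// subr_ge0//.
lra.
Qed.

Lemma powR_abs_lip (p M : R) : 1 <= p -> 0 <= M -> exists2 L, 0 <= L &
  forall x y : R, `|x| <= M -> `|y| <= M ->
    `| `|x| `^ p - `|y| `^ p| <= L * `|x - y|.
Proof.
move=> p1 M0; have [L L0 h] := powR_lip p1 M0; exists L => // x y xM yM.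
have p0 : 0 <= p by rewrite (le_trans ler01).
have mono (u v : R) : 0 <= u -> u <= v -> u `^ p <= v `^ p.
  by move=> u0 uv; apply: ge0_ler_powR; rewrite ?nnegrE ?(le_trans u0 uv).
wlog yx : x y xM yM / `|y| <= `|x|.
  have [yx|xy] := leP `|y| `|x|; first exact.
  by rewrite distrC [`|x - y|]distrC; apply => //; exact: ltW.
rewrite ger0_norm ?subr_ge0 ?mono// (le_trans (h _ _ _ yx xM))//.
by rewrite ler_wpM2l// (le_trans (ler_norm _))// ler_dist_dist.
Qed.

(** Where [|x|] exceeds [d], it is at most a multiple of [|x| ^ p]. *)
Lemma le_young (p d x : R) : 1 <= p -> 0 < d ->
  `|x| <= d + d * d^-1 `^ p * `|x| `^ p.
Proof.
move=> p1 d0; have dp : 0 <= d * d^-1 `^ p * `|x| `^ p.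
  by rewrite !mulr_ge0 ?powR_ge0// ltW.
have [xd|dx] := leP `|x| d; first by rewrite (le_trans xd)// lerDl.
have xd1 : 1 <= `|x| / d by rewrite ler_pdivlMr// mul1r ltW.
have := le1r_powR xd1 p1; rewrite mulrC powRM ?invr_ge0 ?(ltW d0)//.
rewrite ler_pdivrMl// mulrA => h; rewrite (le_trans h)// lerDr ltW//.
Qed.
End Powers.

(** * Simple processes on a refined partition *)

Section Windows.
Context {R : realType} {T : R} {s : seq R}.
Context (sP : itv_partition 0 T s).

Let spath : path <%R 0 s. Proof. by case: sP. Qed.

Lemma node_gap u l : u \in 0 :: s -> (l < size s)%N ->
  u <= node s l \/ node s l.+1 <= u.
Proof.
move=> /mem_node[i im ->] ls; have [il|li] := leqP i l; [left|right].
  exact: (node_le sP il (ltnW ls)).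
exact: (node_le sP li im).
Qed.

Definition win (u t r : R) : R := ((u < r <= t)%R)%:R.

Lemma win_ge0 u t r : 0 <= win u t r. Proof. exact: ler0n. Qed.

Lemma window q u t l : u \in 0 :: s -> t \in 0 :: s -> u <= t ->
  (l < size s)%N ->
  (q (Num.min (node s l.+1) t) - q (Num.min (node s l.+1) u)) -
  (q (Num.min (node s l) t) - q (Num.min (node s l) u)) =
  win u t (node s l.+1) * (q (node s l.+1) - q (node s l)) :> R.
Proof.
move=> us ts ut ls; have lt1 := node_lt sP (ltnSn l) ls; rewrite /win.
have [ul|lu] := node_gap us ls; last first.
  have lt2 := le_trans lu ut; have lt3 := ltW lt1.
  have -> : Num.min (node s l.+1) t = node s l.+1 by exact/min_idPl.
  have -> : Num.min (node s l.+1) u = node s l.+1 by exact/min_idPl.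
  have -> : Num.min (node s l) t = node s l.
    by apply/min_idPl; exact: le_trans lt2.
  have -> : Num.min (node s l) u = node s l.
    by apply/min_idPl; exact: le_trans lu.
  by rewrite ltNge lu mul0r; ring.
have -> : Num.min (node s l.+1) u = u.
  by apply/min_idPr; rewrite (le_trans ul)// ltW.
have -> : Num.min (node s l) u = u by exact/min_idPr.
rewrite (le_lt_trans ul lt1) /=.
have [tl|lt] := node_gap ts ls.
  have -> : Num.min (node s l.+1) t = t.
    by apply/min_idPr; rewrite (le_trans tl)// ltW.
  have -> : Num.min (node s l) t = t by exact/min_idPr.
  by rewrite leNgt (le_lt_trans tl lt1) mul0r; ring.
have -> : Num.min (node s l.+1) t = node s l.+1 by exact/min_idPl.
have -> : Num.min (node s l) t = node s l.
  by apply/min_idPl; rewrite (le_trans _ lt)// ltW.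
by rewrite lt mul1r; ring.
Qed.

Lemma window_cst q u t : u \in 0 :: s -> t \in 0 :: s -> u <= t ->
  q t - q u = \sum_(0 <= l < size s)
    win u t (node s l.+1) * (q (node s l.+1) - q (node s l)) :> R.
Proof.
move=> us ts ut.
have bnd r : r \in 0 :: s -> 0 <= r <= T.
  by move=> /mem_node[i im ->]; exact: node_bounds sP im.
have /andP[u0 uT] := bnd u us; have /andP[t0 tT] := bnd t ts.
pose f r := q (Num.min r t) - q (Num.min r u).
transitivity (f (node s (size s)) - f (node s 0)).
  rewrite (node_last sP) /f /node /=.
  have -> : Num.min T t = t by exact/min_idPr.
  have -> : Num.min T u = u by exact/min_idPr.
  have -> : Num.min 0 t = 0 by exact/min_idPl.
  have -> : Num.min 0 u = 0 by exact/min_idPl.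
  by rewrite subrr subr0.
rewrite -(telescope_sumr (fun l => f (node s l)))// !big_nat.
by apply: eq_bigr => l /= ls; exact: window.
Qed.

Lemma stepfun1_le1 r : stepfun (fun=> 1) 0 s r <= 1.
Proof.
have [r0|r0] := leP r 0; first by rewrite stepfun_le.
have [rT|rT] := leP r T.
  have st : is_step (fun=> 1) 0 s by elim: (s) (0) => //=.
  have last_s : last 0 s = T by case: sP => _ /eqP.
  rewrite (@stepfun_of_step _ (fun=> 1) 0 s (fun=> 1) r)//.
  by rewrite r0 last_s.
rewrite /stepfun big_nat big1// => j /= js; rewrite indic_oc.
have /andP[_ jT] := node_bounds sP js.
by rewrite -/(node s j.+1) [r <= _]leNgt (le_lt_trans jT rT) andbF mulr0.
Qed.
End Windows.

Section SimpleProcesses.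
Context {R : realType} {T : R} {E : (Omega T -> R) -> R} {v K : R}.
Context (T0 : 0 < T) (gb : G_brownian E v K).
Let sE : sublinear_expectation (cyl T) E := gb_sexp gb.
Let sEL := EL_sexp gb.
Let TT := lexx T.
Implicit Types (eta : simple_process T) (s : seq R).

Let sp_path eta : path <%R 0 (sp_times eta).
Proof. by case: (sp_partition eta). Qed.

Lemma sp_valE eta r w :
  sp_val eta r w = stepfun (fun j => sp_coef eta j w) 0 (sp_times eta) r.
Proof. by []. Qed.

Section Refine.
Context {s : seq R} {eta : simple_process T}.
Context (sP : itv_partition 0 T s) (sub : {subset sp_times eta <= s}).

Let spath : path <%R 0 s. Proof. by case: sP. Qed.
Let slast : last 0 (sp_times eta) = last 0 s.
Proof. by case: (sp_partition eta) => _ /eqP ->; case: sP => _ /eqP ->. Qed.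

Lemma sp_step w : is_step (fun r => sp_val eta r w) 0 s.
Proof.
have st := stepfun_step (fun j => sp_coef eta j w) (sp_path eta).
by have [] := step_refine (sp_path eta) spath sub slast st.
Qed.

(** Being left-continuous, a simple process is known at the beginning of each
    interval of a finer partition. *)
Lemma sp_val_bcyl j : (j < size s)%N ->
  bcyl (node s j) (fun w => sp_val eta (node s j.+1) w).
Proof.
move=> js; rewrite /sp_val; apply: bcyl_sum => i isz.
have [ij|ij] := ltP (node (sp_times eta) i) (node s j.+1); last first.
  have -> : (fun w => sp_coef eta i w *
    \1_(`]node (sp_times eta) i, node (sp_times eta) i.+1]%classic) (node s j.+1))
      = fun=> 0.
    by apply/funext => w; rewrite indic_oc ltNge ij mulr0.
  exact: bcyl_cst.
under eq_fun do rewrite mulrC.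
apply: bcyl_scale; apply: (@bcyl_le _ _ (node (sp_times eta) i)); last first.
  by apply: Lip_bcyl; exact: sp_adapted.
have i_s : node (sp_times eta) i \in 0 :: s.
  have := @node_mem _ (sp_times eta) i (ltnW isz).
  by rewrite !in_cons => /orP[->//|/sub ->]; rewrite orbT.
have [//|h] := node_gap sP i_s js.
by have := lt_le_trans ij h; rewrite ltxx.
Qed.

Lemma sp_integralE (Q : R -> rvseq T) t n w :
  sp_integral Q eta t n w = \sum_(0 <= l < size s) sp_val eta (node s l.+1) w *
    (Q (Num.min (node s l.+1) t) n w - Q (Num.min (node s l) t) n w).
Proof.
pose q r := Q (Num.min r t) n w.
have st := stepfun_step (fun j => sp_coef eta j w) (sp_path eta).
have [_ /(_ q) h] := step_refine (sp_path eta) spath sub slast st.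
transitivity (stieltjes (fun r => sp_val eta r w) q 0 s).
  rewrite -[RHS]h -stieltjes_stepfun//.
by rewrite /stieltjes -lsum_node.
Qed.

Lemma sp_integral_window (Q : R -> rvseq T) u t n w :
  u \in 0 :: s -> t \in 0 :: s -> u <= t ->
  sp_integral Q eta t n w - sp_integral Q eta u n w =
  \sum_(0 <= l < size s) sp_val eta (node s l.+1) w *
    (win u t (node s l.+1) * (Q (node s l.+1) n w - Q (node s l) n w)).
Proof.
move=> us ts ut; rewrite !sp_integralE -sumrB !big_nat.
apply: eq_bigr => l /= ls; rewrite -mulrBr; congr (_ * _).
by rewrite -(window sP (fun r => Q r n w) us ts ut ls); ring.
Qed.
End Refine.

Lemma sp_integral_L1 (Q : R -> rvseq T) eta t : quadratic_variation E Q ->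
  0 <= t <= T -> Lc E T (fun p => sp_integral Q eta t p.1 p.2).
Proof.
move=> Qqv tT; apply: (Lc_sum gb TT) => j js.
have bnd i : (i <= size (sp_times eta))%N ->
    0 <= Num.min (node (sp_times eta) i) t <= T.
  move=> im; have /andP[h1 h2] := node_bounds (sp_partition eta) im.
  have /andP[t0 tT'] := tT.
  by rewrite le_min h1 t0 ge_min h2.
apply: (Lc_bmul gb TT).
  apply: (@bcyl_le _ _ (node (sp_times eta) j)).
    by have /andP[] := node_bounds (sp_partition eta) (ltnW js).
  by apply: Lip_bcyl; exact: sp_adapted.
apply: (Lc_sub gb TT).
  by have b := bnd _ js; apply: (Lc_le (proj2 (andP b))); exact: Lc_Q.
by have b := bnd _ (ltnW js); apply: (Lc_le (proj2 (andP b))); exact: Lc_Q.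
Qed.

(** ** The integral of a step process over [0,T] *)

Definition tint (s : seq R) (g : R -> Omega T -> R) (w : Omega T) : R :=
  \sum_(0 <= j < size s) g (node s j.+1) w * (node s j.+1 - node s j).

Lemma tint_refine s s' (g : R -> Omega T -> R) w : itv_partition 0 T s ->
  itv_partition 0 T s' -> {subset s <= s'} -> is_step (fun r => g r w) 0 s ->
  tint s g w = tint s' g w.
Proof.
move=> [sp /eqP sl] [sp' /eqP sl'] ss st.
have [_ /(_ id)] : is_step (fun r => g r w) 0 s' /\ forall q,
    stieltjes (fun r => g r w) q 0 s = stieltjes (fun r => g r w) q 0 s'.
  by apply: step_refine => //; rewrite sl sl'.
by rewrite /stieltjes -!lsum_node.
Qed.

Lemma is_step_map (f : R -> R -> R) (g g' : R -> R) a s :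
  is_step g a s -> is_step g' a s -> is_step (fun r => f (g r) (g' r)) a s.
Proof.
elim: s a => //= x s IH a [h1 h2] [h3 h4]; split; last exact: IH.
by move=> r ar; rewrite h1// h3.
Qed.

Lemma Rintegral_step_process (p : R) s (g : R -> Omega T -> R) (w : Omega T) :
  0 < p -> itv_partition 0 T s -> is_step (fun r => g r w) 0 s -> g 0 w = 0 ->
  \int[@lebesgue_measure R]_(r in `[0, T]) (`|g r w| `^ p) =
  tint s (fun r w => `|g r w| `^ p) w.
Proof.
move=> p0 sP st g0; have [sp /eqP sl] := sP.
rewrite /tint -(Rintegral_step (ltW T0) sP); last first.
  by move=> j; exact: powR_ge0.
apply: eq_Rintegral => r; rewrite inE /= in_itv /= => /andP[r0 rT].
move: r0; rewrite le_eqVlt => /orP[/eqP <-|r0].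
  by rewrite stepfun_le// g0 normr0 powR0// gt_eqF.
by rewrite (@stepfun_of_step _ _ 0 s (fun x => `|x| `^ p) r sp st)// r0 sl.
Qed.

Lemma bcyl_powR t (p : R) (X : Omega T -> R) : 1 <= p -> bcyl t X ->
  bcyl t (fun w => `|X w| `^ p).
Proof.
move=> p1 [S Ss [C [C0 XC Xl]]]; exists S => //.
have [L L0 Lp] := powR_abs_lip p1 C0.
exists (C `^ p + L * C); split=> [|w|w w'].
- by rewrite addr_ge0 ?powR_ge0// mulr_ge0.
- rewrite ger0_norm ?powR_ge0// (le_trans _ (_ : C `^ p <= _))//.
    by apply: ge0_ler_powR; rewrite ?nnegrE// (le_trans ler01).
  by rewrite lerDl mulr_ge0.
- rewrite (le_trans (Lp _ _ (XC w) (XC w')))// mulrDl.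
  apply: (@le_trans _ _ (L * C * pdist S w w')); first by rewrite -mulrA ler_wpM2l.
  by rewrite lerDr mulr_ge0 ?powR_ge0// pdist_ge0.
Qed.

Lemma bcyl_tint s t (g : R -> Omega T -> R) :
  (forall j, (j < size s)%N -> bcyl t (g (node s j.+1))) -> bcyl t (tint s g).
Proof.
move=> gb'; apply: bcyl_sum => j js.
by under eq_fun do rewrite mulrC; apply: bcyl_scale; exact: gb'.
Qed.

(** The norm of M^p controls the norm of M^1, since [|x|] is at most a small
    constant plus a multiple of [|x| ^ p]. *)
Lemma L1_of_Mnorm (p e : R) : 1 <= p -> 0 < e -> exists2 k : R, 0 < k &
  forall s (g : R -> Omega T -> R), itv_partition 0 T s ->
    (forall w, is_step (fun r => g r w) 0 s) -> (forall w, g 0 w = 0) ->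
    (forall j, (j < size s)%N -> bcyl T (g (node s j.+1))) ->
    Mnorm E p g < k -> E (tint s (fun r w => `|g r w|)) <= e.
Proof.
move=> p1 e0; have p0 : 0 < p by rewrite (lt_le_trans ltr01).
pose d := e / (2 * T); have d0 : 0 < d by rewrite divr_gt0// mulr_gt0.
pose c := d * d^-1 `^ p.
have c0 : 0 < c by apply: mulr_gt0 => //; apply: powR_gt0; rewrite invr_gt0.
pose kk := e / (2 * c); have kk0 : 0 < kk by rewrite divr_gt0// mulr_gt0.
exists (kk `^ p^-1); first exact: powR_gt0.
move=> s g sP st g0 gbT Mk.
have cg j : (j < size s)%N -> bcyl T (fun w => `|g (node s j.+1) w| `^ p).
  by move=> /gbT; exact: bcyl_powR.
have bp := bcyl_cyl (bcyl_tint (g := fun r w => `|g r w| `^ p) cg).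
have b1 : cyl T (tint s (fun r w => `|g r w|)).
  by apply: bcyl_cyl; apply: bcyl_tint => j /gbT; exact: bcyl_abs.
have node_ge j : (j < size s)%N -> 0 <= node s j.+1 - node s j.
  by move=> js; rewrite subr_ge0 (node_le sP).
have Ep : E (tint s (fun r w => `|g r w| `^ p)) <= kk.
  rewrite leNgt; apply/negP => kE; move: Mk; rewrite /Mnorm.
  have -> : (fun w => \int[@lebesgue_measure R]_(r in `[0, T]) (`|g r w| `^ p)) =
      tint s (fun r w => `|g r w| `^ p).
    by apply/funext => w; exact: Rintegral_step_process.
  rewrite ltNge => /negP; apply; apply: ge0_ler_powR; rewrite ?nnegrE ?invr_ge0.
  - exact: ltW.
  - exact: ltW.
  - exact: le_trans (ltW kk0) (ltW kE).
  - exact: ltW.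
apply: (@le_trans _ _ (c * E (tint s (fun r w => `|g r w| `^ p)) + d * T)).
  have cb := rv_scale sE c bp.
  rewrite -(sexp_homogeneous sE (ltW c0) bp) -(sexp_addc sE _ cb).
  apply: (sexp_monotone sE) => [//||w].
    exact: (rv_add sE cb (rv_cst sE _)).
  have -> : d * T = \sum_(0 <= j < size s) d * (node s j.+1 - node s j).
    rewrite -mulr_sumr telescope_sumr//; congr (_ * _).
    by rewrite (node_last sP) /node /= subr0.
  rewrite /tint mulr_sumr -big_split /= !big_nat; apply: ler_sum => j /= js.
  rewrite mulrA -mulrDl ler_wpM2r ?node_ge// addrC.
  exact: le_young.
have -> : e = c * kk + d * T.
  have ->: c * kk = e / 2 by rewrite /kk; field; rewrite gt_eqF.
  have -> : d * T = e / 2 by rewrite /d; field; rewrite gt_eqF.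
  by rewrite -splitr.
by rewrite lerD2r ler_wpM2l// ltW.
Qed.
End SimpleProcesses.

(** * Insertion of short intervals *)

Section Insertion.
Context {R : realType} {T : R} {E : (Omega T -> R) -> R} {v K : R}.
Context (T0 : 0 < T) (gb : G_brownian E v K).
Let sE : sublinear_expectation (cyl T) E := gb_sexp gb.
Let sEL := EL_sexp gb.
Let TT := lexx T.

Definition lip_first (k : nat) (L : R) (F : (nat -> R) -> R) : Prop :=
  0 <= L /\ forall x y, `|F x - F y| <= L * \sum_(0 <= i < k) `|x i - y i|.

Lemma lip_first_eq k L F x y : lip_first k L F ->
  (forall i, (i < k)%N -> x i = y i) -> F x = F y.
Proof.
move=> [L0 FL] xy; apply/eqP; rewrite -subr_eq0 -normr_le0.
rewrite (le_trans (FL x y))// big_nat big1 ?mulr0// => i /= ik.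
by rewrite xy// subrr normr0.
Qed.

Section EvenStep.
Context {a b : nat -> R}.
Let e (i : nat) (w : Omega T) : R := w (b i) - w (a i).

Let times k : seq R :=
  [seq a i | i <- index_iota 0 k] ++ [seq b i | i <- index_iota 0 k].

Let times_in k r : (forall i, (i < k)%N -> 0 <= a i <= r /\ 0 <= b i <= r) ->
  forall x, x \in times k -> 0 <= x <= r.
Proof.
move=> abr x; rewrite mem_cat => /orP[] /mapP[i]; rewrite mem_index_iota /=.
  by move=> /abr[? _] ->.
by move=> /abr[_ ?] ->.
Qed.

Let times_dist k w w' :
  \sum_(0 <= i < k) `|e i w - e i w'| <= pdist (times k) w w'.
Proof.
rewrite /pdist big_cat /= !big_map -big_split; apply: ler_sum => i _ /=.
have -> : e i w - e i w' = (w (b i) - w' (b i)) - (w (a i) - w' (a i)).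
  by rewrite /e; ring.
by rewrite (le_trans (ler_normB _ _))// addrC.
Qed.

Lemma lip_first_cyl k L F r : lip_first k L F ->
  (forall i, (i < k)%N -> 0 <= a i <= r /\ 0 <= b i <= r) ->
  cyl r (fun w => F (e^~ w)).
Proof.
move=> [L0 FL] abr; exists (times k); first exact: times_in.
exists L, 0%N; split=> // w w'; rewrite expr0 mulr1.
by rewrite (le_trans (FL _ _))// ler_wpM2l.
Qed.

(** The conditional expectation of [F] given its first [k] arguments, when the
    next one is the increment over [s,t]. *)
Definition avg (s t : R) k (F : (nat -> R) -> R) (x : nat -> R) : R :=
  E (fun w : Omega T => F (fun i => if (i < k)%N then x i else w t - w s)).

Lemma cyl_avg s t k L F x : 0 <= s -> s < t -> t <= T -> lip_first k.+1 L F ->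
  cyl T (fun w : Omega T => F (fun i => if (i < k)%N then x i else w t - w s)).
Proof.
move=> s0 st tT [L0 FL]; exists [:: s; t].
  move=> r; rewrite !inE => /orP[] /eqP ->.
    by rewrite s0 (le_trans (ltW st)).
  by rewrite tT (le_trans s0 (ltW st)).
exists L, 0%N; split=> // w w'; rewrite expr0 mulr1.
apply: (le_trans (FL _ _)); rewrite ler_wpM2l// big_nat_recr//= ltnn.
rewrite big_nat big1 ?add0r; last by move=> i /= ->; rewrite subrr normr0.
rewrite /pdist big_cons big_seq1.
have -> : w t - w s - (w' t - w' s) = (w t - w' t) - (w s - w' s) by ring.
by rewrite (le_trans (ler_normB _ _))// addrC.
Qed.

Lemma lip_avg s t k L F : 0 <= s -> s < t -> t <= T -> lip_first k.+1 L F ->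
  lip_first k L (avg s t k F).
Proof.
move=> s0 st tT FL; have [L0 Fl] := FL; split=> // x y.
have cF z := cyl_avg z s0 st tT FL.
apply: le_trans (sexp_dist sE (cF x) (cF y)) _.
apply: (sexp_le_cst sE) => [|w]; first exact/cyl_abs/cyl_sub.
apply: (le_trans (Fl _ _)); rewrite ler_wpM2l// big_nat_recr//= ltnn subrr.
by rewrite normr0 addr0 !big_nat; apply: ler_sum => i /= ->.
Qed.

Lemma EL_avg s t k L F X : 0 <= s -> s < t -> t <= T -> lip_first k.+1 L F ->
  (forall i, (i < k)%N -> 0 <= a i <= s /\ 0 <= b i <= s) ->
  a k = s -> b k = t -> Lc E s X ->
  EL E (fun p => X p + F (e^~ p.2)) = EL E (fun p => X p + avg s t k F (e^~ p.2)).
Proof.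
move=> s0 st tT FL abs ak bk [X1 _]; rewrite /EL /Eext.
suff -> : (fun n => E (fun w => X (n, w) + F (e^~ w))) =
  (fun n => E (fun w => X (n, w) + avg s t k F (e^~ w))) by [].
apply/funext => n; have [L0 Fl] := FL.
have [S Ss XS] := X1 n.
pose G (z : Omega T * R) := F (fun i => if (i < k)%N then e i z.1 else z.2).
pose S2 := S ++ times k.
have S2s r : r \in S2 -> 0 <= r <= s.
  by rewrite mem_cat => /orP[/Ss|/(times_in abs)].
have Gp : plip (cylN S2) (cylD S2) (fun z => X (n, z.1) + G z).
  apply: (plip_add (@cylN_ge0 _ _ S2) (@cylD_ge0 _ _ S2)).
    apply: (@plip_past _ _ S2 (fun w => X (n, w))).
    by apply: plip_sub XS => r; rewrite mem_cat => ->.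
  exists L, 0%N; split=> // z z'; rewrite expr0 mulr1.
  rewrite (le_trans (Fl _ _))// ler_wpM2l// big_nat_recr//= ltnn.
  rewrite /cylD /pairD /ndist lerD2r /pdist big_cat /=.
  apply: (@le_trans _ _ (pdist (times k) z.1 z'.1)).
    apply: le_trans (times_dist _ _ _); rewrite !big_nat.
    by apply: ler_sum => i /= ->.
  by rewrite /pdist lerDr sumr_ge0.
have [_ eqE] := gb_indep gb s0 st tT S2s Gp.
transitivity (E (fun w => X (n, w) + G (w, w t - w s))).
  congr E; apply/funext => w; congr (_ + _); rewrite /G /=.
  apply: (lip_first_eq FL) => i.
  rewrite ltnS leq_eqVlt => /orP[/eqP ->|->//].
  by rewrite ltnn /e ak bk.
rewrite eqE; congr E; apply/funext => w /=; rewrite /G /=.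
under eq_fun do rewrite addrC.
by rewrite (sexp_addc sE _ (cyl_avg (e^~ w) s0 st tT FL)) addrC.
Qed.
End EvenStep.

(** The beginning of the last part of the [j]-th interval, of relative length
    [th]. *)
Definition cut (th : R) (s : seq R) j : R :=
  node s j.+1 - th * (node s j.+1 - node s j).

Section Cut.
Context {th : R} {s : seq R} (th0 : 0 < th) (th1 : th < 1).
Context (sP : itv_partition 0 T s).

Lemma cut_bounds j : (j < size s)%N ->
  [/\ 0 <= node s j, node s j < cut th s j, cut th s j < node s j.+1 &
      node s j.+1 <= T].
Proof.
move=> js; have d := node_lt sP (ltnSn j) js.
have /andP[n0 _] := node_bounds sP (ltnW js).
have /andP[_ n1] := node_bounds sP js.
split=> //; rewrite /cut.
  have : th * (node s j.+1 - node s j) < 1 * (node s j.+1 - node s j).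
    by rewrite ltr_pM2r// subr_gt0.
  lra.
by rewrite gtrBl mulr_gt0// subr_gt0.
Qed.

Let e (i : nat) (w : Omega T) : R := w (cut th s i) - w (node s i).
Let o (i : nat) (w : Omega T) : R := w (node s i.+1) - w (cut th s i).

(** Backward in time: the last neutral variable drops out, since [F] only
    involves increments over first parts, which are known by then; averaging
    over the last first part then leaves a function of one argument less. *)
Lemma EL_even_neutral (Y : nat -> nat * Omega T -> R) k F L :
  (forall j, (j < size s)%N ->
     Lc E (node s j.+1) (Y j) /\ neutral E (cut th s j) (Y j)) ->
  (k <= size s)%N -> lip_first k L F ->
  E (fun w => F (e^~ w)) =
  EL E (fun p => F (e^~ p.2) + \sum_(0 <= j < k) Y j p).
Proof.
move=> HY; elim: k F => [|k IH] F ks FL.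
  rewrite -[LHS]EL_snd; congr EL; apply/funext => p.
  by rewrite big_geq// addr0.
have [n0 nc cn nT] := cut_bounds ks.
have nTT i : (i <= size s)%N -> node s i <= T.
  by move=> /(node_bounds sP)/andP[].
have cT := le_trans (ltW cn) nT; have nkT := nTT k (ltnW ks).
have before i r : (i < k)%N -> node s k <= r ->
    0 <= node s i <= r /\ 0 <= cut th s i <= r.
  move=> ik kr; have [h1 h2 h3 _] := cut_bounds (ltn_trans ik ks).
  have h4 : node s i.+1 <= r by rewrite (le_trans _ kr)// (node_le sP ik (ltnW ks)).
  have h5 := ltW (lt_le_trans h3 h4).
  by rewrite h1 h5 (le_trans h1 (ltW h2)) (le_trans (ltW h2) h5).
have beforek i : (i < k)%N -> 0 <= node s i <= node s k /\
    0 <= cut th s i <= node s k by move=> /before; apply.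
have LF := lip_avg n0 nc cT FL.
have avgE X : Lc E (node s k) X -> EL E (fun p => X p + F (e^~ p.2)) =
    EL E (fun p => X p + avg (node s k) (cut th s k) k F (e^~ p.2)).
  exact: (EL_avg (a := node s) (b := cut th s) n0 nc cT FL beforek).
have cS : Lc E (node s k) (fun p => \sum_(0 <= j < k) Y j p).
  apply: (Lc_sum gb nkT) => i ik; have [h _] := HY i (ltn_trans ik ks).
  by apply: Lc_le h; apply: (node_le sP ik (ltnW ks)).
pose A w := avg (node s k) (cut th s k) k F (e^~ w).
have avg0 : E (fun w => F (e^~ w)) = E A.
  have := avgE (fun=> 0) (Lc_cst gb _ 0).
  have zero_add G : EL E (fun p => 0 + G p.2) = E G.
    by under eq_fun do rewrite add0r; exact: EL_snd.
  by rewrite (zero_add (fun w => F (e^~ w))) (zero_add A).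
rewrite avg0 (IH _ (ltnW ks) LF).
transitivity (EL E (fun p => \sum_(0 <= j < k) Y j p + A p.2)).
  by congr EL; apply/funext => p; rewrite addrC.
rewrite -(avgE _ cS).
rewrite -((HY k ks).2 (fun p => \sum_(0 <= j < k) Y j p + F (e^~ p.2))).
  congr EL; apply/funext => p; rewrite big_nat_recr//=; ring.
apply: (Lc_add gb cT); first exact: (Lc_le (ltW nc)).
apply: (Lc_snd gb (X := fun w => F (e^~ w))).
apply: (lip_first_cyl (a := node s) (b := cut th s) FL) => i.
rewrite ltnS leq_eqVlt => /orP[/eqP ->|ik]; last by apply: before => //; exact: ltW.
by rewrite n0 lexx (ltW nc) (le_trans n0 (ltW nc)).
Qed.

(** The increments over the last parts are orthogonal, each of upper variance
    [v] times its length. *)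
Lemma E_odd_sqr k : (k <= size s)%N ->
  cyl (node s k) (fun w => \sum_(0 <= l < k) o l w) /\
  E (fun w => (\sum_(0 <= l < k) o l w) ^+ 2) <= v * (th * node s k).
Proof.
elim: k => [_|k IH ks].
  split.
    by under eq_fun do rewrite big_geq//; exact: cyl_cst.
  under eq_fun do rewrite big_geq// expr0n /=.
  by rewrite (sexp_cst sE) /node /= !mulr0.
have [cO EO] := IH (ltnW ks); have [n0 nc cn nT] := cut_bounds ks.
have c0 := le_trans n0 (ltW nc).
have co : cyl (node s k.+1) (o k).
  by apply: cyl_sub; apply: cyl_eval; rewrite ?lexx ?(ltW cn) ?(le_trans c0 (ltW cn)) ?c0.
have cO' : cyl (node s k.+1) (fun w => \sum_(0 <= l < k) o l w).
  by apply: cyl_le cO; rewrite (le_trans (ltW nc))// ltW.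
have cO'' := cyl_le (ltW nc) cO.
have split_sum w : \sum_(0 <= l < k.+1) o l w = \sum_(0 <= l < k) o l w + o k w.
  by rewrite big_nat_recr.
split; first by under eq_fun do rewrite split_sum; exact: cyl_add.
pose O w := \sum_(0 <= l < k) o l w.
have toT (X : Omega T -> R) : cyl (node s k.+1) X -> cyl T X by exact: cyl_le.
have cross : cyl T (fun w => O w ^+ 2 + 2 * O w * o k w).
  by apply/toT/cyl_add; [exact: cyl_sqr | apply: cyl_mul => //; exact: cyl_scale].
have -> : (fun w => (\sum_(0 <= l < k.+1) o l w) ^+ 2) =
    (fun w => (O w ^+ 2 + 2 * O w * o k w) + o k w ^+ 2).
  by apply/funext => w; rewrite split_sum -/(O w); ring.
apply: le_trans (sexp_add sE cross (toT _ (cyl_sqr co))) _.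
have -> : E (fun w => O w ^+ 2 + 2 * O w * o k w) = E (fun w => O w ^+ 2).
  have := neutral_mean gb c0 cn nT (cyl_scale 2 cO'') (Lc_snd gb (cyl_sqr cO'')).
  by rewrite (EL_snd (fun w => O w ^+ 2)) => <-; rewrite -[LHS]EL_snd.
have -> : E (fun w => o k w ^+ 2) = v * (node s k.+1 - cut th s k).
  have := gb_var gb c0 cn nT (ler01).
  have -> : (fun w : Omega T => 1 * ((w (node s k.+1) - w (cut th s k)) ^+ 2 -
      v * (node s k.+1 - cut th s k))) =
      (fun w => o k w ^+ 2 + - (v * (node s k.+1 - cut th s k))).
    by apply/funext => w; rewrite mul1r.
  rewrite (sexp_addc sE) => [h|]; last by apply/toT/cyl_sqr.
  by apply/eqP; rewrite -subr_eq0 h.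
have -> : v * (th * node s k.+1) = v * (th * node s k) +
    v * (node s k.+1 - cut th s k) by rewrite /cut; ring.
by rewrite lerD2r.
Qed.
End Cut.

(** A functional of finitely many values of the path hardly changes when the
    increments over short last parts of the intervals of a partition are
    removed; random variables that are neutral at the beginning of these last
    parts can then be added without changing the expectation. *)
Lemma insertion (Phi : Omega T -> R) (kap : R) : bcyl T Phi -> 0 < kap ->
  exists th : R, 0 < th < 1 /\ exists2 S : seq R,
    (forall r, r \in S -> 0 <= r <= T) &
    forall s, itv_partition 0 T s -> {subset S <= 0 :: s} ->
    forall Y : nat -> nat * Omega T -> R,
    (forall j, (j < size s)%N ->
      Lc E (node s j.+1) (Y j) /\ neutral E (cut th s j) (Y j)) ->
    E Phi <= EL E (fun p => Phi p.2 + \sum_(0 <= j < size s) Y j p) + kap.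
Proof.
move=> [S ST [C [C0 PhiB PhiC]]] kap0; have v0 := gb_v0 gb.
pose al := kap / (2 * (C * (size S)%:R + 1) * 2).
have CS0 : 0 <= C * (size S)%:R by rewrite mulr_ge0.
have D0 : 0 < 2 * (C * (size S)%:R + 1) * 2.
  by rewrite !mulr_gt0// ltr_wpDl.
have al0 : 0 < al by rewrite divr_gt0.
pose th := Num.min 2^-1 (al ^+ 2 / (v * T)).
have vT0 : 0 < v * T by rewrite mulr_gt0.
have th0 : 0 < th by rewrite lt_min invr_gt0 ltr0n divr_gt0// exprn_gt0.
have th1 : th < 1 by rewrite gt_min; apply/orP; left; lra.
have thal : v * (th * T) <= al ^+ 2.
  have : th <= al ^+ 2 / (v * T) by rewrite ge_min lexx orbT.
  by rewrite ler_pdivlMr// mulrCA.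
exists th; split; [by rewrite th0 th1|]; exists S => // s sP Ss Y HY.
pose m := size s; pose V := 'rV[R]_m.
have [P [K' [K'0 Px P_inc PN PD]]] := path_of_increments sP (lexx T) Ss.
pose row (x : nat -> R) : V := \row_(l < m) x l.
pose F (x : nat -> R) := Phi (P (row x)).
pose e (i : nat) (w : Omega T) : R := w (cut th s i) - w (node s i).
pose o (i : nat) (w : Omega T) : R := w (node s i.+1) - w (cut th s i).
pose kk r := index r (0 :: s).
have kkP r : r \in S -> (kk r <= m)%N /\ r = node s (kk r).
  move=> /Ss rs; split; last by rewrite /node nth_index.
  by rewrite -ltnS -[X in (_ < X)%N]/(size (0 :: s)) index_mem.
have P_diff x y r : r \in S ->
    `|P (row x) r - P (row y) r| <= `|\sum_(0 <= l < kk r) (x l - y l)|.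
  by move=> rS; rewrite !Px// -sumrB.
have FL : lip_first m (C * (size S)%:R) F.
  split=> // x y; rewrite (le_trans (PhiC _ _))// -mulrA ler_wpM2l//.
  apply: ler_sum_size => r rS; have [km _] := kkP r rS.
  rewrite (le_trans (P_diff x y r rS))// (le_trans (ler_norm_sum _ _ _))//.
  by rewrite [leRHS](big_cat_nat (leq0n (kk r)) km)//= lerDl sumr_ge0.
have Phi_inc w : F (fun l => e l w + o l w) = Phi w.
  have PhiS : plip (pnorm S) (pdist S) Phi.
    by exists C, 0%N; split=> // w1 w2; rewrite expr0 mulr1.
  apply: (plip_agree PhiS) => r rS; rewrite -[RHS]P_inc//; congr (P _ r).
  by apply/rowP => l; rewrite !mxE /e /o addrC subrKA.
have cPhi : cyl T Phi by apply: bcyl_cyl; exists S => //; exists C.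
have before i : (i < m)%N -> 0 <= node s i <= T /\ 0 <= cut th s i <= T.
  move=> im; have [h1 h2 h3 h4] := cut_bounds th0 th1 sP im.
  by rewrite h1 (le_trans h1 (ltW h2)) (le_trans (ltW h3) h4)
             (le_trans (ltW (lt_trans h2 h3)) h4).
have cF : cyl T (fun w => F (e^~ w)).
  exact: (lip_first_cyl (a := node s) (b := cut th s) FL before).
(* as [v * th * T <= al ^+ 2], dropping the last parts moves each value of the
   path by at most [2 * al] in mean *)
have close : E (fun w => `|Phi w - F (e^~ w)|) <= kap / 2.
  pose O r w := `|\sum_(0 <= l < kk r) o l w|.
  have cO r : r \in S -> cyl T (O r) /\ E (O r) <= al + al.
    move=> rS; have [km rk] := kkP r rS.
    have [c0 e0] := E_odd_sqr th0 th1 sP km.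
    have /andP[_ rT] := node_bounds sP km.
    have cT := cyl_le rT c0; split; first exact: cyl_abs.
    apply: le_trans (sexp_abs_le_sqr sE al0 cT (cyl_sqr cT)) _.
    rewrite lerD2r ler_pdivrMl// -expr2 (le_trans e0)// (le_trans _ thal)//.
    by rewrite ler_wpM2l ?ler_wpM2l// ltW.
  have cOi i : (i < size S)%N -> cyl T (O (nth 0 S i)).
    by move=> iS; have [] := cO _ (mem_nth 0 iS).
  apply: (@le_trans _ _ (C * E (fun w => \sum_(0 <= i < size S) O (nth 0 S i) w))).
    rewrite -(sexp_homogeneous sE C0 (cyl_sum cOi)).
    apply: (sexp_monotone sE) => [||w]; first exact/cyl_abs/cyl_sub.
      by apply: cyl_scale; exact: cyl_sum.
    rewrite -Phi_inc (le_trans (PhiC _ _))// ler_wpM2l//.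
    rewrite -(big_nth 0 xpredT (fun r => O r w)) /pdist big_seq [leRHS]big_seq.
    apply: ler_sum => r rS; rewrite (le_trans (P_diff _ _ r rS))//.
    by under eq_bigr do rewrite addrAC subrr add0r.
  apply: (@le_trans _ _ (C * \sum_(0 <= i < size S) (al + al))).
    rewrite ler_wpM2l// (le_trans (sexp_sum sE cOi))// !big_nat.
    by apply: ler_sum => i /= iS; have [] := cO _ (mem_nth 0 iS).
  rewrite sumr_const_nat subn0 -[_ *+ _]mulr_natl.
  have -> : kap / 2 = (C * (size S)%:R + 1) * (al + al).
    by rewrite /al; field; rewrite gt_eqF// ltr_wpDl.
  by rewrite mulrA ler_wpM2r ?lerDl// addr_ge0// ltW.
have cdiff := cyl_abs (cyl_sub cPhi cF).
have cY : Lc E T (fun p => \sum_(0 <= j < m) Y j p).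
  apply: (Lc_sum gb TT) => j jm; have [h _] := HY j jm.
  by apply: Lc_le h; have /andP[] := node_bounds sP jm.
have h1 : E Phi <= E (fun w => F (e^~ w)) + kap / 2.
  have := le_trans (ler_norm _) (sexp_dist sE cPhi cF); lra.
rewrite (EL_even_neutral th0 th1 sP HY (leqnn m) FL) in h1.
have LF := Lc_snd gb cF; have LPhi := Lc_snd gb cPhi.
have h2 : EL E (fun p => F (e^~ p.2) + \sum_(0 <= j < m) Y j p) <=
    EL E (fun p => Phi p.2 + \sum_(0 <= j < m) Y j p) + kap / 2.
  have Ldiff := Lc_snd gb cdiff.
  have LS := Lc_add gb TT LPhi cY.
  apply: (@le_trans _ _ (EL E (fun p => (Phi p.2 + \sum_(0 <= j < m) Y j p) +
     `|Phi p.2 - F (e^~ p.2)|))).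
    apply: (sexp_monotone sEL) => [||p]; [exact: (Lc_add gb TT)..|].
    have := ler_norm (F (e^~ p.2) - Phi p.2); rewrite distrC; lra.
  apply: le_trans (sexp_add sEL LS Ldiff) _.
  by rewrite lerD2l (EL_snd (fun w => `|Phi w - F (e^~ w)|)).
lra.
Qed.
End Insertion.

(** * Integrals with respect to the quadratic variation *)

Section Integrals.
Context {R : realType} {T : R} {E : (Omega T -> R) -> R} {v K : R}.
Context (T0 : 0 < T) (gb : G_brownian E v K).
Let sE : sublinear_expectation (cyl T) E := gb_sexp gb.
Let sEL := EL_sexp gb.
Let TT := lexx T.
Context {Q : R -> rvseq T} (Qqv : quadratic_variation E Q).

Lemma step_node (g : R -> R) a s j r : is_step g a s -> (j < size s)%N ->
  nth 0 (a :: s) j < r <= nth 0 (a :: s) j.+1 -> g r = g (nth 0 (a :: s) j.+1).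
Proof.
elim: s a j => // x s IH a [|j] [g1 g2] js; first exact: g1.
exact: (IH x j g2 js).
Qed.

Lemma EL_mul_excess (s t : R) (d : Omega T -> R) : 0 <= s -> s < t -> t <= T ->
  bcyl T d ->
  Lc E T (fun p => `|d p.2| * excess v Q s t p) /\
  EL E (fun p => `|d p.2| * excess v Q s t p) <= 0.
Proof.
move=> s0 st tT bd; have cE := Lc_le tT (Lc_excess gb Qqv s0 st tT).
have cdE := Lc_bmul gb TT (bcyl_abs bd) cE; split=> //.
have [S _ [C [C0 dC _]]] := bd.
rewrite -(mulr0 C) -(EL_excess gb Qqv s0 st tT) -(sexp_homogeneous sEL C0 cE).
apply: (sexp_monotone sEL) => // [|p]; first exact: (Lc_scale gb).
by rewrite ler_wpM2r// excess_ge0.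
Qed.

Lemma EL_sum_excess N (al be : nat -> R) (d : nat -> Omega T -> R) :
  (forall l, (l < N)%N -> [/\ 0 <= al l, al l < be l & be l <= T]) ->
  (forall l, (l < N)%N -> bcyl T (d l)) ->
  let W := fun p => \sum_(0 <= l < N)
    `|d l p.2| * excess v Q (al l) (be l) p in
  Lc E T W /\ EL E W <= 0.
Proof.
move=> albe bd W.
have exP l : (l < N)%N -> Lc E T (fun p => `|d l p.2| *
      excess v Q (al l) (be l) p) /\
    EL E (fun p => `|d l p.2| *
      excess v Q (al l) (be l) p) <= 0.
  by move=> lN; have [a0 ab bT] := albe l lN; exact: EL_mul_excess (bd l lN).
split; first by apply: (Lc_sum gb TT) => l /exP[].
rewrite (le_trans (sexp_sum sEL _))//; first by move=> l /exP[].
by rewrite big_nat sumr_le0// => l /= /exP[].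
Qed.

Section OnPartition.
Context {s : seq R} (sP : itv_partition 0 T s).

Let dQ l (p : nat * Omega T) := Q (node s l.+1) p.1 p.2 - Q (node s l) p.1 p.2.
Let D l := node s l.+1 - node s l.
Let ex l (p : nat * Omega T) :=
  excess v Q (node s l) (node s l.+1) p.

Lemma dQ_abs l p : (l < size s)%N -> `|dQ l p| <= v * D l + ex l p.
Proof.
move=> ls; have /andP[h1 h2] := @dQ_bounds R T v Q (node s l) (node s l.+1) p.
have vD : 0 <= v * D l.
  by rewrite mulr_ge0 ?(ltW (gb_v0 gb))// subr_ge0 (node_le sP).
rewrite ler_norml /dQ /ex; apply/andP; split; last exact: h2.
by rewrite /D in vD *; lra.
Qed.

(** After an exchange of the sums, the weights of the windows over one interval
    of the partition add up to at most 1 in absolute value. *)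
Lemma window_bound (d : nat -> R) N (al be a : nat -> R) p :
  (forall r, `|\sum_(0 <= j < N) a j * win (al j) (be j) r| <= 1) ->
  `|\sum_(0 <= j < N) a j *
     \sum_(0 <= l < size s) d l * (win (al j) (be j) (node s l.+1) * dQ l p)|
  <= \sum_(0 <= l < size s) `|d l| * (v * D l + ex l p).
Proof.
move=> a1.
have -> : \sum_(0 <= j < N) a j * \sum_(0 <= l < size s)
    d l * (win (al j) (be j) (node s l.+1) * dQ l p) =
  \sum_(0 <= l < size s) d l * dQ l p *
     \sum_(0 <= j < N) a j * win (al j) (be j) (node s l.+1).
  under eq_bigr do rewrite mulr_sumr.
  rewrite exchange_big /=; apply: eq_bigr => l _; rewrite mulr_sumr.
  by apply: eq_bigr => j _; ring.
rewrite (le_trans (ler_norm_sum _ _ _))// !big_nat; apply: ler_sum => l /= ls.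
rewrite !normrM -[leRHS]mulr1; apply: ler_pM; [exact: mulr_ge0|exact: normr_ge0| |exact: a1].
by rewrite ler_wpM2l// dQ_abs.
Qed.

Lemma EL_window_bound (d : nat -> Omega T -> R) :
  (forall l, (l < size s)%N -> bcyl T (d l)) ->
  Lc E T (fun p => \sum_(0 <= l < size s) `|d l p.2| * (v * D l + ex l p)) /\
  EL E (fun p => \sum_(0 <= l < size s) `|d l p.2| * (v * D l + ex l p)) <=
  v * E (fun w => \sum_(0 <= l < size s) `|d l w| * D l).
Proof.
move=> bd.
have [Lex Eex] : Lc E T (fun p => \sum_(0 <= l < size s) `|d l p.2| * ex l p) /\
    EL E (fun p => \sum_(0 <= l < size s) `|d l p.2| * ex l p) <= 0.
  apply: (EL_sum_excess (al := node s) (be := fun l => node s l.+1)) bd => l ls.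
  split; [by have /andP[] := node_bounds sP (ltnW ls) | exact: (node_lt sP) |].
  by have /andP[] := node_bounds sP ls.
have cD : cyl T (fun w => \sum_(0 <= l < size s) `|d l w| * D l).
  apply: cyl_sum => l ls; under eq_fun do rewrite mulrC.
  by apply: cyl_scale; apply: cyl_abs; apply: bcyl_cyl; exact: bd.
have LD := Lc_scale gb v TT (Lc_snd gb cD).
have eqp : (fun p => \sum_(0 <= l < size s) `|d l p.2| * (v * D l + ex l p)) =
    (fun p => v * (\sum_(0 <= l < size s) `|d l p.2| * D l) +
       \sum_(0 <= l < size s) `|d l p.2| * ex l p).
  apply/funext => p; rewrite mulr_sumr -big_split; apply: eq_bigr => l _ /=.
  by ring.
rewrite eqp; split; first exact: (Lc_add gb TT).
apply: le_trans (sexp_add sEL LD Lex) _.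
rewrite (sexp_homogeneous sEL (ltW (gb_v0 gb)) (Lc_snd gb cD)).
rewrite (EL_snd (fun w => \sum_(0 <= l < size s) `|d l w| * D l)).
by rewrite -[leRHS]addr0 lerD2l.
Qed.
End OnPartition.

Context {beta : R} {h : nat -> simple_process T} {A : R -> rvseq T}.
Context (beta1 : 1 < beta) (h_M : MG E beta h) (h_ge0 : MG_nonneg E beta h).
Context (A_int : forall t, 0 <= t <= T -> is_integral E Q h t (A t)).

Definition refines s n := itv_partition 0 T s /\ {subset sp_times (h n) <= s}.

Let X n r w := sp_val (h n) r w.

Let sp_val0 eta (w : Omega T) : sp_val eta 0 w = 0.
Proof. by rewrite sp_valE stepfun_le//; case: (sp_partition eta). Qed.

Lemma refines_val s n j : refines s n -> (j < size s)%N ->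
  bcyl (node s j) (X n (node s j.+1)).
Proof. by move=> [sP sub] js; exact: sp_val_bcyl. Qed.

Lemma refines_valT s n j : refines s n -> (j < size s)%N ->
  bcyl T (X n (node s j.+1)).
Proof.
move=> sn js; apply: bcyl_le (refines_val sn js).
by have /andP[] := node_bounds sn.1 (ltnW js).
Qed.

(** The distance of [h m] and [h n] in the space M^1 if [s] refines both. *)
Definition dist1 s m n : R := E (tint s (fun r w => `|X m r w - X n r w|)).

Lemma h_cauchy1 (e : R) : 0 < e -> exists n0 : nat, forall m n s, (n0 <= m)%N ->
  (n0 <= n)%N -> refines s m -> refines s n -> dist1 s m n <= e.
Proof.
move=> e0; have [k k0 kP] := L1_of_Mnorm T0 gb (ltW beta1) e0.
have [n0 n0P] := h_M k0; exists n0 => m n s mn nn [sP sm] [_ sn].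
apply: (kP s (fun r w => X m r w - X n r w)) => //.
- move=> w; apply: (is_step_map (fun x y => x - y)); exact: sp_step.
- by move=> w; rewrite /X !sp_val0 subrr.
- by move=> j js; apply: bcyl_sub; apply: refines_valT.
- exact: n0P.
Qed.

Lemma h_neg (e : R) : 0 < e -> exists n0 : nat, forall n s, (n0 <= n)%N ->
  refines s n -> E (tint s (fun r w => `|Num.max (- X n r w) 0|)) <= e.
Proof.
move=> e0; have [k k0 kP] := L1_of_Mnorm T0 gb (ltW beta1) e0.
have /cvgrPdist_lt/(_ k k0)[n0 _ n0P] := h_ge0; exists n0 => n s nn [sP sn].
apply: (kP s (fun r w => Num.max (- X n r w) 0)) => //.
- move=> w; apply: (is_step_map (fun x _ => Num.max (- x) 0)
    (g' := fun r => X n r w)); exact: sp_step.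
- by move=> w; rewrite /X sp_val0 oppr0 maxxx.
- by move=> j js; apply: bcyl_maxc; apply: bcyl_opp; exact: refines_valT.
have := n0P n nn; rewrite /= distrC subr0; apply: le_lt_trans; exact: ler_norm.
Qed.

Lemma Lc_I n t : 0 <= t <= T -> Lc E T (fun p => sp_integral Q (h n) t p.1 p.2).
Proof. by move=> tT; exact: (sp_integral_L1 gb (h n) Qqv tT). Qed.

Lemma Lc_AT t : 0 <= t <= T -> Lc E T (fun p => A t p.1 p.2).
Proof.
move=> tT; have [At _] := A_int tT; have := L1G_Lc tT At.
by have /andP[_ h1] := tT; exact: Lc_le.
Qed.

Let gap n t (p : nat * Omega T) : R :=
  `|A t p.1 p.2 - sp_integral Q (h n) t p.1 p.2|.

Lemma Lc_gap n t : 0 <= t <= T -> Lc E T (gap n t).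
Proof.
move=> tT; apply: (Lc_abs gb TT); apply: (Lc_sub gb TT).
  exact: Lc_AT.
exact: Lc_I.
Qed.

Lemma gap_small (L : seq R) (e : R) : 0 < e -> (forall t, t \in L -> 0 <= t <= T) ->
  exists n0 : nat, forall n, (n0 <= n)%N -> forall t, t \in L ->
    EL E (gap n t) <= e.
Proof.
move=> e0; elim: L => [|t L IH] LT; first by exists 0%N.
have [n1 n1P] : exists n0 : nat, forall n, (n0 <= n)%N -> forall t, t \in L ->
    EL E (gap n t) <= e.
  by apply: IH => u uL; apply: LT; rewrite in_cons uL orbT.
have tT : 0 <= t <= T by apply: LT; rewrite mem_head.
have [_ /cvgrPdist_lt/(_ e e0)[n2 _ n2P]] := A_int tT.
exists (maxn n1 n2) => n; rewrite geq_max => /andP[h1 h2] u.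
rewrite in_cons => /orP[/eqP ->|]; last exact: n1P.
have := n2P n h2; rewrite /= distrC subr0 => /ltW.
apply: le_trans; exact: ler_norm.
Qed.

Lemma common_refinement (L : seq R) n : (forall r, r \in L -> 0 <= r <= T) ->
  exists s, refines s n /\ {subset L <= 0 :: s}.
Proof.
move=> LT; have timesT r : r \in sp_times (h n) -> 0 <= r <= T.
  move=> rh; have /mem_node[i im ->] : r \in 0 :: sp_times (h n).
    by rewrite in_cons rh orbT.
  exact: (node_bounds (sp_partition (h n))).
have [s sP sub] : exists2 p, itv_partition 0 T p &
    {subset L ++ sp_times (h n) <= 0 :: p}.
  by apply: partition_of => // r; rewrite mem_cat => /orP[/LT|/timesT].
exists s; split; last by move=> r rL; apply: sub; rewrite mem_cat rL.
split=> // r rh; have := sub r; rewrite mem_cat rh orbT in_cons => /(_ isT).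
case/orP => // /eqP r0; have [hp _] := sp_partition (h n).
by have := path_lt_mem hp rh; rewrite r0 ltxx.
Qed.

(** Replacing [h n1] by the integrand of [A] over the last parts of the
    intervals costs at most [v] times the distance in M^1, uniformly over weights
    of size at most 1. *)
Lemma integral_approx n1 (dl th : R) s (a : nat -> Omega T -> R) :
  (forall m s', (n1 <= m)%N -> refines s' m -> refines s' n1 ->
     dist1 s' m n1 <= dl) ->
  refines s n1 -> 0 < th -> th < 1 ->
  (forall j, (j < size s)%N -> bcyl T (a j)) ->
  (forall j w, `|a j w| <= 1) ->
  let W := fun p : nat * Omega T => \sum_(0 <= j < size s) a j p.2 *
    (X n1 (node s j.+1) p.2 *
       (Q (node s j.+1) p.1 p.2 - Q (cut th s j) p.1 p.2) -
     (A (node s j.+1) p.1 p.2 - A (cut th s j) p.1 p.2)) in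
  Lc E T W /\ EL E W <= v * dl.
Proof.
move=> h_dl sn th0 th1 ba a1 W; have [sP sub] := sn.
have cutb j : (j < size s)%N -> [/\ 0 <= cut th s j <= T,
    0 <= node s j.+1 <= T, cut th s j <= node s j.+1 & node s j <= cut th s j].
  move=> js; have [h1 h2 h3 h4] := cut_bounds th0 th1 sP js.
  have h5 := le_trans h1 (ltW h2).
  by rewrite h5 h4 (le_trans h5 (ltW h3)) (le_trans (ltW h3) h4); split=> //; exact: ltW.
have LcQT t : 0 <= t <= T -> Lc E T (fun p => Q t p.1 p.2).
  by move=> tT; have := Lc_Q Qqv tT; have /andP[_ h1] := tT; exact: Lc_le.
have LW : Lc E T W.
  apply: (Lc_sum gb TT) => j js; have [b1 b2 _ _] := cutb j js.
  apply: (Lc_bmul gb TT (ba j js)); apply: (Lc_sub gb TT).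
    apply: (Lc_bmul gb TT (refines_valT sn js)).
    by apply: (Lc_sub gb TT); exact: LcQT.
  by apply: (Lc_sub gb TT); exact: Lc_AT.
split=> //; apply/ler_addgt0Pr => e e0; set N := size s.
have e1 : 0 < e / (2 * (N%:R + 1)) by rewrite divr_gt0// mulr_gt0// ltr_wpDl.
pose L := [seq node s j.+1 | j <- index_iota 0 N] ++
          [seq cut th s j | j <- index_iota 0 N].
have LT t : t \in L -> 0 <= t <= T.
  rewrite mem_cat => /orP[] /mapP[j]; rewrite mem_index_iota /= => /cutb[? ? ? ?];
    by move=> ->.
have [n0 n0P] := gap_small e1 LT.
pose m := maxn n0 n1; have n1m : (n1 <= m)%N by exact: leq_maxr.
have gapP t : t \in L -> EL E (gap m t) <= e / (2 * (N%:R + 1)).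
  by apply: n0P; exact: leq_maxl.
have [s1 [s1n sub1]] := common_refinement n1 LT.
have s1T r : r \in s1 ++ s ++ L -> 0 <= r <= T.
  have in01 p' : itv_partition 0 T p' -> r \in p' -> 0 <= r <= T.
    move=> pP rp; have /mem_node[i im ->] : r \in 0 :: p' by rewrite in_cons rp orbT.
    exact: node_bounds pP im.
  rewrite mem_cat => /orP[/(in01 _ s1n.1)//|].
  by rewrite mem_cat => /orP[/(in01 _ sP)|/LT].
have [s' [s'm sub']] := common_refinement m s1T.
have s'n : refines s' n1.
  split; first exact: s'm.1.
  move=> r rh; have := sub' r; rewrite mem_cat (s1n.2 r rh) in_cons => /(_ isT).
  case/orP => // /eqP r0; have [hp _] := sp_partition (h n1).
  by have := path_lt_mem hp rh; rewrite r0 ltxx.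
have Ls' r : r \in L -> r \in 0 :: s'.
  by move=> rL; apply: sub'; rewrite mem_cat [in X in _ || X]mem_cat rL !orbT.
pose d l w := X n1 (node s' l.+1) w - X m (node s' l.+1) w.
have bd l : (l < size s')%N -> bcyl T (d l).
  by move=> ls; apply: bcyl_sub; apply: refines_valT.
have [LB EB] := EL_window_bound s'm.1 bd.
have wins r w : `|\sum_(0 <= j < N) a j w * win (cut th s j) (node s j.+1) r| <= 1.
  rewrite (le_trans (ler_norm_sum _ _ _))// (le_trans _ (stepfun1_le1 sP r))//.
  rewrite /stepfun !big_nat; apply: ler_sum => j /= js; have [_ _ _ b4] := cutb j js.
  rewrite normrM (ger0_norm (win_ge0 _ _ _)) mul1r indic_oc.
  apply: (@le_trans _ _ (1 * win (cut th s j) (node s j.+1) r)).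
    by rewrite ler_wpM2r// win_ge0.
  rewrite mul1r /win ler_nat; case: (ltP (cut th s j) r) => //= cr.
  by rewrite -/(node s j) -/(node s j.+1) (le_lt_trans b4 cr).
pose G p := \sum_(0 <= j < N) (gap m (node s j.+1) p + gap m (cut th s j) p).
have inL j : (j < N)%N -> node s j.+1 \in L /\ cut th s j \in L.
  move=> jN; rewrite !mem_cat; split.
    by apply/orP; left; apply/mapP; exists j => //; rewrite mem_index_iota.
  by apply/orP; right; apply/mapP; exists j => //; rewrite mem_index_iota.
have Lgg j : (j < N)%N ->
    Lc E T (fun p => gap m (node s j.+1) p + gap m (cut th s j) p).
  move=> jN; have [b1 b2 _ _] := cutb j jN.
  by apply: (Lc_add gb TT); exact: Lc_gap.
have LG : Lc E T G by apply: (Lc_sum gb TT).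
have key p : W p <= \sum_(0 <= l < size s') `|d l p.2| *
    (v * (node s' l.+1 - node s' l) +
     excess v Q (node s' l) (node s' l.+1) p) + G p.
  have WE : W p = \sum_(0 <= j < N) a j p.2 * \sum_(0 <= l < size s') d l p.2 *
      (win (cut th s j) (node s j.+1) (node s' l.+1) *
       (Q (node s' l.+1) p.1 p.2 - Q (node s' l) p.1 p.2)) +
    \sum_(0 <= j < N) a j p.2 *
      ((sp_integral Q (h m) (node s j.+1) p.1 p.2 - A (node s j.+1) p.1 p.2) -
       (sp_integral Q (h m) (cut th s j) p.1 p.2 - A (cut th s j) p.1 p.2)).
    rewrite -big_split /W !big_nat; apply: eq_bigr => j /= jN; rewrite -mulrDr.
    congr (_ * _); have [b1 b2 b3 b4] := cutb j jN; have [i1 i2] := inL j jN.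
    have wI := sp_integral_window s'm.1 s'm.2 Q p.1 p.2 (Ls' _ i2) (Ls' _ i1) b3.
    have wQ := window_cst s'm.1 (fun r => Q r p.1 p.2) (Ls' _ i2) (Ls' _ i1) b3.
    rewrite wQ mulr_sumr.
    have -> : \sum_(0 <= l < size s') d l p.2 *
        (win (cut th s j) (node s j.+1) (node s' l.+1) *
         (Q (node s' l.+1) p.1 p.2 - Q (node s' l) p.1 p.2)) =
      \sum_(0 <= l < size s') X n1 (node s j.+1) p.2 *
        (win (cut th s j) (node s j.+1) (node s' l.+1) *
         (Q (node s' l.+1) p.1 p.2 - Q (node s' l) p.1 p.2)) -
      \sum_(0 <= l < size s') X m (node s' l.+1) p.2 *
        (win (cut th s j) (node s j.+1) (node s' l.+1) *
         (Q (node s' l.+1) p.1 p.2 - Q (node s' l) p.1 p.2)).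
      rewrite -sumrB; apply: eq_bigr => l _; rewrite /d /win.
      case: (boolP (cut th s j < node s' l.+1 <= node s j.+1)) => [/andP[c1 c2]|_];
        last by rewrite !mul0r !mulr0 subrr.
      have <- : X n1 (node s' l.+1) p.2 = X n1 (node s j.+1) p.2.
        apply: (step_node (sp_step sP sub p.2) jN).
        by rewrite -/(node s j) (le_lt_trans b4 c1).
      by rewrite mulrBl.
    by rewrite -wI; ring.
  rewrite WE; apply: lerD.
    apply: le_trans (ler_norm _) _.
    exact: (@window_bound s' s'm.1 (d^~ p.2) N (cut th s) (fun j => node s j.+1)
      (a^~ p.2) p (fun r => wins r p.2)).
  rewrite /G; apply: ler_sum => j _.
  apply: le_trans (ler_norm _) _; rewrite normrM.
  apply: le_trans (ler_wpM2r (normr_ge0 _) (a1 j p.2)) _; rewrite mul1r.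
  apply: le_trans (ler_normB _ _) _.
  by rewrite lerD// distrC.
apply: (@le_trans _ _ (EL E (fun p => \sum_(0 <= l < size s') `|d l p.2| *
    (v * (node s' l.+1 - node s' l) +
     excess v Q (node s' l) (node s' l.+1) p) + G p))).
  by apply: (sexp_monotone sEL) => //; exact: (Lc_add gb TT).
apply: le_trans (sexp_add sEL LB LG) _; apply: lerD.
  apply: (le_trans EB); rewrite ler_wpM2l ?(ltW (gb_v0 gb))//.
  apply: le_trans (h_dl m s' n1m s'm s'n).
  rewrite /dist1 /tint le_eqVlt; apply/orP; left; apply/eqP; congr E.
  by apply/funext => w; apply: eq_bigr => l _; rewrite /d distrC.
apply: le_trans (sexp_sum sEL Lgg) _.
apply: (@le_trans _ _ (\sum_(0 <= j < N) (2 * (e / (2 * (N%:R + 1)))))).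
  rewrite !big_nat; apply: ler_sum => j /= jN; have [i1 i2] := inL j jN.
  have [b1 b2 _ _] := cutb j jN.
  apply: le_trans (sexp_add sEL (Lc_gap m b2) (Lc_gap m b1)) _.
  by rewrite mulrDl mul1r lerD// gapP.
rewrite sumr_const_nat subn0 -[_ *+ _]mulr_natl.
have N1 : 0 < N%:R + 1 :> R by rewrite ltr_wpDl.
have -> : N%:R * (2 * (e / (2 * (N%:R + 1)))) = e * (N%:R / (N%:R + 1)).
  by field; rewrite gt_eqF.
by rewrite ler_piMr ?(ltW e0)// ler_pdivrMr// mul1r lerDl.
Qed.

(** The increments of [A] are nonnegative in mean because [h] and the quadratic
    variation are. *)
Lemma A_pos t : 0 <= t <= T -> 0 <= EL E (dA A 0 t).
Proof.
move=> tT; have v0 := gb_v0 gb; have zT : 0 <= (0 : R) <= T by rewrite lexx ltW.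
have LA : Lc E T (dA A 0 t).
  by apply: (Lc_sub gb TT); exact: Lc_AT.
apply/ler_addgt0Pr => e e0.
have e4 : 0 < e / 4 by rewrite divr_gt0.
have e2v : 0 < e / (2 * v) by rewrite divr_gt0// mulr_gt0.
have LT r : r \in [:: 0; t] -> 0 <= r <= T.
  by rewrite !inE => /orP[] /eqP ->.
have [n0 n0P] := gap_small e4 LT; have [n1 n1P] := h_neg e2v.
pose n := maxn n0 n1; have [s [sn sub]] := common_refinement n LT.
have gapP r : r \in [:: 0; t] -> EL E (gap n r) <= e / 4.
  by apply: n0P; exact: leq_maxl.
have negP := n1P n s (leq_maxr _ _) sn.
have [i0 it] : 0 \in 0 :: s /\ t \in 0 :: s.
  by split; apply: sub; rewrite !inE eqxx ?orbT.
have t0 : 0 <= t by have /andP[] := tT.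
pose neg l w := Num.max (- X n (node s l.+1) w) 0.
have bneg l : (l < size s)%N -> bcyl T (neg l).
  by move=> ls; apply: bcyl_maxc; apply: bcyl_opp; exact: refines_valT.
have [LB EB] := EL_window_bound sn.1 bneg.
have [LX EX] := @EL_sum_excess (size s) (node s) (fun l => node s l.+1)
  (fun l => X n (node s l.+1))
  (fun l ls => And3 (proj1 (andP (node_bounds sn.1 (ltnW ls))))
     (node_lt sn.1 (ltnSn l) ls) (proj2 (andP (node_bounds sn.1 ls))))
  (fun l ls => refines_valT sn ls).
have Lg r : r \in [:: 0; t] -> Lc E T (gap n r) by move=> /LT; exact: Lc_gap.
have [z1 z2] : 0 \in [:: 0; t] /\ t \in [:: 0; t].
  by rewrite !inE !eqxx orbT.
have opp : EL E (fun p => - dA A 0 t p) <= e.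
  have LL := Lc_add gb TT (Lc_add gb TT (Lg t z2) (Lg 0 z1)) (Lc_add gb TT LB LX).
  apply: le_trans (sexp_monotone sEL (Lc_opp gb TT LA) LL _) _; last first.
    apply: le_trans (sexp_add sEL (Lc_add gb TT (Lg t z2) (Lg 0 z1))
      (Lc_add gb TT LB LX)) _.
    have h1 := sexp_add sEL (Lg t z2) (Lg 0 z1).
    have h2 := sexp_add sEL LB LX.
    have h3 := gapP t z2; have h4 := gapP 0 z1.
    have h5 : v * E (fun w => \sum_(0 <= l < size s) `|neg l w| *
        (node s l.+1 - node s l)) <= e / 2.
      have -> : e / 2 = v * (e / (2 * v)) by field; rewrite gt_eqF.
      by rewrite ler_wpM2l// ltW.
    lra.
  move=> p.
  have -> : - dA A 0 t p =
    - (A t p.1 p.2 - sp_integral Q (h n) t p.1 p.2) +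
    (A 0 p.1 p.2 - sp_integral Q (h n) 0 p.1 p.2) -
    (sp_integral Q (h n) t p.1 p.2 - sp_integral Q (h n) 0 p.1 p.2).
    by rewrite /dA; ring.
  rewrite (sp_integral_window sn.1 sn.2 Q p.1 p.2 i0 it t0).
  apply: lerD.
    by apply: lerD; [rewrite /gap -normrN|]; exact: ler_norm.
  rewrite -sumrN -big_split /= !big_nat; apply: ler_sum => l /= ls.
  have /andP[q1 q2] := @dQ_bounds R T v Q (node s l) (node s l.+1) p.
  have := @excess_ge0 R T v Q (node s l) (node s l.+1) p.
  move: (excess _ _ _ _ p) q1 q2 => x q1 q2 x0.
  move: (Q (node s l.+1) p.1 p.2 - Q (node s l) p.1 p.2) q1 q2 => q q1 q2.
  have vD : 0 <= v * (node s l.+1 - node s l).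
    by rewrite mulr_ge0 ?(ltW v0)// subr_ge0 (node_le sn.1).
  move: (v * _) vD q2 => V V0 q2.
  have w01 : 0 <= win 0 t (node s l.+1) <= 1.
    by rewrite win_ge0 /win lern1 leq_b1.
  move: (win _ _ _) w01 => ww /andP[w0 w1].
  rewrite /neg /X; move: (sp_val _ _ _) => y.
  have [y0|y0] := leP 0 y.
    have -> : Num.max (- y) 0 = 0 by apply/max_idPr; rewrite oppr_le0.
    have -> : - (y * (ww * q)) = y * (ww * - q) by ring.
    rewrite normr0 mul0r add0r (ger0_norm y0) ler_wpM2l//.
    apply: (@le_trans _ _ (ww * x)); first by rewrite ler_wpM2l// lerNl.
    by rewrite ler_piMl.
  have -> : Num.max (- y) 0 = - y by apply/max_idPl; rewrite oppr_ge0 ltW.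
  rewrite normrN (ltr0_norm y0).
  apply: (@le_trans _ _ (- y * (V + x))); last first.
    by rewrite lerDl mulr_ge0// oppr_ge0 ltW.
  rewrite -mulNr ler_wpM2l ?oppr_ge0 ?(ltW y0)//.
  apply: (@le_trans _ _ (ww * (V + x))); first by rewrite ler_wpM2l.
  by rewrite ler_piMl// addr_ge0.
have := sexp_opp sEL LA; lra.
Qed.
End Integrals.
Arguments refines {R T} h s n.
Arguments dist1 {R T} E h s m n.

(** * The integrand is constant *)

Section RealSteps.
Context {R : realType}.
Implicit Types (x y c : R).

Lemma max_dist x y c :
  Num.max (x - c) 0 <= `|x - y| + Num.max (y - c) 0.
Proof.
have := max_lip 0 (x - c) (y - c); rewrite opprB addrA subrK => h.
by have := ler_norm (Num.max (x - c) 0 - Num.max (y - c) 0); lra.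
Qed.

Lemma max_subC x c : Num.max (c - x) 0 = Num.max (x - c) 0 - (x - c).
Proof. by case: (leP (c - x) 0); case: (leP (x - c) 0) => *; lra. Qed.

(** A Lipschitz approximation of the indicator of [0 < x], for use as a
    weight. *)
Definition sgn_cut (e x : R) : R := Num.min (e^-1 * Num.max x 0) 1.

Lemma sgn_cut_bounds e x : 0 < e -> 0 <= sgn_cut e x <= 1.
Proof.
move=> e0; rewrite /sgn_cut ge_min lexx orbT andbT le_min ler01 andbT.
by apply: mulr_ge0; [rewrite invr_ge0 ltW | rewrite le_max lexx orbT].
Qed.

Lemma sgn_cut_le e x : 0 < e -> Num.max x 0 <= sgn_cut e x * x + e.
Proof.
move=> e0; rewrite /sgn_cut; have [x0|x0] := leP x 0.
  by rewrite mulr0 min_l// mul0r add0r ltW.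
have [xe|xe] := leP (e^-1 * x) 1; last by rewrite mul1r lerDl ltW.
rewrite ler_pdivrMl// mulr1 in xe.
rewrite (le_trans xe)// lerDr.
by do 2?[apply: mulr_ge0]; rewrite ?invr_ge0 ltW.
Qed.

(** Put [b = a * xi / (th * v)]. The gain [a * xi * D = b * (v * th * D)] equals
    [b * q] up to [b] times the compensated increment [q - v * th * D]; as
    [b <= M], the penalty [M] turns the latter into an upper bound. *)
Lemma upper_step (v th c D e a x0 xi q d M ex : R) :
  0 < v -> 0 < th -> 0 <= D -> 0 <= M -> 0 <= a <= 1 -> 0 <= ex ->
  Num.max (xi - c) 0 <= a * (xi - c) + e ->
  `|(th * v)^-1 * xi| <= M -> q <= v * (th * D) + ex ->
  Num.max (x0 - c) 0 * D + M * (q - v * (th * D)) <=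
  `|x0 - xi| * D + e * D + (th * v)^-1 * (a * (d - c * v * (th * D))) +
  (th * v)^-1 * (a * (xi * q - d)) + 2 * M * ex.
Proof.
move=> v0 th0 D0 M0 /andP[a0 a1] ex0 hmax hM hq.
have thv : th * v != 0 by rewrite mulf_neq0 ?gt_eqF.
have h1 := ler_wpM2r D0 (max_dist x0 xi c).
have h2 := ler_wpM2r D0 hmax.
have [b bE] : exists b, b = (th * v)^-1 * xi * a by eexists.
have bM : `|b| <= M.
  by rewrite bE normrM (ger0_norm a0) -[leRHS]mulr1; apply: ler_pM.
have kk : (th * v)^-1 * (a * (d - c * v * (th * D))) +
    (th * v)^-1 * (a * (xi * q - d)) = b * q - a * c * D.
  by rewrite bE; field; rewrite !gt_eqF.
have eb : b * (v * (th * D)) = a * xi * D by rewrite bE; field; rewrite !gt_eqF.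
move: bM; rewrite ler_norml => /andP[b1 b2].
have Mb : 0 <= M - b by rewrite subr_ge0.
have h3 : (M - b) * (q - v * (th * D)) <= (M - b) * ex.
  by rewrite ler_wpM2l// lerBlDl.
have h4 : (M - b) * ex <= (2 * M) * ex by rewrite ler_wpM2r//; lra.
rewrite -[X in X + 2 * M * ex]addrA kk.
lra.
Qed.

(** As [q <= v * th * D] up to [ex], the increment [d] of the integral of
    [xi >= 0] is at most [xi * v * th * D]; so [d - c * v * th * D] is negative
    where [xi < c] and compensates the gain [c - xi]. *)
Lemma lower_step (v th c D x0 xi q d ex : R) :
  0 < v -> 0 < th -> 0 <= D -> 0 <= ex -> - ex <= q -> q <= v * (th * D) + ex ->
  Num.max (c - x0) 0 * D + (th * v)^-1 * (d - c * v * (th * D)) <=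
  `|x0 - xi| * D + Num.max (xi - c) 0 * D + 2 * (`|Num.max (- xi) 0| * D) +
  (th * v)^-1 * (-1 * (xi * q - d)) + (th * v)^-1 * (`|xi| * ex).
Proof.
move=> v0 th0 D0 ex0 hq1 hq2.
have thv : th * v != 0 by rewrite mulf_neq0 ?gt_eqF.
have k0 : 0 <= (th * v)^-1 by rewrite invr_ge0 ltW// mulr_gt0.
have h1 : Num.max (c - x0) 0 * D <= (`|x0 - xi| + Num.max (c - xi) 0) * D.
  rewrite ler_wpM2r//; have := max_lip 0 (c - x0) (c - xi).
  have -> : c - x0 - (c - xi) = - (x0 - xi) by ring.
  rewrite normrN; have := ler_norm (Num.max (c - x0) 0 - Num.max (c - xi) 0).
  lra.
rewrite (max_subC xi c) in h1.
have kD : (th * v)^-1 * (v * (th * D)) = D by field; rewrite !gt_eqF.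
have kk : (th * v)^-1 * (d - c * v * (th * D)) =
    (th * v)^-1 * (-1 * (xi * q - d)) + (th * v)^-1 * (xi * q) - c * D.
  by field; rewrite !gt_eqF.
have h2 : (th * v)^-1 * (xi * q) <=
    xi * D + 2 * (`|Num.max (- xi) 0| * D) + (th * v)^-1 * (`|xi| * ex).
  rewrite -[in X in _ <= X + _ + _]kD.
  have [xi0|xi0] := leP 0 xi.
    have -> : Num.max (- xi) 0 = 0 by apply/max_idPr; rewrite oppr_le0.
    have h := ler_wpM2l k0 (ler_wpM2l xi0 hq2).
    rewrite normr0 (ger0_norm xi0); lra.
  have -> : Num.max (- xi) 0 = - xi by apply/max_idPl; rewrite oppr_ge0 ltW.
  have xi0' : 0 <= - xi by rewrite oppr_ge0 ltW.
  rewrite normrN (ltr0_norm xi0).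
  have hq1' : - q <= ex by rewrite lerNl.
  have h := ler_wpM2l k0 (ler_wpM2l xi0' hq1').
  have h' := mulr_ge0 xi0' D0; rewrite kD; lra.
rewrite kk; lra.
Qed.
End RealSteps.

Section ConstantIntegrand.
Context {R : realType} {T : R} {E : (Omega T -> R) -> R} {v K : R}.
Context (T0 : 0 < T) (gb : G_brownian E v K).
Let sE : sublinear_expectation (cyl T) E := gb_sexp gb.
Let sEL := EL_sexp gb.
Let TT := lexx T.
Let v0 : 0 < v := gb_v0 gb.
Context {Q : R -> rvseq T} (Qqv : quadratic_variation E Q).
Context {beta : R} {h : nat -> simple_process T} {A : R -> rvseq T}.
Context (beta1 : 1 < beta) (h_M : MG E beta h) (h_ge0 : MG_nonneg E beta h).
Context (A_int : forall t, 0 <= t <= T -> is_integral E Q h t (A t)).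
Context (A_indep : independent_increments E A).
Context {lam : R} (A_mean : forall s t, 0 <= s -> s <= t -> t <= T ->
  EL E (dA A s t) = lam * (t - s)).

Let c := lam / v.
Let lamE : lam = c * v. Proof. by rewrite /c divfK// gt_eqF. Qed.

Local Notation X := (fun n r w => sp_val (h n) r w).
Local Notation refines := (refines h).
Local Notation exc := (fun s t => excess v Q s t).

Lemma subset_pos (p s : seq R) : itv_partition 0 T p -> {subset p <= 0 :: s} ->
  {subset p <= s}.
Proof.
move=> [pp _] ps r rp; have := ps r rp; rewrite in_cons => /orP[/eqP r0|//].
by have := path_lt_mem pp rp; rewrite r0 ltxx.
Qed.

Lemma common_refinement2 (L : seq R) m n : (forall r, r \in L -> 0 <= r <= T) ->
  exists s, [/\ refines s m, refines s n & {subset L <= 0 :: s}].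
Proof.
move=> LT; have [s [sn sub]] : exists s, refines s n /\
    {subset L ++ sp_times (h m) <= 0 :: s}.
  apply: (common_refinement T0) => r; rewrite mem_cat => /orP[/LT//|rh].
  have /mem_node[i im ->] : r \in 0 :: sp_times (h m) by rewrite in_cons rh orbT.
  exact: (node_bounds (sp_partition (h m))).
exists s; split=> //; last by move=> r rL; apply: sub; rewrite mem_cat rL.
split; first exact: sn.1.
apply: (subset_pos (sp_partition (h m))) => r rh.
by apply: sub; rewrite mem_cat rh orbT.
Qed.

Lemma bcyl_family_bound N (f : nat -> Omega T -> R) :
  (forall j, (j < N)%N -> bcyl T (f j)) ->
  exists2 M, 0 <= M & forall j w, (j < N)%N -> `|f j w| <= M.
Proof.
elim: N => [|N IH] bf; first by exists 0.
have [M M0 fM] := IH (fun j jN => bf j (ltnW jN)).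
have [S _ [C [C0 fC _]]] := bf N (ltnSn N).
exists (M + C) => [|j w]; first exact: addr_ge0.
rewrite ltnS leq_eqVlt => /orP[/eqP ->|jN]; first by rewrite (le_trans (fC w))// lerDr.
by rewrite (le_trans (fM j w jN))// lerDl.
Qed.

Lemma bcyl_sgn_cut t e (f : Omega T -> R) : bcyl t f ->
  bcyl t (fun w => sgn_cut e (f w)).
Proof.
by move=> bf; apply: bcyl_minc; apply: bcyl_scale; exact: bcyl_maxc.
Qed.

(** Each term is neutral, as its weight is nonnegative and known when the
    interval begins. *)
Lemma EL_compensated s th (a : nat -> Omega T -> R) : itv_partition 0 T s ->
  0 < th -> th < 1 -> (forall j, (j < size s)%N -> bcyl (node s j) (a j)) ->
  (forall j w, 0 <= a j w) ->
  let W := fun p => \sum_(0 <= j < size s) a j p.2 *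
    (dA A (cut th s j) (node s j.+1) p - lam * (node s j.+1 - cut th s j)) in
  Lc E T W /\ EL E W = 0.
Proof.
move=> sP th0 th1 ba a0 W.
have HY j : (j < size s)%N -> Lc E (node s j.+1) (fun p => a j p.2 *
      (dA A (cut th s j) (node s j.+1) p -
       lam * (node s j.+1 - cut th s j))) /\
    neutral E (node s j) (fun p => a j p.2 *
      (dA A (cut th s j) (node s j.+1) p -
       lam * (node s j.+1 - cut th s j))).
  move=> js; have [b1 b2 b3 b4] := cut_bounds th0 th1 sP js.
  have c0 := le_lt_trans b1 b2; have bac := bcyl_le (ltW b2) (ba j js).
  split.
    apply: (Lc_bmul gb b4); first exact: (bcyl_le (ltW b3)).
    apply: (Lc_sub gb b4); last exact: (Lc_cst gb).
    by apply: (Lc_dA gb A_indep) => //; exact: ltW.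
  apply: (neutral_le (ltW b2)).
  rewrite -(A_mean (ltW c0) (ltW b3) b4).
  exact: (neutral_dA gb A_indep c0 b3 b4 bac).
have nodeT i : (i <= size s)%N -> node s i <= T.
  by move=> /(node_bounds sP)/andP[].
have nW : neutral E (node s 0) W.
  apply: (neutral_sum gb (s := node s)) => // i js.
  by rewrite (node_le sP).
split.
  apply: (Lc_sum gb TT) => j js; have [hL _] := HY j js.
  by apply: Lc_le hL; exact: nodeT.
have := nW (fun=> 0) (Lc_cst gb _ 0).
by under eq_fun do rewrite add0r; move=> ->; exact: (sexp_cst sEL).
Qed.

Lemma Lc_tint s (g : R -> Omega T -> R) :
  (forall j, (j < size s)%N -> bcyl T (g (node s j.+1))) ->
  Lc E T (fun p => tint s g p.2).
Proof.
by move=> bg; apply: (Lc_snd gb); apply: bcyl_cyl; exact: bcyl_tint.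
Qed.

(** Insertion for the integral of a function [F] of [h n], on a partition that
    also refines a second approximation [h n1], chosen after [th]. *)
Lemma insertion_step (F : R -> R) n s kap : 0 < kap -> refines s n ->
  (forall t f, bcyl (T := T) t f -> bcyl t (fun w => F (f w))) ->
  exists th, 0 < th < 1 /\ forall n1, exists q, [/\ refines q n, refines q n1 &
    forall Y : nat -> nat * Omega T -> R, (forall j, (j < size q)%N ->
      Lc E (node q j.+1) (Y j) /\ neutral E (cut th q j) (Y j)) ->
    E (tint s (fun r w => F (X n r w))) <=
    EL E (fun p => tint q (fun r w => F (X n r w)) p.2 +
      \sum_(0 <= j < size q) Y j p) + kap].
Proof.
move=> kap0 sn bF; have [sP ssub] := sn.
pose f r w := F (X n r w).
have bPhi : bcyl T (tint s f).
  by apply: bcyl_tint => j js; apply: bF; exact: (refines_valT sn js).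
have [th [/andP[th0 th1] [S ST ins]]] := insertion T0 gb bPhi kap0.
exists th; split=> [|n1]; first by rewrite th0.
have sST r : r \in s ++ S -> 0 <= r <= T.
  rewrite mem_cat => /orP[rs|/ST//].
  have /mem_node[i im ->] : r \in 0 :: s by rewrite in_cons rs orbT.
  exact: (node_bounds sP).
have [q [qn qn1 qsub]] := common_refinement2 n n1 sST.
exists q; split=> // Y HY.
have sq : {subset s <= q}.
  by apply: (subset_pos sP) => r rs; apply: qsub; rewrite mem_cat rs.
have Sq : {subset S <= 0 :: q}.
  by move=> r rS; apply: qsub; rewrite mem_cat rS orbT.
have <- : tint s f = tint q f; last exact: ins qn.1 Sq Y HY.
apply/funext => w; apply: (tint_refine sP qn.1 sq).
by apply: (is_step_map (fun x _ => F x) (g' := fun r => X n r w)); exact: sp_step.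
Qed.

(** The last parts of the intervals carry [M] times the compensated increments
    of the quadratic variation, which forces maximal volatility there. Where
    [h] exceeds [c], the increment of [A] would then exceed [lam] times the
    length, but its compensated increments have mean zero. *)
Lemma integrand_le kap : 0 < kap -> exists n0 : nat, forall n s, (n0 <= n)%N ->
  refines s n -> E (tint s (fun r w => Num.max (X n r w - c) 0)) <= kap.
Proof.
move=> kap0; have k4 : 0 < kap / 4 by rewrite divr_gt0.
have [n0 n0P] := h_cauchy1 T0 gb beta1 h_M k4; exists n0 => n s nn sn.
have [|th [/andP[th0 th1] ins]] := @insertion_step (fun x => Num.max (x - c) 0) n s _ k4 sn.
  move=> t f bf; apply: bcyl_maxc; apply: bcyl_sub => //; exact: bcyl_cst.
pose f r w := Num.max (X n r w - c) 0.
have [n1' n1'P] := h_cauchy1 T0 gb beta1 h_M (mulr_gt0 th0 k4).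
pose n1 := maxn n0 n1'.
have n01 : (n0 <= n1)%N by exact: leq_maxl.
have n11 : (n1' <= n1)%N by exact: leq_maxr.
have [q [qn qn1 insq]] := ins n1; have qP := qn.1.
pose N := size q; pose D j := node q j.+1 - node q j.
have D0 j : (j < N)%N -> 0 <= D j by move=> jN; rewrite subr_ge0 (node_le qP).
have cutD j : node q j.+1 - cut th q j = th * D j by rewrite /cut /D; ring.
pose xi j w := X n1 (node q j.+1) w.
have bxi j : (j < N)%N -> bcyl T (xi j) by exact: (refines_valT qn1).
have [M M0 hM] := bcyl_family_bound (fun j jN => bcyl_scale (th * v)^-1 (bxi j jN)).
pose dQ j (p : nat * Omega T) := Q (node q j.+1) p.1 p.2 - Q (cut th q j) p.1 p.2.
pose Y j (p : nat * Omega T) := M * (dQ j p - v * (node q j.+1 - cut th q j)).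
have HY j : (j < N)%N -> Lc E (node q j.+1) (Y j) /\ neutral E (cut th q j) (Y j).
  move=> jN; have [b1 b2 b3 b4] := cut_bounds th0 th1 qP jN.
  have c0 := le_trans b1 (ltW b2).
  split; last exact: (neutral_dQ gb Qqv c0 b3 b4 M0).
  apply: (Lc_scale gb _ b4); apply: (Lc_sub gb b4); last exact: (Lc_cst gb).
  exact: (Lc_dQ gb Qqv c0 b3 b4).
apply: (le_trans (insq Y HY)).
pose e1 := kap / (4 * T); have e10 : 0 < e1 by rewrite divr_gt0// mulr_gt0.
pose a j w := if (j < N)%N then sgn_cut e1 (xi j w - c) else 0.
have a01 j w : 0 <= a j w <= 1.
  by rewrite /a; case: ifP => _; [exact: sgn_cut_bounds | rewrite lexx ler01].
have ba j : (j < N)%N -> bcyl (node q j) (a j).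
  move=> jN; rewrite /a jN; apply: bcyl_sgn_cut; apply: bcyl_sub.
    exact: (refines_val qn1).
  exact: bcyl_cst.
have nodeT j : (j <= N)%N -> node q j <= T by move=> /(node_bounds qP)/andP[].
have [L3 E3] := EL_compensated qP th0 th1 ba (fun j w => proj1 (andP (a01 j w))).
have a1 j w : `|a j w| <= 1 by have /andP[a0 a1] := a01 j w; rewrite ger0_norm.
have [L4 E4] := integral_approx T0 gb Qqv A_int
  (fun m s' n1m s'm s'n1 => n1'P m n1 s' (leq_trans n11 n1m) n11 s'm s'n1)
  qn1 th0 th1 (fun j jN => bcyl_le (nodeT j (ltnW jN)) (ba j jN)) a1.
have albe j : (j < N)%N -> [/\ 0 <= cut th q j, cut th q j < node q j.+1 &
    node q j.+1 <= T].
  move=> jN; have [b1 b2 b3 b4] := cut_bounds th0 th1 qP jN.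
  by rewrite (le_trans b1 (ltW b2)).
have [L5 E5] := EL_sum_excess gb Qqv albe (fun j _ => bcyl_cst T (2 * M)).
have L1 := Lc_tint (g := fun r w => `|X n r w - X n1 r w|) (fun j (jN : (j < N)%N) =>
  bcyl_abs (bcyl_sub (refines_valT qn jN) (refines_valT qn1 jN))).
have E1 := n0P n n1 q nn n01 qn qn1.
set W1 := fun p : nat * Omega T => tint q _ p.2 in L1.
set W3 := fun p => \sum_(_ <= _ < _) _ in L3 E3.
set W4 := fun p => \sum_(_ <= _ < _) _ in L4 E4.
set W5 := fun p => \sum_(_ <= _ < _) _ in L5 E5.
have thv : 0 <= (th * v)^-1 by rewrite invr_ge0 ltW// mulr_gt0.
have L3' := Lc_scale gb (th * v)^-1 TT L3.
have L4' := Lc_scale gb (th * v)^-1 TT L4.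
have L1' := Lc_add gb TT L1 (Lc_cst gb T (e1 * T)).
have LZ := Lc_add gb TT (Lc_add gb TT (Lc_add gb TT L1' L3') L4') L5.
have LPhi := Lc_tint (g := f) (fun j (jN : (j < N)%N) =>
  bcyl_maxc 0 (bcyl_sub (refines_valT qn jN) (bcyl_cst T c))).
have LY : Lc E T (fun p => \sum_(0 <= j < N) Y j p).
  apply: (Lc_sum gb TT) => j jN; have [hL _] := HY j jN.
  by apply: Lc_le hL; exact: nodeT.
have le_Z : EL E (fun p => tint q f p.2 + \sum_(0 <= j < N) Y j p) <=
    EL E (fun p => W1 p + e1 * T + (th * v)^-1 * W3 p + (th * v)^-1 * W4 p + W5 p).
  apply: (sexp_monotone sEL) => [|//|p]; first exact: (Lc_add gb TT).
  rewrite /tint /W1 /W3 /W4 /W5 /tint.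
  have -> : e1 * T = \sum_(0 <= j < N) e1 * D j.
    rewrite -mulr_sumr telescope_sumr//; congr (_ * _).
    by rewrite (node_last qP) /node /= subr0.
  rewrite ![_^-1 * \sum_(_ <= _ < _) _]mulr_sumr -!big_split /= !big_nat.
  apply: ler_sum => j /= jN; have [b1 b2 b3 b4] := cut_bounds th0 th1 qP jN.
  have /andP[_ q2] := @dQ_bounds R T v Q (cut th q j) (node q j.+1) p.
  have ex0 := @excess_ge0 R T v Q (cut th q j) (node q j.+1) p.
  rewrite /Y /dQ cutD in q2 *; rewrite lamE.
  have aE : a j p.2 = sgn_cut e1 (xi j p.2 - c) by rewrite /a jN.
  have M2 : `|2 * M| = 2 * M by rewrite ger0_norm// mulr_ge0.
  have hmax : Num.max (xi j p.2 - c) 0 <= a j p.2 * (xi j p.2 - c) + e1.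
    by rewrite aE; exact: sgn_cut_le.
  rewrite M2; exact: (@upper_step R v th c (D j) e1 (a j p.2)
    (X n (node q j.+1) p.2) (xi j p.2)
    (Q (node q j.+1) p.1 p.2 - Q (cut th q j) p.1 p.2)
    (dA A (cut th q j) (node q j.+1) p) M
    (excess v Q (cut th q j) (node q j.+1) p)
    v0 th0 (D0 j jN) M0 (a01 j p.2) ex0 hmax (hM j p.2 jN) q2).
have EZ : EL E (fun p => W1 p + e1 * T + (th * v)^-1 * W3 p +
    (th * v)^-1 * W4 p + W5 p) <= kap / 4 + kap / 4 + 0 + kap / 4 + 0.
  apply: le_trans (sexp_add sEL (Lc_add gb TT (Lc_add gb TT L1' L3') L4') L5) _.
  apply: lerD; last exact: E5.
  apply: le_trans (sexp_add sEL (Lc_add gb TT L1' L3') L4') _.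
  apply: lerD; last first.
    rewrite (sexp_homogeneous sEL thv L4); apply: le_trans (ler_wpM2l thv E4) _.
    by rewrite le_eqVlt; apply/orP; left; apply/eqP; field; rewrite !gt_eqF.
  apply: le_trans (sexp_add sEL L1' L3') _.
  apply: lerD; last by rewrite (sexp_homogeneous sEL thv L3) E3 mulr0.
  rewrite (sexp_addc sEL _ L1); apply: lerD.
    by rewrite (EL_snd (tint q _)).
  by rewrite le_eqVlt; apply/orP; left; apply/eqP; rewrite /e1; field; rewrite gt_eqF.
have := le_trans le_Z EZ; rewrite -/N; lra.
Qed.

(** The last parts carry the compensated increments of [A] itself: [A] attains
    the mean [lam], which is the largest possible one when [h] is at most [c],
    so that [h] cannot fall below [c]. *)
Lemma integrand_ge kap : 0 < kap -> exists n0 : nat, forall n s, (n0 <= n)%N ->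
  refines s n -> E (tint s (fun r w => Num.max (c - X n r w) 0)) <= kap.
Proof.
move=> kap0; have k6 : 0 < kap / 6 by rewrite divr_gt0.
have [n0 n0P] := h_cauchy1 T0 gb beta1 h_M k6; exists n0 => n s nn sn.
have [|th [/andP[th0 th1] ins]] := @insertion_step (fun x => Num.max (c - x) 0) n s _ k6 sn.
  move=> t f bf; apply: bcyl_maxc; apply: bcyl_sub => //; exact: bcyl_cst.
pose f r w := Num.max (c - X n r w) 0.
have [n1' n1'P] := h_cauchy1 T0 gb beta1 h_M (mulr_gt0 th0 k6).
have [n2 n2P] := integrand_le k6.
have [n3 n3P] := h_neg T0 gb beta1 h_ge0 k6.
pose n1 := maxn (maxn n0 n1') (maxn n2 n3).
have /andP[/andP[n01 n11] /andP[n21 n31]] :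
  [&& ((n0 <= n1) && (n1' <= n1))%N, (n2 <= n1)%N & (n3 <= n1)%N].
  by rewrite -!geq_max.
have [q [qn qn1 insq]] := ins n1; have qP := qn.1.
pose N := size q; pose D j := node q j.+1 - node q j.
have D0 j : (j < N)%N -> 0 <= D j by move=> jN; rewrite subr_ge0 (node_le qP).
have cutD j : node q j.+1 - cut th q j = th * D j by rewrite /cut /D; ring.
have thv : 0 <= (th * v)^-1 by rewrite invr_ge0 ltW// mulr_gt0.
pose Y j (p : nat * Omega T) := (th * v)^-1 *
  (dA A (cut th q j) (node q j.+1) p - lam * (node q j.+1 - cut th q j)).
have HY j : (j < N)%N -> Lc E (node q j.+1) (Y j) /\ neutral E (cut th q j) (Y j).
  move=> jN; have [b1 b2 b3 b4] := cut_bounds th0 th1 qP jN.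
  have c0 := le_lt_trans b1 b2.
  split.
    apply: (Lc_scale gb _ b4); apply: (Lc_sub gb b4); last exact: (Lc_cst gb).
    by apply: (Lc_dA gb A_indep) => //; exact: ltW.
  rewrite /Y -(A_mean (ltW c0) (ltW b3) b4).
  exact: (neutral_dA gb A_indep c0 b3 b4 (bcyl_cst _ _) (fun=> thv)).
apply: (le_trans (insq Y HY)).
have [L4 E4] := integral_approx T0 gb Qqv A_int
  (fun m s' n1m s'm s'n1 => n1'P m n1 s' (leq_trans n11 n1m) n11 s'm s'n1)
  qn1 th0 th1 (fun j _ => bcyl_cst T (-1))
  (fun _ _ => eq_ind_r (fun x => x <= 1) (lexx 1) (normrN1 R)).
have albe j : (j < N)%N -> [/\ 0 <= cut th q j, cut th q j < node q j.+1 &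
    node q j.+1 <= T].
  move=> jN; have [b1 b2 b3 b4] := cut_bounds th0 th1 qP jN.
  by rewrite (le_trans b1 (ltW b2)).
have bX j : (j < N)%N -> bcyl T (X n1 (node q j.+1)) by exact: (refines_valT qn1).
have [L5 E5] := EL_sum_excess gb Qqv albe bX.
have L1 := Lc_tint (g := fun r w => `|X n r w - X n1 r w|) (fun j (jN : (j < N)%N) =>
  bcyl_abs (bcyl_sub (refines_valT qn jN) (bX j jN))).
have E1 := n0P n n1 q nn n01 qn qn1.
have L2 := Lc_tint (g := fun r w => Num.max (X n1 r w - c) 0)
  (fun j (jN : (j < N)%N) => bcyl_maxc 0 (bcyl_sub (bX j jN) (bcyl_cst T c))).
have E2 := n2P n1 q n21 qn1.
have L3 := Lc_tint (g := fun r w => `|Num.max (- X n1 r w) 0|)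
  (fun j (jN : (j < N)%N) => bcyl_abs (bcyl_maxc 0 (bcyl_opp (bX j jN)))).
have E3 := n3P n1 q n31 qn1.
set W1 := fun p : nat * Omega T => tint q _ p.2 in L1.
set W2 := fun p : nat * Omega T => tint q _ p.2 in L2.
set W3 := fun p : nat * Omega T => tint q _ p.2 in L3.
set W4 := fun p => \sum_(_ <= _ < _) _ in L4 E4.
set W5 := fun p => \sum_(_ <= _ < _) _ in L5 E5.
have L3' := Lc_scale gb 2 TT L3.
have L4' := Lc_scale gb (th * v)^-1 TT L4.
have L5' := Lc_scale gb (th * v)^-1 TT L5.
have L12 := Lc_add gb TT L1 L2.
have L123 := Lc_add gb TT L12 L3'.
have L1234 := Lc_add gb TT L123 L4'.
have LPhi := Lc_tint (g := f) (fun j (jN : (j < N)%N) =>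
  bcyl_maxc 0 (bcyl_sub (bcyl_cst T c) (refines_valT qn jN))).
have LY : Lc E T (fun p => \sum_(0 <= j < N) Y j p).
  apply: (Lc_sum gb TT) => j jN; have [hL _] := HY j jN.
  by apply: Lc_le hL; have /andP[] := node_bounds qP jN.
have le_Z : EL E (fun p => tint q f p.2 + \sum_(0 <= j < N) Y j p) <=
    EL E (fun p => W1 p + W2 p + 2 * W3 p + (th * v)^-1 * W4 p +
      (th * v)^-1 * W5 p).
  apply: (sexp_monotone sEL) => [||p]; [exact: (Lc_add gb TT)|exact: (Lc_add gb TT)|].
  rewrite /W1 /W2 /W3 /W4 /W5 /tint.
  rewrite 2![_^-1 * \sum_(_ <= _ < _) _]mulr_sumr [2 * \sum_(_ <= _ < _) _]mulr_sumr.
  rewrite -!big_split /= !big_nat.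
  apply: ler_sum => j /= jN; have [b1 b2 b3 b4] := cut_bounds th0 th1 qP jN.
  have /andP[q1 q2] := @dQ_bounds R T v Q (cut th q j) (node q j.+1) p.
  have ex0 := @excess_ge0 R T v Q (cut th q j) (node q j.+1) p.
  rewrite /Y cutD in q2 *; rewrite lamE.
  exact: (@lower_step R v th c (D j)
    (X n (node q j.+1) p.2) (X n1 (node q j.+1) p.2)
    (Q (node q j.+1) p.1 p.2 - Q (cut th q j) p.1 p.2)
    (dA A (cut th q j) (node q j.+1) p)
    (excess v Q (cut th q j) (node q j.+1) p)
    v0 th0 (D0 j jN) ex0 q1 q2).
have EZ : EL E (fun p => W1 p + W2 p + 2 * W3 p + (th * v)^-1 * W4 p +
    (th * v)^-1 * W5 p) <= kap / 6 + kap / 6 + 2 * (kap / 6) + kap / 6 + 0.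
  apply: le_trans (sexp_add sEL L1234 L5') _.
  apply: lerD; last first.
    by rewrite (sexp_homogeneous sEL thv L5) mulr_ge0_le0.
  apply: le_trans (sexp_add sEL L123 L4') _.
  apply: lerD; last first.
    rewrite (sexp_homogeneous sEL thv L4); apply: le_trans (ler_wpM2l thv E4) _.
    by rewrite le_eqVlt; apply/orP; left; apply/eqP; field; rewrite !gt_eqF.
  apply: le_trans (sexp_add sEL L12 L3') _.
  apply: lerD; last first.
    by rewrite (sexp_homogeneous sEL (ler0n R 2) L3) ler_wpM2l// (EL_snd (tint q _)).
  apply: le_trans (sexp_add sEL L1 L2) _.
  by apply: lerD; rewrite (EL_snd (tint q _)).
have := le_trans le_Z EZ; rewrite -/N; lra.
Qed.

Lemma sp_integral_at0 eta n w : sp_integral Q eta 0 n w = 0 :> R.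
Proof.
rewrite /sp_integral big_nat big1// => j /= js.
have m0 i : (i <= size (sp_times eta))%N -> Num.min (node (sp_times eta) i) 0 = 0.
  by move=> /(node_bounds (sp_partition eta))/andP[i0 _]; exact: min_r.
by rewrite !m0 ?subrr ?mulr0// ltnW.
Qed.

(** By both bounds on the integrand, [h n] tends to [c] in M^1, hence its
    integral tends to [c] times the quadratic variation. *)
Lemma integral_constant t : 0 <= t <= T ->
  EL E (fun p => `|A t p.1 p.2 - c * Q t p.1 p.2|) = 0.
Proof.
move=> tT; have zT : 0 <= (0 : R) <= T by rewrite lexx ltW.
have /andP[t0 t1] := tT.
have LQT u : 0 <= u <= T -> Lc E T (fun p => Q u p.1 p.2).
  by move=> uT; have := Lc_Q Qqv uT; have /andP[_ h1] := uT; exact: Lc_le.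
have LAQ : Lc E T (fun p => `|A t p.1 p.2 - c * Q t p.1 p.2|).
  apply: (Lc_abs gb TT); apply: (Lc_sub gb TT); first exact: (Lc_AT A_int).
  by apply: (Lc_scale gb _ TT); exact: LQT.
apply/eqP; rewrite eq_le (sexp_ge0 sEL LAQ) ?andbT//.
apply/ler_addgt0Pr => e e0; rewrite add0r.
have e2 : 0 < e / 2 by rewrite divr_gt0.
have e4v : 0 < e / (4 * v) by rewrite divr_gt0// mulr_gt0.
have LT r : r \in [:: 0; t] -> 0 <= r <= T by rewrite !inE => /orP[] /eqP ->.
have [n1 n1P] := gap_small A_int e2 LT.
have [n2 n2P] := integrand_le e4v; have [n3 n3P] := integrand_ge e4v.
pose n := maxn n1 (maxn n2 n3).
have /and3P[n1n n2n n3n] : [&& (n1 <= n)%N, (n2 <= n)%N & (n3 <= n)%N].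
  by rewrite -!geq_max.
have [s [sn sub]] := common_refinement (h := h) T0 n LT.
have [i0 it] : 0 \in 0 :: s /\ t \in 0 :: s.
  by split; apply: sub; rewrite !inE eqxx ?orbT.
pose d l w := X n (node s l.+1) w - c.
have bX l : (l < size s)%N -> bcyl T (X n (node s l.+1)) by exact: (refines_valT sn).
have bd l : (l < size s)%N -> bcyl T (d l).
  by move=> ls; apply: bcyl_sub; [exact: bX | exact: bcyl_cst].
have [LB EB] := EL_window_bound gb Qqv sn.1 bd.
have Lg := Lc_gap gb Qqv A_int n tT.
have LQ0 := Lc_scale gb `|c| TT (Lc_abs gb TT (LQT 0 zT)).
have gE : EL E (fun p => `|A t p.1 p.2 - sp_integral Q (h n) t p.1 p.2|) <= e / 2.
  by apply: n1P => //; rewrite !inE eqxx orbT.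
have dE : E (fun w => \sum_(0 <= l < size s) `|d l w| * (node s l.+1 - node s l)) <=
    e / (4 * v) + e / (4 * v).
  apply: le_trans (lerD (n2P n s n2n sn) (n3P n s n3n sn)).
  have c1 : cyl T (tint s (fun r w => Num.max (X n r w - c) 0)).
    apply/bcyl_cyl/bcyl_tint => l ls.
    by apply: bcyl_maxc; apply: bcyl_sub; [exact: bX | exact: bcyl_cst].
  have c2 : cyl T (tint s (fun r w => Num.max (c - X n r w) 0)).
    apply/bcyl_cyl/bcyl_tint => l ls.
    by apply: bcyl_maxc; apply: bcyl_sub; [exact: bcyl_cst | exact: bX].
  apply: le_trans (sexp_add sE c1 c2); rewrite /tint.
  rewrite le_eqVlt; apply/orP; left; apply/eqP; congr E; apply/funext => w.
  rewrite -big_split /=; apply: eq_bigr => l _; rewrite -mulrDl; congr (_ * _).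
  rewrite /d (max_subC (X n (node s l.+1) w) c); have [x0|x0] := leP (X n (node s l.+1) w - c) 0.
    by rewrite (ler0_norm x0) add0r sub0r.
  by rewrite (gtr0_norm x0) subrr addr0.
apply: le_trans (_ : EL E (fun p => `|A t p.1 p.2 - sp_integral Q (h n) t p.1 p.2| +
    \sum_(0 <= l < size s) `|d l p.2| * (v * (node s l.+1 - node s l) +
      exc (node s l) (node s l.+1) p) + `|c| * `|Q 0 p.1 p.2|) <= _).
  apply: (sexp_monotone sEL) => // [|p].
    by apply: (Lc_add gb TT) => //; exact: (Lc_add gb TT).
  have wb := @window_bound R T E v K gb Q s sn.1 (d^~ p.2) 1 (fun=> 0) (fun=> t)
    (fun=> 1) p.
  rewrite !big_nat1 mul1r in wb.
  apply: le_trans (_ : `|A t p.1 p.2 - sp_integral Q (h n) t p.1 p.2| +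
    `|\sum_(0 <= l < size s) d l p.2 * (win 0 t (node s l.+1) *
       (Q (node s l.+1) p.1 p.2 - Q (node s l) p.1 p.2))| +
    `|c * Q 0 p.1 p.2| <= _); last first.
    rewrite normrM lerD2r lerD2l; apply: wb => r; rewrite big_nat1 mul1r.
    by rewrite ger0_norm ?win_ge0// /win lern1 leq_b1.
  have := sp_integral_window sn.1 sn.2 Q p.1 p.2 i0 it t0.
  rewrite sp_integral_at0 subr0 => wI.
  have wQ := window_cst sn.1 (fun r => Q r p.1 p.2) i0 it t0.
  have -> : \sum_(0 <= l < size s) d l p.2 * (win 0 t (node s l.+1) *
       (Q (node s l.+1) p.1 p.2 - Q (node s l) p.1 p.2)) =
     sp_integral Q (h n) t p.1 p.2 - c * (Q t p.1 p.2 - Q 0 p.1 p.2).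
    rewrite wQ wI mulr_sumr -sumrB.
    by apply: eq_bigr => l _; rewrite /d mulrBl.
  move: (sp_integral _ _ _ _ _) (Q t _ _) (Q 0 _ _) (A t _ _) => x q q0 a.
  have -> : a - c * q = (a - x) + (x - c * (q - q0)) - c * q0 by ring.
  by apply: le_trans (ler_normB _ _) _; rewrite lerD2r ler_normD.
apply: le_trans (sexp_add sEL (Lc_add gb TT Lg LB) LQ0) _.
rewrite (sexp_homogeneous sEL (normr_ge0 c) (Lc_abs gb TT (LQT 0 zT))).
rewrite (EL_Q0 T0 gb Qqv) mulr0 addr0.
apply: le_trans (sexp_add sEL Lg LB) _.
have := le_trans EB (ler_wpM2l (ltW v0) dE).
have -> : v * (e / (4 * v) + e / (4 * v)) = e / 2 by field; rewrite gt_eqF.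
lra.
Qed.
End ConstantIntegrand.

Unset Implicit Arguments.

Theorem theorem3p6 (R : realType) (T slo shi beta : R)
    (E : (Omega T -> R) -> R) (Q : R -> rvseq T)
    (h : nat -> simple_process T) (A : R -> rvseq T)
    (T_gt0 : 0 < T) (slo_gt0 : 0 < slo) (slo_lt_shi : slo < shi)
    (E_G : G_expectation slo shi E)
    (Q_qv : quadratic_variation E Q)
    (beta_gt1 : 1 < beta)
    (h_M : MG E beta h) (h_ge0 : MG_nonneg E beta h)
    (A_int : forall t, 0 <= t <= T -> is_integral E Q h t (A t))
    (A_stat : stationary_increments E A)
    (A_indep : independent_increments E A) :
  exists2 c : R, 0 <= c &
    forall t, 0 <= t <= T -> L1G_eq E (A t) (fun n w => c * Q t n w).
Proof.
have shi0 : 0 < shi by exact: lt_trans slo_gt0 slo_lt_shi.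
have [K gb] := G_expectation_brownian T_gt0 shi0 E_G.
have A_pos0 := A_pos T_gt0 gb Q_qv beta_gt1 h_ge0 A_int.
have [lam lam0 A_mean] := A_mean T_gt0 gb A_stat A_indep A_pos0.
exists (lam / shi ^+ 2) => [|t tT]; first by rewrite divr_ge0// sqr_ge0.
have tT1 : t <= T by have /andP[] := tT.
have LQ := Lc_le tT1 (Lc_Q Q_qv tT).
have L0 : Lc E T (fun p => `|A t p.1 p.2 - lam / shi ^+ 2 * Q t p.1 p.2|).
  apply: (Lc_abs gb (lexx T)); apply: (Lc_sub gb (lexx T)).
    exact: (Lc_AT A_int).
  exact: (Lc_scale gb _ (lexx T)).
have := EL_cvg gb L0.
by rewrite (integral_constant T_gt0 gb Q_qv beta_gt1 h_M h_ge0 A_int A_indep A_mean tT).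
Qed.
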